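(* Let $\zeta$ denote the Riemann zeta function and, for real $k>0$ and $T>0$, let $$M_k(T)=\int_0^T |\zeta(\tfrac12+it)|^{2k}\,dt .$$ Then for any real number $k>1$ and all sufficiently large $T$ (depending on $k$), $$M_k(T)\ge e^{-30k^4}\,T(\log T)^{k^2}.$$ *)

(* Defs.v *)
From Stdlib Require Import Reals.
From Coquelicot Require Import Coquelicot.

Open Scope R_scope.

Definition Cexp (z : C) : C :=
  (exp (Re z) * cos (Im z), exp (Re z) * sin (Im z)).

(* n^{-s} = exp (- s log n), meaningful for n >= 1 *)
Definition dirichlet_term (s : C) (n : nat) : C :=
  Cexp (Copp (Cmult s (RtoC (ln (INR n))))).

Definition analytic_at (f : C -> C) (z0 : C) : Prop :=
  exists (a : nat -> C) (r : R), 0 < r /\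
    forall z : C, Cmod (Cminus z z0) < r ->
      is_pseries (K := C_AbsRing) (V := C_NormedModule) a (Cminus z z0) (f z).

(* zeta is the analytic continuation to C \ {1} of the Dirichlet series
   sum_{n >= 1} n^{-s} (Re s > 1). As C \ {1} is connected, this determines
   zeta everywhere except at the pole s = 1, where its value is left free. *)
Definition is_riemann_zeta (zeta : C -> C) : Prop :=
  (forall s : C, 1 < Re s ->
     is_series (K := C_AbsRing) (V := C_NormedModule)
       (fun n : nat => dirichlet_term s (S n)) (zeta s)) /\
  (forall s : C, s <> RtoC 1 -> analytic_at zeta s).

(* x^y for x >= 0 and y > 0. Rpower alone would give Rpower 0 y = 1, because
   ln 0 = 0 in Stdlib; here 0^y = 0, which matters at the zeros of zeta. *)
Definition rpow (x y : R) : R :=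
  if Rlt_dec 0 x then Rpower x y else 0.

(* For k > 0 the integrand is continuous in t, so RInt is the genuine
   Riemann integral. *)
Definition zeta_moment (zeta : C -> C) (k T : R) : R :=
  RInt (fun t : R => rpow (Cmod (zeta (1 / 2, t))) (2 * k)) 0 T.

(* Main.v *)
Require Import Defs.
From Stdlib Require Import Reals Lra Lia Psatz List Factorial IndefiniteDescription.
From mathcomp Require ssrbool eqtype ssrnat seq div prime binomial.
From Coquelicot Require Import Coquelicot.
Import ListNotations.
Open Scope R_scope.

(** Let [q = 2k/(k-1)]. For Dirichlet polynomials [A] and [B], Hoelder's inequality bounds
    the integral of [zeta B conj(A)] over [T/2, T] by the product of the norms of [zeta] in
    [L^2k], of [A] in [L^2] and of [B] in [L^q]. Ideally [A = exp (k P)] and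
    [B = exp ((k-1) P)], where [P] is the sum of [p^(-1/2-it)] over primes. The primes up to
    a small power of [T] are split into the ranges [(2^(2^i), 2^(2^(i+1))]], on each of which
    the sum of [1/p] is bounded, and both exponentials are replaced on each range by Taylor
    polynomials in the partial sum over that range. With [T] about [2^(2^L)] and [n = L - i],
    the degree [4 n^2] is so large that the truncation errors are summable, and so small that
    the total length of the polynomials remains a small power of [T]; hence only diagonal
    terms matter, and these factor over the ranges. Where the partial sum is large, [|B|^q]
    is bounded by a high moment of it, which is again the square of a Dirichlet polynomial.
    For [n] below [2k^2/(k-1)] one takes [B = 1] instead, which keeps the loss bounded as
    [k] tends to [1].

    On the critical line [zeta] is approximated by a partial sum of length [T^(3/2)], by the
    midpoint rule for the Dirichlet series and uniqueness of analytic continuation. *)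

(** * Complex series and truncated exponentials *)

(** Hoelder's inequality bounds the moment below by about T exp (2k lg - k lv - (k-1) lw), where lg,
    lv and lw are the logarithms of the mean values of zeta B conj(A), |A|^2 and |B|^q. On a range
    where the sum of 1/p is S, B = exp ((k-1) P) makes all three about k^2 S, and the combination is
    again k^2 S: nothing is lost. With B = 1 they are k S, k^2 S and 0, which loses k^2 (k-1) S.
    This is the price when n is below 2k^2/(k-1), because there the degree 4 n^2 (k-1)/k that is
    appropriate for B is too small. As S <= 2 and fewer than 2k^2/(k-1) ranges are concerned, the
    total loss is at most 4k^4.

    Two sets of primes are left out: those up to 2^(2^i0) with i0 about k, where the squares of 1/p
    would matter, and the last ranges, with n up to about 16k^2, where the degree 4 n^2 does not yet
    give small errors and the length would exceed a small power of T. The latter lower the prime sum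
    by about 16 k^2 ln 2; multiplied by k^2, this is the main part of the constant 30 k^4. *)

Fixpoint csum (a : nat -> C) (n : nat) : C :=
  match n with O => RtoC 0 | S n' => Cplus (csum a n') (a n') end.

Lemma csum_S (a : nat -> C) (n : nat) : csum a (S n) = Cplus (csum a n) (a n).
Proof. reflexivity. Qed.

Lemma csum_ext (a b : nat -> C) (n : nat) :
  (forall i, (i < n)%nat -> a i = b i) -> csum a n = csum b n.
Proof.
  induction n as [|n IH]; intros H; simpl; [reflexivity|].
  rewrite IH, (H n) by (intros; auto with arith). reflexivity.
Qed.

Lemma csum_plus (a b : nat -> C) (n : nat) :
  csum (fun i => Cplus (a i) (b i)) n = Cplus (csum a n) (csum b n).
Proof.
  induction n as [|n IH]; simpl; [|rewrite IH]; ring.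
Qed.

Lemma csum_scal (c : C) (a : nat -> C) (n : nat) :
  csum (fun i => Cmult c (a i)) n = Cmult c (csum a n).
Proof.
  induction n as [|n IH]; simpl; [|rewrite IH]; ring.
Qed.

Lemma csum_sum_n (a : nat -> C) (n : nat) :
  csum a (S n) = sum_n (G := C_AbelianMonoid) a n.
Proof.
  induction n as [|n IH].
  - rewrite sum_O. simpl. ring.
  - rewrite sum_Sn, <- IH. reflexivity.
Qed.

(** The majorant is written as the real part of a [csum], so that the algebra of [csum] serves for
    real sums as well. *)
Lemma Cmod_csum (a : nat -> C) (b : nat -> R) (n : nat) :
  (forall i, (i < n)%nat -> Cmod (a i) <= b i) ->
  Cmod (csum a n) <= Re (csum (fun i => RtoC (b i)) n).
Proof.
  induction n as [|n IH]; intros H; simpl.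
  - rewrite Cmod_0. lra.
  - eapply Rle_trans; [apply Cmod_triangle|].
    specialize (H n (Nat.lt_succ_diag_r n)) as Hn.
    assert (IH' := IH (fun i Hi => H i (Nat.lt_lt_succ_r _ _ Hi))).
    unfold Re in *. lra.
Qed.

Definition cseries (a : nat -> C) (l : C) : Prop :=
  forall eps, 0 < eps -> exists N, forall n, (N <= n)%nat ->
    Cmod (Cminus (csum a n) l) < eps.

Lemma cseries_is_series (a : nat -> C) (l : C) :
  is_series (K := C_AbsRing) (V := C_NormedModule) a l <-> cseries a l.
Proof.
  split.
  - intros H eps Heps.
    destruct (proj1 (filterlim_locally_ball_norm (K := C_AbsRing) (U := C_NormedModule)
        (F := eventually) _ _) H (mkposreal eps Heps)) as [N HN].
    (* Off by one: [csum a (S n)] is [sum_n a n], because [sum_n] includes its last index. *)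
    exists (S N). intros [|n] Hn; [lia|].
    assert (HN' := HN n ltac:(lia)). rewrite csum_sum_n. exact HN'.
  - intros H. apply (filterlim_locally_ball_norm (K := C_AbsRing) (U := C_NormedModule)).
    intros [eps Heps]. destruct (H eps Heps) as [N HN].
    exists N. intros n Hn. specialize (HN (S n) ltac:(lia)).
    rewrite csum_sum_n in HN. exact HN.
Qed.

Lemma cseries_unique (a : nat -> C) (l l' : C) :
  cseries a l -> cseries a l' -> l = l'.
Proof.
  intros H H'.
  destruct (Req_dec (Cmod (Cminus l l')) 0) as [E|E].
  - apply Cmod_eq_0 in E. replace l with (Cplus (Cminus l l') l') by ring.
    rewrite E. ring.
  - assert (Hp : 0 < Cmod (Cminus l l') / 2) by (pose proof (Cmod_ge_0 (Cminus l l')); lra).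
    destruct (H _ Hp) as [N HN]. destruct (H' _ Hp) as [N' HN'].
    specialize (HN (N + N')%nat ltac:(lia)). specialize (HN' (N + N')%nat ltac:(lia)).
    set (x := csum a (N + N')) in *.
    assert (Cmod (Cminus l l') <= Cmod (Cminus x l) + Cmod (Cminus x l')).
    { replace (Cminus l l') with (Cplus (Copp (Cminus x l)) (Cminus x l')) by ring.
      eapply Rle_trans; [apply Cmod_triangle|]. rewrite Cmod_opp. lra. }
    lra.
Qed.

Lemma cseries_ext (a b : nat -> C) (l : C) :
  (forall n, a n = b n) -> cseries a l -> cseries b l.
Proof.
  intros E H eps He. destruct (H eps He) as [N HN]. exists N. intros n Hn.
  rewrite <- (csum_ext a b) by auto. auto.
Qed.

Lemma cseries_plus (a b : nat -> C) (l m : C) :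
  cseries a l -> cseries b m -> cseries (fun n => Cplus (a n) (b n)) (Cplus l m).
Proof.
  intros H H' eps He.
  destruct (H (eps / 2) ltac:(lra)) as [N HN]. destruct (H' (eps / 2) ltac:(lra)) as [N' HN'].
  exists (N + N')%nat. intros n Hn. rewrite csum_plus.
  specialize (HN n ltac:(lia)). specialize (HN' n ltac:(lia)).
  replace (Cminus (Cplus (csum a n) (csum b n)) (Cplus l m))
    with (Cplus (Cminus (csum a n) l) (Cminus (csum b n) m)) by ring.
  eapply Rle_lt_trans; [apply Cmod_triangle|]. lra.
Qed.

Lemma cseries_scal (c : C) (a : nat -> C) (l : C) :
  cseries a l -> cseries (fun n => Cmult c (a n)) (Cmult c l).
Proof.
  intros H eps He. pose proof (Cmod_ge_0 c) as Hc.
  destruct (H (eps / (Cmod c + 1))) as [N HN].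
  { apply Rdiv_lt_0_compat; lra. }
  exists N. intros n Hn. rewrite csum_scal. specialize (HN n Hn).
  replace (Cminus (Cmult c (csum a n)) (Cmult c l))
    with (Cmult c (Cminus (csum a n) l)) by ring.
  rewrite Cmod_mult.
  apply Rmult_lt_compat_r with (r := Cmod c + 1) in HN; [|lra].
  unfold Rdiv in HN. rewrite Rmult_assoc, Rinv_l, Rmult_1_r in HN by lra.
  pose proof (Cmod_ge_0 (Cminus (csum a n) l)). nra.
Qed.

Lemma csum_incr (a : nat -> C) (n : nat) :
  csum a (S n) = Cplus (a 0%nat) (csum (fun i => a (S i)) n).
Proof.
  induction n as [|n IH]; [simpl; ring|].
  change (csum a (S (S n))) with (Cplus (csum a (S n)) (a (S n))). rewrite IH. simpl. ring.
Qed.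

Lemma csum_add (a : nat -> C) (m n : nat) :
  csum a (m + n) = Cplus (csum a m) (csum (fun i => a (m + i)%nat) n).
Proof.
  induction n as [|n IH]; simpl.
  - rewrite Nat.add_0_r. ring.
  - rewrite Nat.add_succ_r. simpl. rewrite IH. ring.
Qed.

Lemma cseries_shift (a : nat -> C) (l : C) (m : nat) :
  cseries (fun i => a (m + i)%nat) l <-> cseries a (Cplus (csum a m) l).
Proof.
  split; intros H eps He; destruct (H eps He) as [N HN].
  - exists (m + N)%nat. intros n Hn. specialize (HN (n - m)%nat ltac:(lia)).
    replace n with (m + (n - m))%nat by lia. rewrite csum_add.
    eapply Rle_lt_trans; [|exact HN]. apply Req_le. f_equal. ring.
  - exists N. intros n Hn. specialize (HN (m + n)%nat ltac:(lia)).
    rewrite csum_add in HN.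
    eapply Rle_lt_trans; [|exact HN]. apply Req_le. f_equal. ring.
Qed.

Lemma cseries_bound (a : nat -> C) (l w : C) (K : R) :
  cseries a l ->
  (exists N, forall n, (N <= n)%nat -> Cmod (Cminus (csum a n) w) <= K) ->
  Cmod (Cminus l w) <= K.
Proof.
  intros H [N HN]. apply le_epsilon. intros eps He.
  destruct (H eps He) as [N' HN'].
  specialize (HN (N + N')%nat ltac:(lia)). specialize (HN' (N + N')%nat ltac:(lia)).
  set (x := csum a (N + N')) in *.
  replace (Cminus l w) with (Cplus (Copp (Cminus x l)) (Cminus x w)) by ring.
  eapply Rle_trans; [apply Cmod_triangle|]. rewrite Cmod_opp. lra.
Qed.

Lemma cseries_dominated (a : nat -> C) (b : nat -> R) :
  (forall n, Cmod (a n) <= b n) -> ex_series b -> exists l, cseries a l.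
Proof.
  intros H Hb.
  destruct (ex_series_le (K := C_AbsRing) (V := C_CompleteNormedModule) a b) as [l Hl];
    [intros n; apply (H n)|exact Hb|].
  exists l. apply cseries_is_series. exact Hl.
Qed.

(** * Derivatives of complex functions of a real variable *)

Definition isd (f : R -> C) (x : R) (d : C) : Prop :=
  is_derive (fun y => fst (f y)) x (fst d) /\ is_derive (fun y => snd (f y)) x (snd d).

Lemma isd_const (c : C) (x : R) : isd (fun _ => c) x (RtoC 0).
Proof. split; apply @is_derive_const. Qed.

Lemma isd_plus (f g : R -> C) (x : R) (d e : C) :
  isd f x d -> isd g x e -> isd (fun y => Cplus (f y) (g y)) x (Cplus d e).
Proof.
  intros [H1 H2] [H3 H4]. split; simpl.
  - apply @is_derive_plus; assumption.
  - apply @is_derive_plus; assumption.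
Qed.

Lemma isd_opp (f : R -> C) (x : R) (d : C) :
  isd f x d -> isd (fun y => Copp (f y)) x (Copp d).
Proof. intros [H1 H2]. split; simpl; apply @is_derive_opp; assumption. Qed.

Lemma isd_minus (f g : R -> C) (x : R) (d e : C) :
  isd f x d -> isd g x e -> isd (fun y => Cminus (f y) (g y)) x (Cminus d e).
Proof. intros H1 H2. apply isd_plus; [|apply isd_opp]; assumption. Qed.

Lemma is_derive_eq (f : R -> R) (x d e : R) : is_derive f x d -> d = e -> is_derive f x e.
Proof. intros H <-. exact H. Qed.

Lemma isd_mult (f g : R -> C) (x : R) (d e : C) :
  isd f x d -> isd g x e ->
  isd (fun y => Cmult (f y) (g y)) x (Cplus (Cmult d (g x)) (Cmult (f x) e)).
Proof.
  assert (M : forall (u v : R -> R) du dv, is_derive u x du -> is_derive v x dv ->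
     is_derive (fun y => u y * v y) x (du * v x + u x * dv)).
  { intros u v du dv Hu Hv. exact (is_derive_mult u v x du dv Hu Hv Rmult_comm). }
  intros [H1 H2] [H3 H4]. split; simpl.
  - eapply is_derive_eq.
    + apply @is_derive_minus; apply M; eassumption.
    + unfold minus, plus, opp; simpl. ring.
  - eapply is_derive_eq.
    + apply @is_derive_plus; apply M; eassumption.
    + unfold minus, plus, opp; simpl. ring.
Qed.

Lemma isd_scal (c : C) (f : R -> C) (x : R) (d : C) :
  isd f x d -> isd (fun y => Cmult c (f y)) x (Cmult c d).
Proof.
  intros H. pose proof (isd_mult _ _ _ _ _ (isd_const c x) H) as H'.
  replace (Cmult c d) with (Cplus (Cmult (RtoC 0) (f x)) (Cmult c d)) by ring. exact H'.
Qed.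

Lemma isd_comp (f : R -> C) (g : R -> R) (x dg : R) (d : C) :
  isd f (g x) d -> is_derive g x dg -> isd (fun y => f (g y)) x (Cmult (RtoC dg) d).
Proof.
  intros [H1 H2] H. split; simpl.
  - eapply is_derive_eq.
    + apply (is_derive_comp (fun y => fst (f y)) g); eassumption.
    + unfold scal; simpl; unfold mult; simpl. ring.
  - eapply is_derive_eq.
    + apply (is_derive_comp (fun y => snd (f y)) g); eassumption.
    + unfold scal; simpl; unfold mult; simpl. ring.
Qed.

Lemma isd_eq (f : R -> C) (x : R) (d e : C) : isd f x d -> d = e -> isd f x e.
Proof. intros H <-. exact H. Qed.

Lemma Cmod_dot (c w : C) : Rabs (fst c * fst w + snd c * snd w) <= Cmod c * Cmod w.
Proof.
  rewrite <- (Cmod_conj c), <- Cmod_mult.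
  replace (fst c * fst w + snd c * snd w) with (Re (Cmult (Cconj c) w))
    by (unfold Re; simpl; ring).
  apply re_le_Cmod.
Qed.

(* Project [f b - f a] onto its own direction to reduce to a real function. *)
Lemma isd_dominated (f df : R -> C) (g dg : R -> R) (a b : R) :
  a <= b ->
  (forall x, a <= x <= b -> isd f x (df x)) ->
  (forall x, a <= x <= b -> is_derive g x (dg x)) ->
  (forall x, a <= x <= b -> Cmod (df x) <= dg x) ->
  Cmod (Cminus (f b) (f a)) <= g b - g a.
Proof.
  intros Hab Hf Hg Hd.
  set (w := Cminus (f b) (f a)).
  pose proof (Cmod_ge_0 w) as Hw.
  set (h := fun x => Cmod w * g x - (fst w * fst (f x) + snd w * snd (f x))).
  set (dh := fun x => Cmod w * dg x - (fst w * fst (df x) + snd w * snd (df x))).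
  assert (Hh : forall x, a <= x <= b -> is_derive h x (dh x)).
  { intros x Hx. destruct (Hf x Hx) as [H1 H2]. specialize (Hg x Hx).
    unfold h, dh.
    apply @is_derive_minus; [apply is_derive_scal; assumption|].
    apply @is_derive_plus; apply is_derive_scal; assumption. }
  destruct (MVT_gen h a b dh) as [x [Hx E]].
  - intros x Hx. rewrite Rmin_left, Rmax_right in Hx by lra. apply Hh. lra.
  - intros x Hx. rewrite Rmin_left, Rmax_right in Hx by lra.
    apply continuity_pt_filterlim. apply (ex_derive_continuous h).
    exists (dh x). apply Hh. lra.
  - rewrite Rmin_left, Rmax_right in Hx by lra.
    assert (0 <= dh x).
    { unfold dh. pose proof (Cmod_dot w (df x)) as D. apply Rabs_le_between in D.
      assert (Cmod w * Cmod (df x) <= Cmod w * dg x) by (apply Rmult_le_compat_l; auto).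
      lra. }
    assert (0 <= h b - h a) by (rewrite E; apply Rmult_le_pos; lra).
    assert (Cmod w * Cmod w <= Cmod w * (g b - g a)).
    { replace (Cmod w * Cmod w) with (fst w * fst w + snd w * snd w).
      - unfold h in *. unfold w in *. simpl in *. lra.
      - pose proof (Cmod2_alt w). unfold Re, Im in *. lra. }
    (* The factor [Cmod w] can be cancelled only if it is positive. For [w = 0] the claim is that
       [g] does not decrease, which holds because [dg] dominates a modulus. *)
    destruct (Rle_lt_or_eq_dec _ _ Hw) as [Hp|Hz].
    + apply Rmult_le_reg_l with (Cmod w); assumption.
    + rewrite <- Hz.
      destruct (MVT_gen g a b dg) as [y [Hy Ey]].
      * intros y Hy. rewrite Rmin_left, Rmax_right in Hy by lra. apply Hg. lra.
      * intros y Hy. rewrite Rmin_left, Rmax_right in Hy by lra.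
        apply continuity_pt_filterlim. apply (ex_derive_continuous g).
        exists (dg y). apply Hg. lra.
      * rewrite Rmin_left, Rmax_right in Hy by lra. rewrite Ey.
        apply Rmult_le_pos; [|lra].
        eapply Rle_trans; [apply Cmod_ge_0|apply Hd; lra].
Qed.

(** * The complex exponential and its Taylor polynomials *)

Lemma Cexp_plus (z w : C) : Cexp (Cplus z w) = Cmult (Cexp z) (Cexp w).
Proof.
  unfold Cexp, Re, Im. destruct z as [a b], w as [c d]. simpl.
  rewrite exp_plus, cos_plus, sin_plus. unfold Cmult; simpl. f_equal; ring.
Qed.

Lemma Cexp_0 : Cexp (RtoC 0) = RtoC 1.
Proof.
  unfold Cexp, RtoC; simpl. rewrite exp_0, cos_0, sin_0. f_equal; ring.
Qed.

Lemma Cmod_Cexp (z : C) : Cmod (Cexp z) = exp (Re z).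
Proof.
  unfold Cmod, Cexp; simpl.
  replace (_ + _) with ((exp (Re z))²).
  - apply sqrt_Rsqr. left. apply exp_pos.
  - pose proof (sin2_cos2 (Im z)) as H. unfold Rsqr in *.
    set (e := exp (Re z)) in *. set (c := cos (Im z)) in *. set (s := sin (Im z)) in *.
    transitivity (e * e * (s * s + c * c)); [rewrite H|]; ring.
Qed.

Lemma isd_Cexp (z : C) (x : R) :
  isd (fun y => Cexp (Cmult (RtoC y) z)) x (Cmult z (Cexp (Cmult (RtoC x) z))).
Proof.
  unfold Cexp, Re, Im. destruct z as [a b].
  split; simpl.
  - apply (is_derive_ext (fun y => exp (y * a) * cos (y * b))).
    { intros y. f_equal; f_equal; ring. }
    replace (x * a - 0 * b) with (x * a) by ring.
    replace (x * b + 0 * a) with (x * b) by ring.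
    auto_derive; [trivial|ring].
  - apply (is_derive_ext (fun y => exp (y * a) * sin (y * b))).
    { intros y. f_equal; f_equal; ring. }
    replace (x * a - 0 * b) with (x * a) by ring.
    replace (x * b + 0 * a) with (x * b) by ring.
    auto_derive; [trivial|ring].
Qed.

(** Here [n] counts the terms, so the degree is [n - 1]. *)
Definition texp (n : nat) (z : C) : C :=
  csum (fun r => Cmult (RtoC (/ INR (fact r))) (Cpow z r)) n.

Lemma isd_Cpow (z : C) (n : nat) (x : R) :
  isd (fun y => Cpow (Cmult (RtoC y) z) (S n)) x
    (Cmult (RtoC (INR (S n))) (Cmult z (Cpow (Cmult (RtoC x) z) n))).
Proof.
  assert (L : isd (fun y => Cmult (RtoC y) z) x z).
  { destruct z as [a b]. split; simpl; (auto_derive; [trivial|ring]). }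
  induction n as [|n IH].
  - eapply isd_eq.
    + apply (isd_mult _ _ _ _ _ L (isd_const (RtoC 1) x)).
    + simpl. ring.
  - eapply isd_eq; [exact (isd_mult _ _ _ _ _ L IH)|].
    rewrite (S_INR (S n)), RtoC_plus. rewrite !Cpow_S. ring.
Qed.

Lemma isd_texp (z : C) (n : nat) (x : R) :
  isd (fun y => texp (S n) (Cmult (RtoC y) z)) x (Cmult z (texp n (Cmult (RtoC x) z))).
Proof.
  induction n as [|n IH].
  - eapply isd_eq;
      [exact (isd_plus _ _ _ _ _ (isd_const (RtoC 0) x)
        (isd_const (Cmult (RtoC (/ INR (fact 0))) (RtoC 1)) x))|].
    unfold texp; simpl. ring.
  - eapply isd_eq;
      [exact (isd_plus _ _ _ _ _ IH (isd_scal (RtoC (/ INR (fact (S n)))) _ _ _ (isd_Cpow z n x)))|].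
    unfold texp at 2. simpl csum. fold (texp n (Cmult (RtoC x) z)).
      assert (E : Cmult (RtoC (/ INR (fact (S n)))) (RtoC (INR (S n)))
                  = RtoC (/ INR (fact n))).
      { rewrite <- RtoC_mult. f_equal. rewrite fact_simpl, mult_INR.
        field. split; [apply INR_fact_neq_0|apply not_0_INR; lia]. }
      rewrite Cmult_assoc, E. ring.
Qed.

Lemma texp_S_0 (n : nat) : texp (S n) (RtoC 0) = RtoC 1.
Proof.
  unfold texp. rewrite csum_incr.
  rewrite (csum_ext _ (fun _ => RtoC 0)).
  - replace (csum (fun _ => RtoC 0) n) with (RtoC 0).
    + simpl. rewrite Rinv_1. ring.
    + clear. induction n as [|n IH]; [reflexivity|]. simpl. rewrite <- IH. ring.
  - intros i _. rewrite Cpow_S. ring.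
Qed.

(** Along the segment from 0 to [z], the derivative of the remainder of [texp (S n)] is [z] times
    that of [texp n], and the bounds are related in the same way; [isd_dominated] integrates the
    inequality. The factor [exp (Cmod z)] comes from [n = 0], where the remainder is the exponential
    itself. *)
Lemma Cexp_texp_aux (z : C) (n : nat) (x : R) :
  0 <= x <= 1 ->
  Cmod (Cminus (Cexp (Cmult (RtoC x) z)) (texp n (Cmult (RtoC x) z)))
    <= exp (Cmod z) * ((x * Cmod z) ^ n / INR (fact n)).
Proof.
  revert x. induction n as [|n IH]; intros x Hx.
  - simpl. unfold texp; simpl. unfold Rdiv. rewrite Rinv_1, !Rmult_1_r.
    replace (Cminus (Cexp (Cmult (RtoC x) z)) (RtoC 0))
      with (Cexp (Cmult (RtoC x) z)) by ring.
    rewrite Cmod_Cexp.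
    assert (Re (Cmult (RtoC x) z) <= Cmod z).
    { eapply Rle_trans; [apply Rle_abs|]. eapply Rle_trans; [apply re_le_Cmod|].
      rewrite Cmod_mult, Cmod_R, Rabs_right by lra.
      pose proof (Cmod_ge_0 z). nra. }
    destruct (Rle_lt_or_eq_dec _ _ H) as [H'|H'];
      [left; apply exp_increasing; assumption|rewrite H'; lra].
  - set (f := fun y => Cminus (Cexp (Cmult (RtoC y) z)) (texp (S n) (Cmult (RtoC y) z))).
    set (g := fun y => exp (Cmod z) * ((y * Cmod z) ^ (S n) / INR (fact (S n)))).
    assert (H := isd_dominated f
      (fun y => Cmult z (Cminus (Cexp (Cmult (RtoC y) z)) (texp n (Cmult (RtoC y) z)))) g
      (fun y => Cmod z * (exp (Cmod z) * ((y * Cmod z) ^ n / INR (fact n)))) 0 x ltac:(lra)).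
    assert (F0 : f 0 = RtoC 0).
    { unfold f. rewrite Cmult_0_l, Cexp_0, texp_S_0. ring. }
    assert (G0 : g 0 = 0).
    { unfold g. rewrite Rmult_0_l. simpl. unfold Rdiv. ring. }
    rewrite F0, G0 in H. unfold f, g in H.
    match type of H with _ -> _ -> _ -> Cmod (Cminus ?u _) <= ?v - 0 =>
      replace (Cminus u (RtoC 0)) with u in H by ring; rewrite Rminus_0_r in H end.
    apply H.
    + intros y Hy. eapply isd_eq; [apply isd_minus; [apply isd_Cexp|apply isd_texp]|ring].
    + intros y Hy. clear -n.
      assert (EF : INR (fact (S n)) = INR (S n) * INR (fact n))
        by (rewrite fact_simpl, mult_INR; reflexivity).
      pose proof (INR_fact_neq_0 n). assert (INR (S n) <> 0) by (apply not_0_INR; lia).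
      generalize dependent (INR (fact (S n))). intros F EF.
      apply (is_derive_ext (fun y => (exp (Cmod z) / F) * (y * Cmod z) ^ S n)).
      { intros u. cbv beta. match goal with |- ?a = ?b => change (@eq R a b) end.
        unfold Rdiv. ring. }
      apply is_derive_eq with ((exp (Cmod z) / F) * (INR (S n) * Cmod z * (y * Cmod z) ^ n)).
      * apply is_derive_scal.
        apply is_derive_eq with (INR (S n) * Cmod z * (y * Cmod z) ^ pred (S n)); [|reflexivity].
        apply (is_derive_pow (fun y => y * Cmod z)). auto_derive; [trivial|ring].
      * rewrite EF. field. split; assumption.
    + intros y Hy. rewrite Cmod_mult. apply Rmult_le_compat_l; [apply Cmod_ge_0|].
      apply IH. lra.
Qed.

Lemma Cexp_texp (z : C) (n : nat) :
  Cmod (Cminus (Cexp z) (texp n z)) <= exp (Cmod z) * (Cmod z ^ n / INR (fact n)).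
Proof.
  pose proof (Cexp_texp_aux z n 1 ltac:(lra)) as H.
  rewrite Cmult_1_l, Rmult_1_l in H. exact H.
Qed.

(** The left side is a single term of the series of [exp (INR n)]. *)
Lemma pow_le_fact_exp (n : nat) : INR n ^ n / INR (fact n) <= exp (INR n).
Proof.
  eapply Rle_trans; [|apply (exp_ge_taylor (INR n) n), pos_INR].
  destruct n as [|n]; [simpl; lra|].
  rewrite tech5.
  assert (0 <= sum_f_R0 (fun k => INR (S n) ^ k / INR (fact k)) n); [|lra].
  apply cond_pos_sum. intros k. apply Rdiv_le_0_compat;
    [apply pow_le, pos_INR|apply INR_fact_lt_0].
Qed.

(** On taking fifth powers: e^6 <= 3^6 = 729 < 3125 = 5^5. *)
Lemma exp_6_5_le_5 : exp (6/5) <= 5.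
Proof.
  apply Rnot_lt_le. intros H.
  assert (E : exp (6/5) ^ 5 = exp 1 ^ 6).
  { simpl. rewrite !Rmult_1_r, <- !exp_plus. f_equal. lra. }
  assert (exp 1 ^ 6 <= 3 ^ 6) by (apply pow_incr; pose proof (exp_pos 1); pose proof exp_le_3; lra).
  assert (5 ^ 5 <= exp (6/5) ^ 5) by (apply pow_incr; lra).
  lra.
Qed.

(** The error must be small relative to |e^z|, which may be as small as e^(-|z|). Passing from e^|z|
    to e^(Re z) costs e^(2|z|) <= e^(n/5), while |z|^n / n! <= (e/10)^n; altogether the relative
    error is at most (e^(6/5) / 10)^n <= 2^(-n). *)
Lemma texp_relative (z : C) (n : nat) :
  Cmod z <= INR n / 10 ->
  exp (Re z) * (1 - (/2) ^ n) <= Cmod (texp n z) <= exp (Re z) * (1 + (/2) ^ n).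
Proof.
  intros Hz.
  assert (Key : Cmod (Cminus (Cexp z) (texp n z)) <= exp (Re z) * (/2) ^ n).
  { eapply Rle_trans; [apply Cexp_texp|].
    assert (Hre : - Cmod z <= Re z).
    { pose proof (re_le_Cmod z) as H. apply Rabs_le_between in H. lra. }
    assert (He : exp (Cmod z) <= exp (Re z) * exp (INR n / 5)).
    { rewrite <- exp_plus. destruct (Rle_lt_or_eq_dec (Cmod z) (Re z + INR n / 5)) as [H|H];
        [lra|left; apply exp_increasing; assumption|rewrite <- H; lra]. }
    assert (Hp : Cmod z ^ n / INR (fact n) <= (/10) ^ n * exp (INR n)).
    { apply Rle_trans with ((/10) ^ n * (INR n ^ n / INR (fact n))).
      - unfold Rdiv. rewrite <- Rmult_assoc, <- Rpow_mult_distr.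
        apply Rmult_le_compat_r; [left; apply Rinv_0_lt_compat, INR_fact_lt_0|].
        apply pow_incr. pose proof (Cmod_ge_0 z). lra.
      - apply Rmult_le_compat_l; [apply pow_le; lra|apply pow_le_fact_exp]. }
    assert (H0 : 0 <= Cmod z ^ n / INR (fact n)).
    { apply Rdiv_le_0_compat; [apply pow_le, Cmod_ge_0|apply INR_fact_lt_0]. }
    eapply Rle_trans; [apply Rmult_le_compat; [left; apply exp_pos|exact H0|exact He|exact Hp]|].
    rewrite Rmult_assoc. apply Rmult_le_compat_l; [left; apply exp_pos|].
    replace (exp (INR n / 5) * ((/ 10) ^ n * exp (INR n)))
      with ((/10) ^ n * (exp (INR n / 5) * exp (INR n))) by ring.
    rewrite <- exp_plus.
    replace (INR n / 5 + INR n) with (INR n * (6/5)) by field.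
    assert (E : exp (INR n * (6/5)) = exp (6/5) ^ n).
    { clear. induction n as [|n IH]; [simpl; rewrite Rmult_0_l; apply exp_0|].
      rewrite S_INR, Rmult_plus_distr_r, exp_plus, IH, Rmult_1_l. simpl. ring. }
    rewrite E, <- Rpow_mult_distr. apply pow_incr.
    pose proof exp_6_5_le_5. pose proof (exp_pos (6/5)). lra. }
  rewrite Rmult_minus_distr_l, Rmult_plus_distr_l, Rmult_1_r.
  rewrite <- Cmod_Cexp in *.
  split.
  - assert (Cmod (Cexp z) <= Cmod (Cminus (Cexp z) (texp n z)) + Cmod (texp n z)); [|lra].
    eapply Rle_trans; [|apply Cmod_triangle]. apply Req_le. f_equal. ring.
  - assert (Cmod (texp n z) <= Cmod (Cminus (Cexp z) (texp n z)) + Cmod (Cexp z)); [|lra].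
    rewrite <- (Cmod_opp (Cminus _ _)).
    eapply Rle_trans; [|apply Cmod_triangle]. apply Req_le. f_equal. ring.
Qed.

(** * The zeta function on the critical line *)

(** The power y^(-s) for a positive real base; half-integers occur as bases at the endpoints of the
    midpoint rule. *)
Definition cpw (y : R) (s : C) : C := Cexp (Cmult (RtoC (ln y)) (Copp s)).

Lemma dirichlet_term_cpw (s : C) (n : nat) : dirichlet_term s n = cpw (INR n) s.
Proof. unfold dirichlet_term, cpw. f_equal. ring. Qed.

Lemma Cmod_cpw (y : R) (s : C) : Cmod (cpw y s) = Rpower y (- Re s).
Proof.
  unfold cpw. rewrite Cmod_Cexp. unfold Rpower. f_equal.
  unfold Re. simpl. ring.
Qed.

Lemma cpw_plus (y : R) (s w : C) : cpw y (Cplus s w) = Cmult (cpw y s) (cpw y w).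
Proof. unfold cpw. rewrite <- Cexp_plus. f_equal. ring. Qed.

Lemma cpw_S (y : R) (s : C) : 0 < y -> cpw y (Cplus s (RtoC 1)) = Cmult (RtoC (/ y)) (cpw y s).
Proof.
  intros Hy. rewrite cpw_plus, Cmult_comm. f_equal.
  unfold cpw, Cexp, Re, Im, RtoC. simpl.
  replace (ln y * - (1) - 0 * - 0) with (- ln y) by ring.
  replace (ln y * - 0 + 0 * - (1)) with 0 by ring.
  rewrite exp_Ropp, exp_ln, cos_0, sin_0 by assumption. f_equal; ring.
Qed.

Lemma isd_cpw (s : C) (y : R) :
  0 < y -> isd (fun x => cpw x s) y (Copp (Cmult s (cpw y (Cplus s (RtoC 1))))).
Proof.
  intros Hy. eapply isd_eq.
  - apply (isd_comp (fun x => Cexp (Cmult (RtoC x) (Copp s))) ln); [apply isd_Cexp|].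
    apply is_derive_Reals, derivable_pt_lim_ln. assumption.
  - rewrite cpw_S by assumption. unfold cpw. ring.
Qed.

Lemma isd_cpw_comp (s : C) (g : R -> R) (x dg : R) :
  0 < g x -> is_derive g x dg ->
  isd (fun h => cpw (g h) s) x
    (Cmult (RtoC dg) (Copp (Cmult s (cpw (g x) (Cplus s (RtoC 1)))))).
Proof. intros H1 H2. apply (isd_comp (fun y => cpw y s) g); [apply isd_cpw|]; assumption. Qed.

Lemma is_derive_shift (n e x : R) : is_derive (fun h => n + e * h) x e.
Proof. auto_derive; [trivial|ring]. Qed.

Lemma Rpower_antitone (x y a : R) : 0 < x <= y -> a <= 0 -> Rpower y a <= Rpower x a.
Proof.
  intros [Hx Hxy] Ha. unfold Rpower.
  assert (a * ln y <= a * ln x).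
  { assert (ln x <= ln y) by (apply ln_le; lra). nra. }
  destruct (Rle_lt_or_eq_dec _ _ H) as [H'|H'];
    [left; apply exp_increasing; assumption|rewrite H'; lra].
Qed.

(** The factor s - 1 clears the denominator of the integral of x^(-s), so that each term is entire
    in s, and the endpoint contributions telescope in n. *)
Definition hterm (n : R) (s : C) : C :=
  Cplus (Cmult (Cminus s (RtoC 1)) (cpw n s))
    (Cminus (cpw (n + /2) (Cminus s (RtoC 1))) (cpw (n - /2) (Cminus s (RtoC 1)))).

(* Midpoint rule: [hterm n s] is [s - 1] times the error of approximating the
   integral of [x^-s] over a unit interval by its midpoint value. *)
Lemma hterm_bound (n : R) (s : C) :
  1 <= n -> 0 <= Re s ->
  Cmod (hterm n s) <= Cmod (Cminus s (RtoC 1)) *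
    (Cmod s * Cmod (Cplus s (RtoC 1))) * Rpower (n - /2) (- Re s - 2).
Proof.
  intros Hn Hs.
  set (K := Rpower (n - /2) (- Re s - 2)).
  set (s1 := Cplus s (RtoC 1)). set (A := Cmod s * Cmod s1).
  assert (HK : 0 <= K) by (left; apply exp_pos).
  assert (HA : 0 <= A) by (apply Rmult_le_pos; apply Cmod_ge_0).
  (* The half-width [h] of the interval is varied. The error [P] has derivative [- s' D], the second
     difference [D] has derivative [- s] times a first difference of x^(-s-1), and all of them
     vanish at [h = 0]; three integrations give the bound. *)
  assert (B1 : forall h, 0 <= h <= /2 ->
    Cmod (Cminus (cpw (n + h) s1) (cpw (n - h) s1)) <= Cmod s1 * K * (2 * h)).
  { intros h Hh.
    replace (Cmod s1 * K * (2 * h)) with (Cmod s1 * K * (n + h) - Cmod s1 * K * (n - h)) by ring.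
    apply (isd_dominated (fun y => cpw y s1)
      (fun y => Copp (Cmult s1 (cpw y (Cplus s1 (RtoC 1)))))
      (fun y => Cmod s1 * K * y) (fun _ => Cmod s1 * K)); [lra| | |].
    - intros x Hx. apply isd_cpw. lra.
    - intros x Hx. auto_derive; [trivial|ring].
    - intros x Hx. rewrite Cmod_opp, Cmod_mult, Cmod_cpw.
      apply Rmult_le_compat_l; [apply Cmod_ge_0|].
      replace (- Re (Cplus s1 (RtoC 1))) with (- Re s - 2) by (unfold s1, Re; simpl; ring).
      apply Rpower_antitone; lra. }
  set (D := fun h => Cminus (Cplus (cpw (n + 1 * h) s) (cpw (n + -1 * h) s))
                       (Cmult (RtoC 2) (cpw n s))).
  assert (B2 : forall h, 0 <= h <= /2 -> Cmod (D h) <= A * K * h ^ 2).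
  { intros h Hh.
    assert (D0 : D 0 = RtoC 0).
    { unfold D. rewrite !Rmult_0_r, !Rplus_0_r. ring. }
    replace (D h) with (Cminus (D h) (D 0)) by (rewrite D0; ring).
    replace (A * K * h ^ 2) with (A * K * h ^ 2 - A * K * 0 ^ 2) by ring.
    apply (isd_dominated D
      (fun h => Copp (Cmult s (Cminus (cpw (n + 1 * h) s1) (cpw (n + -1 * h) s1))))
      (fun h => A * K * h ^ 2) (fun h => A * K * (2 * h))); [lra| | |].
    - intros x Hx. eapply isd_eq.
      + apply isd_minus; [apply isd_plus|apply isd_const];
          apply isd_cpw_comp; try (apply is_derive_shift); lra.
      + fold s1. ring_simplify. reflexivity.
    - intros x Hx. auto_derive; [trivial|ring].
    - intros x Hx. rewrite Cmod_opp, Cmod_mult. unfold A.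
      replace (n + 1 * x) with (n + x) by ring. replace (n + -1 * x) with (n - x) by ring.
      replace (Cmod s * Cmod s1 * K * (2 * x)) with (Cmod s * (Cmod s1 * K * (2 * x))) by ring.
      apply Rmult_le_compat_l; [apply Cmod_ge_0|]. apply B1. lra. }
  set (s' := Cminus s (RtoC 1)).
  set (P := fun h => Cplus (Cminus (cpw (n + 1 * h) s') (cpw (n + -1 * h) s'))
                       (Cmult (Cmult (RtoC 2) s') (Cmult (RtoC h) (cpw n s)))).
  assert (P0 : P 0 = RtoC 0).
  { unfold P. rewrite !Rmult_0_r, !Rplus_0_r. ring. }
  assert (Ph : P (/2) = hterm n s).
  { unfold P, hterm. fold s'.
    replace (n + 1 * /2) with (n + /2) by ring. replace (n + -1 * /2) with (n - /2) by ring.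
    assert (E : Cmult (RtoC 2) (RtoC (/2)) = RtoC 1) by (rewrite <- RtoC_mult; f_equal; lra).
    replace (Cmult (Cmult (RtoC 2) s') (Cmult (RtoC (/2)) (cpw n s)))
      with (Cmult (Cmult (RtoC 2) (RtoC (/2))) (Cmult s' (cpw n s))) by ring.
    rewrite E. ring. }
  assert (E1 : Cplus s' (RtoC 1) = s) by (unfold s'; ring).
  assert (B3 : Cmod (Cminus (P (/2)) (P 0)) <= Cmod s' * A * K * (/2) ^ 3 / 3 - Cmod s' * A * K * 0 ^ 3 / 3).
  { apply (isd_dominated P (fun h => Copp (Cmult s' (D h)))
      (fun h => Cmod s' * A * K * h ^ 3 / 3) (fun h => Cmod s' * (A * K * h ^ 2))); [lra| | |].
    - intros x Hx. eapply isd_eq.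
      + apply isd_plus; [apply isd_minus; apply isd_cpw_comp; try (apply is_derive_shift); lra|].
        apply isd_scal. apply isd_mult; [|apply isd_const].
        instantiate (1 := RtoC 1). split; simpl; auto_derive; trivial.
      + rewrite E1. unfold D. simpl RtoC. rewrite Cmult_1_l.
        replace (RtoC (-1)) with (Copp (RtoC 1)) by (rewrite <- RtoC_opp; reflexivity). ring.
    - intros x Hx. auto_derive; [trivial|field].
    - intros x Hx. rewrite Cmod_opp, Cmod_mult.
      apply Rmult_le_compat_l; [apply Cmod_ge_0|]. apply B2. assumption. }
  rewrite Ph, P0 in B3. replace (Cminus (hterm n s) (RtoC 0)) with (hterm n s) in B3 by ring.
  assert (0 <= Cmod s' * A * K).
  { apply Rmult_le_pos; [apply Rmult_le_pos; [apply Cmod_ge_0|assumption]|assumption]. }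
  fold A. lra.
Qed.

(** * Power series and the Cauchy estimate *)

Definition cps (a : nat -> C) (z l : C) : Prop :=
  cseries (fun j => Cmult (a j) (Cpow z j)) l.

Lemma is_pseries_cps (a : nat -> C) (z l : C) :
  is_pseries (K := C_AbsRing) (V := C_NormedModule) a z l <-> cps a z l.
Proof.
  unfold is_pseries, cps.
  rewrite cseries_is_series.
  split; apply cseries_ext; intros n; [|symmetry]; exact (Cmult_comm (Cpow z n) (a n)).
Qed.

Lemma cseries_terms_bounded (a : nat -> C) (l : C) :
  cseries a l -> exists K, forall n, Cmod (a n) <= K.
Proof.
  intros H. destruct (H 1 Rlt_0_1) as [N HN].
  assert (G : forall M, exists K, forall n, (n < M)%nat -> Cmod (a n) <= K).
  { induction M as [|M [K HK]]; [exists 0; intros; lia|].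
    exists (Rmax K (Cmod (a M))). intros n Hn.
    destruct (Nat.eq_dec n M) as [->|]; [apply Rmax_r|].
    eapply Rle_trans; [apply HK; lia|apply Rmax_l]. }
  destruct (G N) as [K HK]. exists (Rmax K 2). intros n.
  destruct (Nat.lt_ge_cases n N) as [Hn|Hn].
  - eapply Rle_trans; [apply HK; assumption|apply Rmax_l].
  - eapply Rle_trans; [|apply Rmax_r].
    replace (a n) with (Cplus (Cminus (csum a (S n)) l) (Copp (Cminus (csum a n) l)))
      by (simpl; ring).
    eapply Rle_trans; [apply Cmod_triangle|]. rewrite Cmod_opp.
    pose proof (HN n Hn). pose proof (HN (S n) ltac:(lia)). lra.
Qed.

Lemma Re_csum_geom (C0 q : R) (N n : nat) : 0 <= C0 -> 0 <= q < 1 ->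
  Re (csum (fun i => RtoC (C0 * q ^ (N + i))) n) <= C0 * q ^ N / (1 - q).
Proof.
  intros HC Hq.
  assert (Re (csum (fun i => RtoC (C0 * q ^ (N + i))) n)
          = C0 * q ^ N / (1 - q) - C0 * q ^ (N + n) / (1 - q)).
  { induction n as [|n IH].
    - rewrite Nat.add_0_r. unfold Re; simpl. ring.
    - simpl csum. unfold Re in *; simpl. rewrite IH, Nat.add_succ_r. simpl. field. lra. }
  rewrite H.
  assert (0 <= C0 * q ^ (N + n) / (1 - q)); [|lra].
  apply Rdiv_le_0_compat; [|lra]. apply Rmult_le_pos; [lra|apply pow_le; lra].
Qed.

Lemma cps_tail (a : nat -> C) (z l : C) (C0 R0 q : R) (N : nat) :
  0 < R0 -> 0 <= q < 1 -> (forall i, Cmod (a i) * R0 ^ i <= C0) ->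
  Cmod z <= q * R0 -> cps a z l ->
  Cmod (Cminus l (csum (fun j => Cmult (a j) (Cpow z j)) N)) <= C0 * q ^ N / (1 - q).
Proof.
  intros HR Hq Ha Hz Hl.
  assert (HC : 0 <= C0).
  { eapply Rle_trans; [|apply (Ha 0%nat)]. simpl. rewrite Rmult_1_r. apply Cmod_ge_0. }
  apply cseries_bound with (1 := Hl). exists N. intros n Hn.
  replace n with (N + (n - N))%nat by lia. rewrite csum_add.
  match goal with |- Cmod (Cminus (Cplus ?x ?y) ?x) <= _ =>
    replace (Cminus (Cplus x y) x) with y by ring end.
  eapply Rle_trans; [|apply (Re_csum_geom C0 q N (n - N)); assumption].
  apply Cmod_csum. intros i _. rewrite Cmod_mult, Cmod_pow.
  apply Rle_trans with (Cmod (a (N + i)%nat) * (q * R0) ^ (N + i)).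
  - apply Rmult_le_compat_l; [apply Cmod_ge_0|].
    apply pow_incr. split; [apply Cmod_ge_0|assumption].
  - rewrite Rpow_mult_distr.
    replace (Cmod (a (N + i)%nat) * (q ^ (N + i) * R0 ^ (N + i)))
      with (Cmod (a (N + i)%nat) * R0 ^ (N + i) * q ^ (N + i)) by ring.
    apply Rmult_le_compat_r; [apply pow_le; lra|apply Ha].
Qed.

Lemma cps_coeff_bounded (a : nat -> C) (R0 : R) (l : C) :
  0 <= R0 -> cps a (RtoC R0) l -> exists C0, forall i, Cmod (a i) * R0 ^ i <= C0.
Proof.
  intros HR H. destruct (cseries_terms_bounded _ _ H) as [K HK].
  exists K. intros i. specialize (HK i).
  rewrite Cmod_mult, Cmod_pow, Cmod_R, Rabs_right in HK by lra. exact HK.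
Qed.

Definition cis (x : R) : C := Cexp (Cmult (RtoC x) Ci).

Lemma cis_plus (x y : R) : cis (x + y) = Cmult (cis x) (cis y).
Proof. unfold cis. rewrite <- Cexp_plus, RtoC_plus. f_equal. ring. Qed.

Lemma Cmod_cis (x : R) : Cmod (cis x) = 1.
Proof.
  unfold cis. rewrite Cmod_Cexp. unfold Re; simpl.
  replace (x * 0 - 0 * 1) with 0 by ring. apply exp_0.
Qed.

Lemma cis_eq (x : R) : cis x = (cos x, sin x).
Proof.
  unfold cis, Cexp, Re, Im; simpl.
  replace (x * 0 - 0 * 1) with 0 by ring. replace (x * 1 + 0 * 0) with x by ring.
  rewrite exp_0. f_equal; ring.
Qed.

Lemma cis_pow (x : R) (n : nat) : Cpow (cis x) n = cis (INR n * x).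
Proof.
  induction n as [|n IH].
  - simpl. rewrite Rmult_0_l, cis_eq, cos_0, sin_0. reflexivity.
  - rewrite Cpow_S, IH, <- cis_plus, S_INR. f_equal. ring.
Qed.

Lemma csum_geom (z : C) (n : nat) :
  Cmult (Cminus z (RtoC 1)) (csum (fun i => Cpow z i) n) = Cminus (Cpow z n) (RtoC 1).
Proof.
  induction n as [|n IH]; [simpl; ring|].
  simpl csum. rewrite Cmult_plus_distr_l, IH, Cpow_S. ring.
Qed.

(** The ratio is an [N]-th root of unity other than 1, so the geometric sum vanishes. *)
Lemma csum_roots_of_unity (N i j : nat) : (i < N)%nat -> (j < N)%nat -> i <> j ->
  csum (fun k => Cpow (cis ((INR i - INR j) * (2 * PI / INR N))) k) N = RtoC 0.
Proof.
  intros Hi Hj Hij. set (z := cis _).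
  assert (HN : 0 < INR N) by (apply lt_0_INR; lia).
  pose proof PI_RGT_0 as Hpi.
  assert (Hz : Cpow z N = RtoC 1).
  { unfold z. rewrite cis_pow, cis_eq.
    replace (INR N * ((INR i - INR j) * (2 * PI / INR N))) with (2 * IZR (Z.of_nat i - Z.of_nat j) * PI).
    - rewrite minus_IZR, <- !INR_IZR_INZ. unfold RtoC.
      replace (2 * (INR i - INR j) * PI) with (2 * INR i * PI - 2 * INR j * PI) by ring.
      rewrite cos_minus, sin_minus.
      replace (2 * INR i * PI) with (0 + 2 * INR i * PI) by ring.
      replace (2 * INR j * PI) with (0 + 2 * INR j * PI) by ring.
      rewrite !cos_period, !sin_period, cos_0, sin_0. f_equal; ring.
    - rewrite minus_IZR, <- !INR_IZR_INZ. field. lra. }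
  pose proof (csum_geom z N) as G. rewrite Hz in G.
  replace (Cminus (RtoC 1) (RtoC 1)) with (RtoC 0) in G by ring.
  assert (Hne : Cminus z (RtoC 1) <> RtoC 0).
  { intros E.
    assert (Ez : z = RtoC 1) by (replace z with (Cplus (Cminus z (RtoC 1)) (RtoC 1)) by ring; rewrite E; ring).
    unfold z in Ez. rewrite cis_eq in Ez. unfold RtoC in Ez. injection Ez as Ec _.
    set (x := (INR i - INR j) * (2 * PI / INR N)) in *.
    (* cos x = 1 - 2 sin^2 (x/2), and 0 < |x/2| < pi *)
    replace x with (2 * (x / 2)) in Ec by field. rewrite cos_2a_sin in Ec.
    assert (Es : sin (x / 2) = 0) by nra.
    assert (Hx : x / 2 = (INR i - INR j) / INR N * PI) by (unfold x; field; lra).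
    assert (Hb : 0 < Rabs (INR i - INR j) / INR N < 1).
    { assert (INR i <> INR j) by (intros E'; apply Hij, INR_eq, E').
      split; [apply Rdiv_lt_0_compat; [apply Rabs_pos_lt; lra|lra]|].
      apply (Rmult_lt_reg_r (INR N)); [lra|]. unfold Rdiv. rewrite Rmult_assoc, Rinv_l by lra.
      rewrite Rmult_1_r, Rmult_1_l.
      pose proof (pos_INR i). pose proof (pos_INR j).
      assert (INR i < INR N) by (apply lt_INR; lia). assert (INR j < INR N) by (apply lt_INR; lia).
      apply Rabs_def1; lra. }
    assert (Sp : 0 < sin (Rabs (INR i - INR j) / INR N * PI)).
    { apply sin_gt_0; nra. }
    rewrite Hx in Es. unfold Rabs in Sp. destruct (Rcase_abs (INR i - INR j)).
    - replace (- (INR i - INR j) / INR N * PI) with (- ((INR i - INR j) / INR N * PI)) in Sp by (field; lra).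
      rewrite sin_neg in Sp. lra.
    - lra. }
  set (X := csum _ N) in *.
  replace X with (Cmult (Cinv (Cminus z (RtoC 1))) (Cmult (Cminus z (RtoC 1)) X)) by (field; exact Hne).
  rewrite G. ring.
Qed.

Lemma csum_const (c : C) (n : nat) : csum (fun _ => c) n = Cmult (RtoC (INR n)) c.
Proof.
  induction n as [|n IH]; [simpl; ring|]. simpl csum. rewrite IH, S_INR, RtoC_plus. ring.
Qed.

Lemma csum_zero (n : nat) : csum (fun _ => RtoC 0) n = RtoC 0.
Proof. rewrite csum_const. ring. Qed.

Lemma csum_swap (f : nat -> nat -> C) (m n : nat) :
  csum (fun i => csum (fun j => f i j) n) m = csum (fun j => csum (fun i => f i j) m) n.
Proof.
  induction m as [|m IH]; simpl; [symmetry; apply csum_zero|].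
  rewrite IH, <- csum_plus. reflexivity.
Qed.

Lemma csum_single (f : nat -> C) (n j : nat) : (j < n)%nat ->
  (forall i, (i < n)%nat -> i <> j -> f i = RtoC 0) -> csum f n = f j.
Proof.
  revert j. induction n as [|n IH]; intros j Hj H; [lia|]. simpl.
  destruct (Nat.eq_dec j n) as [->|].
  - rewrite (csum_ext f (fun _ => RtoC 0)) by (intros; apply H; lia). rewrite csum_zero. ring.
  - rewrite (IH j), (H n); [ring|lia|lia|lia|intros; apply H; lia].
Qed.

(* Averaging over the [N]-th roots of unity isolates the [j]-th coefficient up to a tail. *)
Lemma cauchy_estimate (a : nat -> C) (f : C -> C) (C0 R0 r K : R) (j : nat) :
  0 < r < R0 -> (forall i, Cmod (a i) * R0 ^ i <= C0) ->
  (forall z, Cmod z = r -> cps a z (f z)) ->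
  (forall z, Cmod z = r -> Cmod (f z) <= K) ->
  Cmod (a j) * r ^ j <= K.
Proof.
  intros Hr Ha Hf HK. set (q := r / R0).
  assert (Hq : 0 < q < 1).
  { unfold q. split; [apply Rdiv_lt_0_compat; lra|].
    apply (Rmult_lt_reg_r R0); [lra|]. unfold Rdiv. rewrite Rmult_assoc, Rinv_l; lra. }
  assert (HC : 0 <= C0).
  { eapply Rle_trans; [|apply (Ha 0%nat)]. simpl. rewrite Rmult_1_r. apply Cmod_ge_0. }
  assert (Main : forall N, (j < N)%nat -> Cmod (a j) * r ^ j <= K + C0 * q ^ N / (1 - q)).
  { intros N HN. assert (HN0 : 0 < INR N) by (apply lt_0_INR; lia).
    set (th := 2 * PI / INR N).
    set (zz := fun k => Cmult (RtoC r) (cis (INR k * th))).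
    assert (Hzz : forall k, Cmod (zz k) = r).
    { intros k. unfold zz. rewrite Cmod_mult, Cmod_cis, Cmod_R, Rabs_right; lra. }
    set (P := fun z => csum (fun i => Cmult (a i) (Cpow z i)) N).
    assert (HP : forall k, Cmod (P (zz k)) <= K + C0 * q ^ N / (1 - q)).
    { intros k. specialize (Hf _ (Hzz k)). specialize (HK _ (Hzz k)).
      assert (T := cps_tail a (zz k) (f (zz k)) C0 R0 q N ltac:(lra) ltac:(lra) Ha).
      rewrite Hzz in T. specialize (T ltac:(unfold q; right; field; lra) Hf).
      fold (P (zz k)) in T.
      replace (P (zz k)) with (Cplus (f (zz k)) (Copp (Cminus (f (zz k)) (P (zz k))))) by ring.
      eapply Rle_trans; [apply Cmod_triangle|]. rewrite Cmod_opp. lra. }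
    assert (E : csum (fun k => Cmult (cis (- (INR j * (INR k * th)))) (P (zz k))) N
                = Cmult (RtoC (INR N)) (Cmult (a j) (RtoC (r ^ j)))).
    { rewrite (csum_ext _ (fun k => csum (fun i => Cmult (Cmult (a i) (RtoC (r ^ i)))
         (Cpow (cis ((INR i - INR j) * th)) k)) N)).
      - rewrite csum_swap.
        rewrite (csum_ext _ (fun i => Cmult (Cmult (a i) (RtoC (r ^ i)))
           (csum (fun k => Cpow (cis ((INR i - INR j) * th)) k) N)))
          by (intros; apply csum_scal).
        rewrite (csum_single _ N j HN).
        + replace ((INR j - INR j) * th) with 0 by ring.
          rewrite (csum_ext _ (fun _ => RtoC 1)).
          * rewrite csum_const. ring.
          * intros k _. rewrite cis_pow, Rmult_0_r, cis_eq, cos_0, sin_0. reflexivity.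
        + intros i Hi Hij. unfold th. rewrite csum_roots_of_unity by assumption. ring.
      - intros k _. unfold P. rewrite <- csum_scal. apply csum_ext. intros i _.
        unfold zz. rewrite Cpow_mult_l, cis_pow, cis_pow, <- RtoC_pow.
        replace (INR k * ((INR i - INR j) * th))
          with (- (INR j * (INR k * th)) + INR i * (INR k * th)) by ring.
        rewrite cis_plus. ring. }
    assert (B : Cmod (csum (fun k => Cmult (cis (- (INR j * (INR k * th)))) (P (zz k))) N)
                <= INR N * (K + C0 * q ^ N / (1 - q))).
    { eapply Rle_trans; [apply (Cmod_csum _ (fun _ => K + C0 * q ^ N / (1 - q)))|].
      - intros k _. rewrite Cmod_mult, Cmod_cis, Rmult_1_l. apply HP.
      - rewrite csum_const, <- RtoC_mult. unfold Re; simpl. lra. }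
    rewrite E, !Cmod_mult, !Cmod_R, (Rabs_right (INR N)), (Rabs_right (r ^ j)) in B;
      [|apply Rle_ge, pow_le; lra|lra].
    apply Rmult_le_reg_l in B; lra. }
  apply le_epsilon. intros eps He.
  assert (L : is_lim_seq (fun N => C0 / (1 - q) * q ^ N) (C0 / (1 - q) * 0)).
  { apply (is_lim_seq_scal_l _ _ 0). apply is_lim_seq_geom. rewrite Rabs_right; lra. }
  rewrite Rmult_0_r in L.
  destruct (proj1 (is_lim_seq_Reals _ _) L eps He) as [N HN].
  specialize (HN (N + S j)%nat ltac:(lia)). specialize (Main (N + S j)%nat ltac:(lia)).
  unfold Rdist in HN. rewrite Rminus_0_r in HN. apply Rabs_def2 in HN.
  unfold Rdiv in *. nra.
Qed.

(** This serves for the factor s - 1, which near s0 is the linear function (s0 - 1) + z. *)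
Lemma cps_linear (c : C) (a : nat -> C) (z l : C) :
  cps a z l ->
  cps (fun j => Cplus (Cmult c (a j)) (match j with O => RtoC 0 | S i => a i end)) z
    (Cmult (Cplus c z) l).
Proof.
  intros H.
  replace (Cmult (Cplus c z) l) with (Cplus (Cmult c l) (Cmult z l)) by ring.
  apply (cseries_ext (fun j => Cplus (Cmult c (Cmult (a j) (Cpow z j)))
     (Cmult (match j with O => RtoC 0 | S i => a i end) (Cpow z j)))).
  { intros n. ring. }
  apply cseries_plus; [apply cseries_scal, H|].
  replace (Cmult z l) with (Cplus (csum (fun j =>
     Cmult (match j with O => RtoC 0 | S i => a i end) (Cpow z j)) 1) (Cmult z l))
    by (simpl; ring).
  apply cseries_shift.
  apply (cseries_ext (fun j => Cmult z (Cmult (a j) (Cpow z j)))).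
  - intros n. change (1 + n)%nat with (S n). rewrite Cpow_S. ring.
  - apply cseries_scal, H.
Qed.

Lemma cps_plus (a b : nat -> C) (z l m : C) :
  cps a z l -> cps b z m -> cps (fun j => Cplus (a j) (b j)) z (Cplus l m).
Proof.
  intros H1 H2.
  apply (cseries_ext (fun j => Cplus (Cmult (a j) (Cpow z j)) (Cmult (b j) (Cpow z j)))).
  - intros n. ring.
  - apply cseries_plus; assumption.
Qed.

Lemma cps_scal (c : C) (a : nat -> C) (z l : C) :
  cps a z l -> cps (fun j => Cmult c (a j)) z (Cmult c l).
Proof.
  intros H. apply (cseries_ext (fun j => Cmult c (Cmult (a j) (Cpow z j)))).
  - intros n. ring.
  - apply cseries_scal, H.
Qed.

Lemma cps_Cexp (w z : C) :
  cps (fun j => Cmult (RtoC (/ INR (fact j))) (Cpow w j)) z (Cexp (Cmult z w)).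
Proof.
  set (x := Cmult z w).
  apply (cseries_ext (fun j => Cmult (RtoC (/ INR (fact j))) (Cpow x j))).
  { intros n. unfold x. rewrite Cpow_mult_l. ring. }
  intros eps He.
  destruct (cv_speed_pow_fact (Cmod x) (eps / exp (Cmod x))) as [N HN].
  { apply Rdiv_lt_0_compat; [assumption|apply exp_pos]. }
  exists N. intros n Hn. specialize (HN n Hn). unfold Rdist in HN.
  rewrite Rminus_0_r in HN. apply Rabs_def2 in HN. destruct HN as [HN _].
  rewrite <- Cmod_opp. change (csum _ n) with (texp n x).
  replace (Copp (Cminus (texp n x) (Cexp x))) with (Cminus (Cexp x) (texp n x)) by ring.
  eapply Rle_lt_trans; [apply Cexp_texp|].
  apply (Rmult_lt_compat_l (exp (Cmod x))) in HN; [|apply exp_pos].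
  replace (exp (Cmod x) * (eps / exp (Cmod x))) with eps in HN
    by (field; pose proof (exp_pos (Cmod x)); lra).
  exact HN.
Qed.

Lemma cps_cpw (y : R) (s0 : C) : exists a, forall z, cps a z (cpw y (Cplus s0 z)).
Proof.
  exists (fun j => Cmult (cpw y s0) (Cmult (RtoC (/ INR (fact j))) (Cpow (Copp (RtoC (ln y))) j))).
  intros z. rewrite cpw_plus. apply cps_scal.
  replace (cpw y z) with (Cexp (Cmult z (Copp (RtoC (ln y))))); [apply cps_Cexp|].
  unfold cpw. f_equal. ring.
Qed.

Lemma cps_hterm (n : R) (s0 : C) : exists a, forall z, cps a z (hterm n (Cplus s0 z)).
Proof.
  destruct (cps_cpw n s0) as [a Ha].
  destruct (cps_cpw (n + /2) (Cminus s0 (RtoC 1))) as [b Hb].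
  destruct (cps_cpw (n - /2) (Cminus s0 (RtoC 1))) as [c Hc].
  eexists. intros z. unfold hterm. apply cps_plus.
  - replace (Cminus (Cplus s0 z) (RtoC 1)) with (Cplus (Cminus s0 (RtoC 1)) z) by ring.
    apply cps_linear, Ha.
  - replace (Cminus (Cplus s0 z) (RtoC 1)) with (Cplus (Cminus s0 (RtoC 1)) z) by ring.
    replace (Cminus (cpw (n + / 2) (Cplus (Cminus s0 (RtoC 1)) z)) (cpw (n - / 2) (Cplus (Cminus s0 (RtoC 1)) z)))
      with (Cplus (cpw (n + / 2) (Cplus (Cminus s0 (RtoC 1)) z))
              (Cmult (Copp (RtoC 1)) (cpw (n - / 2) (Cplus (Cminus s0 (RtoC 1)) z)))) by ring.
    apply cps_plus; [apply Hb|]. apply cps_scal, Hc.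
Qed.

Lemma Re_csum_RtoC (b : nat -> R) (n : nat) :
  Re (csum (fun i => RtoC (b i)) (S n)) = sum_f_R0 b n.
Proof.
  induction n as [|n IH].
  - unfold Re; simpl. ring.
  - rewrite tech5, <- IH. reflexivity.
Qed.

Lemma Re_csum_le_Series (b : nat -> R) (n : nat) :
  (forall i, 0 <= b i) -> ex_series b -> Re (csum (fun i => RtoC (b i)) n) <= Series b.
Proof.
  intros Hb Hs.
  assert (P : forall i, 0 <= Series (fun k => b (i + k)%nat)).
  { intros i. replace 0 with (Series (fun _ => 0)).
    - apply Series_le; [intros; split; [lra|apply Hb]|].
      apply (ex_series_incr_n b i), Hs.
    - apply is_series_unique. apply is_series_Reals. intros eps He. exists 0%nat. intros n0 _.
      rewrite sum_eq_R0 by auto. unfold Rdist. rewrite Rminus_0_r, Rabs_R0. lra. }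
  destruct n as [|n].
  - unfold Re; simpl. apply (P 0%nat).
  - rewrite Re_csum_RtoC, (Series_incr_n b (S n)) by (lia || assumption).
    specialize (P (S n)). simpl pred. lra.
Qed.

(** Weierstrass's theorem that a dominated sum of analytic functions is analytic. The domination is
    imposed on the Taylor coefficients, where the Cauchy estimate supplies it; it allows the
    coefficients to be summed over [n] one degree at a time. *)
Lemma cps_of_sum (c : nat -> nat -> C) (F : nat -> C -> C) (h : C -> C) (K : nat -> R) (r : R) :
  0 < r -> ex_series K ->
  (forall n j, Cmod (c n j) * r ^ j <= K n) ->
  (forall n z, Cmod z < r -> cps (c n) z (F n z)) ->
  (forall z, Cmod z < r -> cseries (fun n => F n z) (h z)) ->
  exists a, forall z, Cmod z < r -> cps a z (h z).
Proof.
  intros Hr HK Hc HF Hh.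
  assert (K0 : forall n, 0 <= K n).
  { intros n. eapply Rle_trans; [|apply (Hc n 0%nat)]. simpl.
    rewrite Rmult_1_r. apply Cmod_ge_0. }
  assert (Ex : forall j, exists l, cseries (fun n => c n j) l).
  { intros j. apply cseries_dominated with (fun n => / r ^ j * K n).
    - intros n. apply (Rmult_le_reg_r (r ^ j)); [apply pow_lt; lra|].
      replace (/ r ^ j * K n * r ^ j) with (K n) by (field; apply pow_nonzero; lra). apply Hc.
    - apply (ex_series_scal_l (K := R_AbsRing) (V := R_NormedModule) (/ r ^ j) K), HK. }
  destruct (functional_choice _ Ex) as [a Ha].
  exists a. intros z Hz. set (q := Cmod z / r).
  assert (Hq : 0 <= q < 1).
  { pose proof (Cmod_ge_0 z). unfold q. split; [apply Rdiv_le_0_compat; lra|].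
    apply (Rmult_lt_reg_r r); [lra|]. unfold Rdiv. rewrite Rmult_assoc, Rinv_l; lra. }
  assert (Key : forall J, Cmod (Cminus (h z) (csum (fun j => Cmult (a j) (Cpow z j)) J))
                  <= Series K / (1 - q) * q ^ J).
  { intros J.
    (* the difference is itself the sum over n of the Taylor remainders of F n *)
    assert (S1 : cseries (fun n => Cminus (F n z) (csum (fun j => Cmult (c n j) (Cpow z j)) J))
       (Cminus (h z) (csum (fun j => Cmult (a j) (Cpow z j)) J))).
    { apply cseries_plus; [apply Hh; assumption|].
      apply (cseries_ext (fun n => Cmult (Copp (RtoC 1)) (csum (fun j => Cmult (c n j) (Cpow z j)) J)));
        [intros; ring|].
      replace (Copp (csum (fun j => Cmult (a j) (Cpow z j)) J))
        with (Cmult (Copp (RtoC 1)) (csum (fun j => Cmult (a j) (Cpow z j)) J)) by ring.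
      apply cseries_scal. clear -Ha. induction J as [|J IH]; simpl.
      - intros eps He. exists 0%nat. intros n _. rewrite csum_zero.
        replace (Cminus (RtoC 0) (RtoC 0)) with (RtoC 0) by ring. rewrite Cmod_0. lra.
      - apply cseries_plus; [exact IH|].
        apply (cseries_ext (fun n => Cmult (Cpow z J) (c n J))); [intros; ring|].
        rewrite Cmult_comm. apply cseries_scal, Ha. }
    replace (Cminus (h z) _) with (Cminus (Cminus (h z) (csum (fun j => Cmult (a j) (Cpow z j)) J)) (RtoC 0)) by ring.
    apply cseries_bound with (1 := S1). exists 0%nat. intros N _.
    replace (Cminus (csum _ N) (RtoC 0)) with
      (csum (fun n => Cminus (F n z) (csum (fun j => Cmult (c n j) (Cpow z j)) J)) N) by ring.
    eapply Rle_trans; [apply (Cmod_csum _ (fun n => q ^ J / (1 - q) * K n))|].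
    - intros n _. eapply Rle_trans; [apply (cps_tail (c n) z (F n z) (K n) r q J)|].
      + lra.
      + assumption.
      + apply Hc.
      + unfold q. right. field. lra.
      + apply HF; assumption.
      + right. field. lra.
    - replace (Series K / (1 - q) * q ^ J) with (Series (fun n => q ^ J / (1 - q) * K n))
        by (rewrite Series_scal_l; field; lra).
      apply Re_csum_le_Series.
      + intros i. apply Rmult_le_pos; [|apply K0].
        apply Rdiv_le_0_compat; [apply pow_le|]; lra.
      + apply (ex_series_scal_l (K := R_AbsRing) (V := R_NormedModule) (q ^ J / (1 - q)) K), HK. }
  intros eps He.
  assert (L : is_lim_seq (fun N => Series K / (1 - q) * q ^ N) (Series K / (1 - q) * 0)).
  { apply (is_lim_seq_scal_l _ _ 0). apply is_lim_seq_geom. rewrite Rabs_right; lra. }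
  rewrite Rmult_0_r in L.
  destruct (proj1 (is_lim_seq_Reals _ _) L eps He) as [N HN].
  exists N. intros n Hn. specialize (HN n Hn). unfold Rdist in HN.
  rewrite Rminus_0_r in HN. apply Rabs_def2 in HN. specialize (Key n).
  rewrite <- Cmod_opp.
  match goal with |- Cmod ?x < _ => replace x with
    (Cminus (h z) (csum (fun j => Cmult (a j) (Cpow z j)) n)) by ring end.
  lra.
Qed.

(** * Uniqueness of analytic continuation *)

(** If all earlier coefficients vanish, then at a small real x where f(x) = 0 the term a_j x^j
    equals a tail of size O(x^(j+1)), so a_j is O(x), hence 0. *)
Lemma cps_zero (a : nat -> C) (f : C -> C) (rho delta : R) :
  0 < rho -> 0 < delta ->
  (forall z, Cmod z < rho -> cps a z (f z)) ->
  (forall x, 0 < x < delta -> f (RtoC x) = RtoC 0) ->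
  forall z, Cmod z < rho -> f z = RtoC 0.
Proof.
  intros Hrho Hd Hf H0.
  set (R0 := rho / 2). assert (HR : 0 < R0) by (unfold R0; lra).
  destruct (cps_coeff_bounded a R0 (f (RtoC R0))) as [C0 HC]; [lra|apply Hf|].
  { rewrite Cmod_R, Rabs_right; unfold R0; lra. }
  assert (HC0 : 0 <= C0).
  { eapply Rle_trans; [|apply (HC 0%nat)]. simpl. rewrite Rmult_1_r. apply Cmod_ge_0. }
  assert (Az : forall j, (forall i, (i < j)%nat -> a i = RtoC 0) -> a j = RtoC 0).
  { intros j Hj. apply Cmod_eq_0. apply Rle_antisym; [|apply Cmod_ge_0].
    apply le_epsilon. intros eps He. rewrite Rplus_0_l.
    set (B := 2 * C0 / R0 ^ (S j)).
    assert (HB : 0 <= B) by (apply Rdiv_le_0_compat; [lra|apply pow_lt; lra]).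
    (* The point must lie where [f] vanishes, make the ratio of the geometric tail at most 1/2, and
       make the resulting bound [B * x] for the coefficient at most [eps]. *)
    assert (Hx : exists x, 0 < x < delta /\ x <= R0 / 2 /\ B * x <= eps).
    { exists (Rmin (delta / 2) (Rmin (R0 / 2) (eps / (B + 1)))).
      assert (0 < eps / (B + 1)) by (apply Rdiv_lt_0_compat; lra).
      pose proof (Rmin_l (delta / 2) (Rmin (R0 / 2) (eps / (B + 1)))).
      pose proof (Rmin_r (delta / 2) (Rmin (R0 / 2) (eps / (B + 1)))).
      pose proof (Rmin_l (R0 / 2) (eps / (B + 1))). pose proof (Rmin_r (R0 / 2) (eps / (B + 1))).
      assert (0 < Rmin (delta / 2) (Rmin (R0 / 2) (eps / (B + 1))))
        by (repeat apply Rmin_glb_lt; lra).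
      set (x := Rmin _ _) in *.
      repeat split; try lra.
      apply Rle_trans with ((B + 1) * (eps / (B + 1))); [apply Rmult_le_compat; lra|].
      right. field. lra. }
    destruct Hx as [x [Hx1 [Hx2 Hx3]]].
    assert (T := cps_tail a (RtoC x) (f (RtoC x)) C0 R0 (x / R0) (S j) HR).
    assert (Hq : 0 <= x / R0 <= /2).
    { split; [apply Rdiv_le_0_compat; lra|]. apply (Rmult_le_reg_r R0); [lra|].
      unfold Rdiv. rewrite Rmult_assoc, Rinv_l; lra. }
    specialize (T ltac:(lra) HC). rewrite Cmod_R, Rabs_right in T by lra.
    specialize (T ltac:(right; field; lra)).
    rewrite H0 in T by assumption.
    specialize (T ltac:(rewrite <- (H0 x) by assumption; apply Hf; rewrite Cmod_R, Rabs_right; unfold R0 in *; lra)).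
    simpl csum in T. rewrite (csum_ext _ (fun _ => RtoC 0)) in T
      by (intros i Hi; rewrite Hj by assumption; ring).
    rewrite csum_zero in T.
    replace (Cminus (RtoC 0) (Cplus (RtoC 0) (Cmult (a j) (Cpow (RtoC x) j))))
      with (Copp (Cmult (a j) (Cpow (RtoC x) j))) in T by ring.
    rewrite Cmod_opp, Cmod_mult, Cmod_pow, Cmod_R, Rabs_right in T by lra.
    eapply Rle_trans; [|exact Hx3].
    apply (Rmult_le_reg_r (x ^ j)); [apply pow_lt; lra|].
    eapply Rle_trans; [exact T|].
    apply Rle_trans with (2 * (C0 * (x / R0) ^ S j)).
    - unfold Rdiv at 1. rewrite Rmult_comm. apply Rmult_le_compat_r.
      + apply Rmult_le_pos; [lra|apply pow_le; lra].
      + rewrite <- (Rinv_inv 2). apply Rinv_le_contravar; lra.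
    - right. unfold B. unfold Rdiv. rewrite Rpow_mult_distr, pow_inv. simpl. field.
      split; [apply pow_nonzero; lra|lra]. }
  assert (Aall : forall j, a j = RtoC 0).
  { intros j. induction j as [j IH] using (well_founded_induction Wf_nat.lt_wf). apply Az, IH. }
  intros z Hz. apply (cseries_unique _ _ _ (Hf z Hz)).
  intros eps He. exists 0%nat. intros n _.
  rewrite (csum_ext _ (fun _ => RtoC 0)) by (intros i _; rewrite Aall; ring).
  rewrite csum_zero. replace (Cminus (RtoC 0) (RtoC 0)) with (RtoC 0) by ring.
  rewrite Cmod_0. lra.
Qed.

(** Analyticity is available only locally, so the zero set is extended leftwards along a horizontal
    ray by a supremum argument: at the leftmost point reached, [g] vanishes on a one-sided
    neighbourhood, hence by [cps_zero] on a full disc. *)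
Lemma identity_on_ray (g : C -> C) (t : R) :
  (forall u, /2 <= u -> exists a rho, 0 < rho /\
     forall z, Cmod z < rho -> cps a z (g (Cplus (u, t) z))) ->
  (forall u, 1 < u -> g (u, t) = RtoC 0) ->
  g (/2, t) = RtoC 0.
Proof.
  intros Ha Hg.
  (* The abscissa is [3/2 - x], so that moving left increases [x] and [completeness] applies; the
     cap [x <= 1] is the critical line. *)
  set (E := fun x => x <= 1 /\ forall u, 3/2 - x < u -> g (u, t) = RtoC 0).
  destruct (completeness E) as [X [Hub Hlub]].
  - exists 1. intros x [Hx _]. exact Hx.
  - exists (/2). split; [lra|]. intros u Hu. apply Hg. lra.
  - assert (HX2 : /2 <= X) by (apply Hub; split; [lra|intros u Hu; apply Hg; lra]).
    assert (HX1 : X <= 1) by (apply Hlub; intros x [Hx _]; exact Hx).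
    assert (Hr : forall u, 3/2 - X < u -> g (u, t) = RtoC 0).
    { intros u Hu.
      destruct (Classical_Prop.classic (exists x, E x /\ 3/2 - x < u)) as [[x [[_ Hx] Hxu]]|Hn].
      - apply Hx, Hxu.
      - exfalso. assert (X <= 3/2 - u); [|lra]. apply Hlub. intros x Hx.
        apply Rnot_lt_le. intros Hlt. apply Hn. exists x. split; [assumption|lra]. }
    set (c := 3/2 - X) in *.
    destruct (Ha c ltac:(unfold c; lra)) as [a [rho [Hrho Hps]]].
    assert (Hz := cps_zero a (fun z => g (Cplus (c, t) z)) rho 1 Hrho ltac:(lra) Hps).
    cbv beta in Hz.
    assert (Hz' : forall z, Cmod z < rho -> g (Cplus (c, t) z) = RtoC 0).
    { apply Hz. intros x Hx. replace (Cplus (c, t) (RtoC x)) with ((c + x, t) : C).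
      - apply Hr. lra.
      - unfold Cplus, RtoC; simpl. f_equal; ring. }
    assert (Hd : forall x, Rabs x < rho -> g (c + x, t) = RtoC 0).
    { intros x Hx. replace ((c + x, t) : C) with (Cplus (c, t) (RtoC x)).
      - apply Hz'. rewrite Cmod_R. exact Hx.
      - unfold Cplus, RtoC; simpl. f_equal; ring. }
    destruct (Rle_lt_or_eq_dec _ _ HX1) as [Hlt|Heq].
    + exfalso.
      set (d := Rmin (rho / 2) (1 - X)).
      assert (Hd0 : 0 < d) by (apply Rmin_glb_lt; lra).
      pose proof (Rmin_l (rho / 2) (1 - X)) as M1. pose proof (Rmin_r (rho / 2) (1 - X)) as M2.
      fold d in M1, M2.
      assert (E (X + d)); [|specialize (Hub _ H); lra].
      split; [lra|]. intros u Hu.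
      destruct (Rlt_le_dec c u) as [Hu'|Hu']; [apply Hr; exact Hu'|].
      replace u with (c + (u - c)) by ring. apply Hd. apply Rabs_def1; unfold c in *; lra.
    + replace (/2) with (c + 0) by (unfold c; lra). apply Hd. rewrite Rabs_R0. assumption.
Qed.

(** * Continuation of the Dirichlet series to the critical line *)

Lemma csum_hterm (s : C) (N : nat) :
  csum (fun i => hterm (INR (S i)) s) N =
  Cplus (Cmult (Cminus s (RtoC 1)) (csum (fun i => cpw (INR (S i)) s) N))
    (Cminus (cpw (INR N + /2) (Cminus s (RtoC 1))) (cpw (/2) (Cminus s (RtoC 1)))).
Proof.
  induction N as [|N IH].
  - simpl. rewrite Rplus_0_l. ring.
  - rewrite !csum_S, IH. unfold hterm.
    replace (INR (S N) - /2) with (INR N + /2) by (rewrite S_INR; field). ring.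
Qed.

Lemma exp_le_exp (x y : R) : x <= y -> exp x <= exp y.
Proof.
  intros [H| ->]; [left; apply exp_increasing; assumption|lra].
Qed.

Lemma ex_series_inv_prod : ex_series (fun i => / (INR (S i) * INR (S (S i)))).
Proof.
  exists 1. apply is_series_Reals. intros eps He.
  destruct (archimed_cor1 eps He) as [N [HN HN0]]. exists N. intros n Hn.
  assert (E : sum_f_R0 (fun i => / (INR (S i) * INR (S (S i)))) n = 1 - / INR (S (S n))).
  { clear. induction n as [|n IH].
    - simpl. field.
    - rewrite tech5, IH, !S_INR. pose proof (pos_INR n). field. lra. }
  rewrite E. unfold Rdist. replace (1 - / INR (S (S n)) - 1) with (- / INR (S (S n))) by ring.
  assert (0 < INR N) by (apply lt_0_INR; lia).
  assert (INR N <= INR (S (S n))) by (apply le_INR; lia).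
  rewrite Rabs_Ropp, Rabs_right.
  - eapply Rle_lt_trans; [apply Rinv_le_contravar|exact HN]; lra.
  - apply Rle_ge. left. apply Rinv_0_lt_compat. lra.
Qed.

Lemma hterm_summable_bound (R0 : R) : 0 <= R0 -> exists K, 0 <= K /\ forall (s : C) (i : nat),
  0 <= Re s -> Cmod s <= R0 ->
  Cmod (hterm (INR (S i)) s) <= K * / (INR (S i) * INR (S (S i))).
Proof.
  (* With n >= 1 one has (n - 1/2)^(-Re s) <= 2^R0, and (n - 1/2)^(-2) <= 8 / (n (n + 1)), with
     equality at n = 1. *)
  intros HR. exists ((R0 + 1) * (R0 * (R0 + 1)) * (Rpower 2 R0 * 8)).
  assert (HP : 0 < Rpower 2 R0) by apply exp_pos.
  split; [repeat apply Rmult_le_pos; lra|].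
  intros s i Hs Hm.
  assert (Hn : 1 <= INR (S i)) by (rewrite S_INR; pose proof (pos_INR i); lra).
  set (n := INR (S i)) in *.
  assert (Hn1 : INR (S (S i)) = n + 1) by (rewrite S_INR; reflexivity). rewrite Hn1.
  eapply Rle_trans; [apply hterm_bound; assumption|].
  assert (M1 : Cmod (Cminus s (RtoC 1)) <= R0 + 1).
  { eapply Rle_trans; [apply Cmod_triangle|]. rewrite Cmod_opp, Cmod_1. lra. }
  assert (M2 : Cmod (Cplus s (RtoC 1)) <= R0 + 1).
  { eapply Rle_trans; [apply Cmod_triangle|]. rewrite Cmod_1. lra. }
  pose proof (Cmod_ge_0 s). pose proof (Cmod_ge_0 (Cminus s (RtoC 1))).
  pose proof (Cmod_ge_0 (Cplus s (RtoC 1))).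
  assert (Hre : Re s <= R0).
  { eapply Rle_trans; [apply Rle_abs|]. eapply Rle_trans; [apply re_le_Cmod|lra]. }
  assert (Hpow : Rpower (n - /2) (- Re s - 2) <= Rpower 2 R0 * 8 * / (n * (n + 1))).
  { replace (- Re s - 2) with (- Re s + - (INR 2)) by (simpl; ring).
    rewrite Rpower_plus, (Rpower_Ropp _ (INR 2)), Rpower_pow by lra.
    rewrite (Rmult_assoc _ 8). apply Rmult_le_compat.
    - left; apply exp_pos.
    - left. apply Rinv_0_lt_compat. apply pow_lt. lra.
    - eapply Rle_trans; [apply (Rpower_antitone (/2)); lra|].
      unfold Rpower. rewrite ln_Rinv by lra. apply exp_le_exp.
      assert (0 < ln 2) by (rewrite <- ln_1; apply ln_increasing; lra). nra.
    - apply (Rmult_le_reg_r ((n - /2) ^ 2)); [apply pow_lt; lra|].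
      rewrite Rinv_l by (apply pow_nonzero; lra).
      apply (Rmult_le_reg_r (n * (n + 1))); [nra|].
      replace (8 * / (n * (n + 1)) * (n - / 2) ^ 2 * (n * (n + 1))) with (8 * (n - /2) ^ 2)
        by (field; lra).
      nra. }
  rewrite (Rmult_assoc _ (_ * 8)). apply Rmult_le_compat.
  - apply Rmult_le_pos; [assumption|apply Rmult_le_pos; assumption].
  - left; apply exp_pos.
  - apply Rmult_le_compat; try assumption; [apply Rmult_le_pos; assumption|].
    apply Rmult_le_compat; assumption.
  - exact Hpow.
Qed.

Lemma hterm_sum_exists : exists h : C -> C, forall s, 0 <= Re s ->
  cseries (fun i => hterm (INR (S i)) s) (h s).
Proof.
  apply (functional_choice (fun s l => 0 <= Re s -> cseries (fun i => hterm (INR (S i)) s) l)).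
  (* Outside the half-plane the value 0 is a mere default. *)
  intros s. destruct (Rle_dec 0 (Re s)) as [Hs|Hs]; [|exists (RtoC 0); intros; contradiction].
  destruct (hterm_summable_bound (Cmod s) (Cmod_ge_0 s)) as [K [_ HK]].
  destruct (cseries_dominated (fun i => hterm (INR (S i)) s) (fun i => K * / (INR (S i) * INR (S (S i))))) as [l Hl].
  - intros n. apply HK; lra.
  - apply (ex_series_scal_l (K := R_AbsRing) (V := R_NormedModule) K), ex_series_inv_prod.
  - exists l. intros _. exact Hl.
Qed.

(** The radius 1/4 keeps the disc inside Re s >= 0, where the terms are uniformly summable; the
    Cauchy estimate on the bounding circle transfers this to their Taylor coefficients. *)
Lemma hterm_sum_cps (h : C -> C) (s0 : C) :
  (forall s, 0 <= Re s -> cseries (fun i => hterm (INR (S i)) s) (h s)) ->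
  /2 <= Re s0 -> exists a, forall z, Cmod z < /4 -> cps a z (h (Cplus s0 z)).
Proof.
  intros Hh Hs0.
  destruct (hterm_summable_bound (Cmod s0 + /4)) as [K [K0 HK]].
  { pose proof (Cmod_ge_0 s0). lra. }
  destruct (functional_choice _ (fun n => cps_hterm (INR (S n)) s0)) as [c Hc].
  assert (HRe : forall z, Cmod z <= /4 -> 0 <= Re (Cplus s0 z)).
  { intros z Hz. pose proof (re_le_Cmod z) as H. apply Rabs_le_between in H.
    unfold Re in *. simpl. lra. }
  apply (cps_of_sum c (fun n z => hterm (INR (S n)) (Cplus s0 z)) (fun z => h (Cplus s0 z))
    (fun i => K * / (INR (S i) * INR (S (S i))))).
  - lra.
  - apply (ex_series_scal_l (K := R_AbsRing) (V := R_NormedModule) K), ex_series_inv_prod.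
  - intros n j.
    destruct (cps_coeff_bounded (c n) 1 _ ltac:(lra) (Hc n (RtoC 1))) as [C0 HC0].
    apply (cauchy_estimate (c n) (fun z => hterm (INR (S n)) (Cplus s0 z)) C0 1); [lra|exact HC0| |].
    + intros z _. apply Hc.
    + intros z Hz. apply HK; [apply HRe; lra|].
      eapply Rle_trans; [apply Cmod_triangle|]. lra.
  - intros n z _. apply Hc.
  - intros z Hz. apply Hh, HRe. lra.
Qed.

Lemma cpw_tends_0 (s : C) : 0 < Re s -> forall eps, 0 < eps ->
  exists N, forall n, (N <= n)%nat -> Cmod (cpw (INR n + /2) s) < eps.
Proof.
  intros Hs eps He.
  destruct (nfloor_ex (exp (- ln eps / Re s)) ltac:(left; apply exp_pos)) as [N [_ HN]].
  exists (S N). intros n Hn. rewrite Cmod_cpw. unfold Rpower.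
  rewrite <- (exp_ln eps) by assumption. apply exp_increasing.
  assert (Hlt : exp (- ln eps / Re s) < INR n + /2).
  { assert (INR (S N) <= INR n) by (apply le_INR; assumption). rewrite S_INR in *. lra. }
  apply ln_increasing in Hlt; [|apply exp_pos]. rewrite ln_exp in Hlt.
  apply (Rmult_lt_compat_l (Re s)) in Hlt; [|assumption].
  replace (Re s * (- ln eps / Re s)) with (- ln eps) in Hlt by (field; lra). lra.
Qed.

(** For Re s > 1 this is the telescoped sum of the midpoint errors, [cpw (/2) (s - 1)] being the
    contribution of the endpoint x = 1/2. Both sides are analytic for Re s >= 1/2 on the line of
    height [t], which avoids the pole, so the identity extends. *)
Lemma zeta_hterm (zeta : C -> C) (t : R) : is_riemann_zeta zeta -> t <> 0 ->
  let s := ((/2, t) : C) in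
  cseries (fun i => hterm (INR (S i)) s)
    (Cminus (Cmult (Cminus s (RtoC 1)) (zeta s)) (cpw (/2) (Cminus s (RtoC 1)))).
Proof.
  intros [Hser Han] Ht s.
  destruct hterm_sum_exists as [h Hh].
  set (g := fun w => Cminus (Cminus (Cmult (Cminus w (RtoC 1)) (zeta w))
                               (cpw (/2) (Cminus w (RtoC 1)))) (h w)).
  assert (G : g s = RtoC 0).
  { apply identity_on_ray.
    - intros u Hu. set (s0 := ((u, t) : C)).
      destruct (Han s0) as [a [r [Hr Ha]]].
      { unfold s0, RtoC. intros E. injection E as _ E. contradiction. }
      destruct (hterm_sum_cps h s0 Hh) as [b Hb]; [exact Hu|].
      destruct (cps_cpw (/2) (Cminus s0 (RtoC 1))) as [c Hc].
      eexists. exists (Rmin r (/4)). split; [apply Rmin_glb_lt; lra|].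
      intros z Hz. pose proof (Rmin_l r (/4)). pose proof (Rmin_r r (/4)).
      assert (Az : cps a z (zeta (Cplus s0 z))).
      { apply is_pseries_cps.
        replace z with (Cminus (Cplus s0 z) s0) at 1 by ring. apply Ha.
        replace (Cminus (Cplus s0 z) s0) with z by ring. lra. }
      assert (Bz : cps b z (h (Cplus s0 z))) by (apply Hb; lra).
      specialize (Hc z).
      unfold g.
      replace (Cminus (Cplus s0 z) (RtoC 1)) with (Cplus (Cminus s0 (RtoC 1)) z) by ring.
      match goal with |- cps _ _ (Cminus (Cminus ?x ?y) ?w) =>
        replace (Cminus (Cminus x y) w) with
        (Cplus (Cplus x (Cmult (Copp (RtoC 1)) y)) (Cmult (Copp (RtoC 1)) w)) by ring end.
      apply cps_plus; [apply cps_plus|]; [apply cps_linear; exact Az|apply cps_scal; exact Hc|apply cps_scal; exact Bz].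
    - intros u Hu. set (w := ((u, t) : C)). unfold g.
      assert (E : h w = Cminus (Cmult (Cminus w (RtoC 1)) (zeta w)) (cpw (/2) (Cminus w (RtoC 1)))).
      { apply (cseries_unique (fun i => hterm (INR (S i)) w)); [apply Hh; unfold w, Re; simpl; lra|].
        assert (Hz : cseries (fun i => cpw (INR (S i)) w) (zeta w)).
        { apply cseries_is_series.
          apply (is_series_ext (fun n => dirichlet_term w (S n)));
            [intros; apply dirichlet_term_cpw|]. apply Hser. exact Hu. }
        apply (cseries_scal (Cminus w (RtoC 1))) in Hz.
        intros eps He. destruct (Hz (eps / 2) ltac:(lra)) as [N HN].
        destruct (cpw_tends_0 (Cminus w (RtoC 1))) with (eps := eps / 2) as [N' HN'];
          [unfold w, Re; simpl; lra|lra|].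
        exists (N + N')%nat. intros n Hn.
        specialize (HN n ltac:(lia)). specialize (HN' n ltac:(lia)).
        rewrite csum_scal in HN. rewrite csum_hterm.
        set (A := Cmult (Cminus w (RtoC 1)) (csum (fun i => cpw (INR (S i)) w) n)) in *.
        match goal with |- Cmod ?x < _ => replace x with
          (Cplus (Cminus A (Cmult (Cminus w (RtoC 1)) (zeta w)))
             (cpw (INR n + /2) (Cminus w (RtoC 1)))) by ring end.
        eapply Rle_lt_trans; [apply Cmod_triangle|]. lra. }
      rewrite E. ring. }
  assert (E : h s = Cminus (Cmult (Cminus s (RtoC 1)) (zeta s)) (cpw (/2) (Cminus s (RtoC 1)))).
  { unfold g in G. set (A := Cminus (Cmult _ _) _) in *.
    replace A with (Cplus (Cminus A (h s)) (h s)) by ring. rewrite G. ring. }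
  rewrite <- E. apply Hh. unfold s, Re; simpl. lra.
Qed.

(** The tail of the identity in [zeta_hterm] after [M] terms, divided by s - 1, whose modulus is at
    least t. The first error term is the endpoint M + 1/2, the second the sum of the remaining
    midpoint errors, where the factor |s - 1| cancels. *)
Lemma zeta_partial_sum (zeta : C -> C) (t : R) (M : nat) :
  is_riemann_zeta zeta -> 0 < t -> (1 <= M)%nat ->
  let s := ((/2, t) : C) in
  Cmod (Cminus (zeta s) (csum (fun i => cpw (INR (S i)) s) M))
    <= Rpower (INR M + /2) (/2) / t
       + Cmod s * Cmod (Cplus s (RtoC 1)) * Rpower (INR M) (- (3/2)).
Proof.
  intros Hz Ht HM s.
  assert (HM1 : 1 <= INR M) by (apply (le_INR 1); assumption).
  pose proof (zeta_hterm zeta t Hz ltac:(lra)) as H. cbv zeta in H. fold s in H.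
  set (Z := csum (fun i => cpw (INR (S i)) s) M).
  set (s' := Cminus s (RtoC 1)) in *.
  assert (Hs' : t <= Cmod s').
  { unfold s', s. eapply Rle_trans; [|apply Rmax_Cmod]. simpl.
    eapply Rle_trans; [|apply Rmax_r]. rewrite Rabs_right; lra. }
  assert (T : cseries (fun i => hterm (INR (S (M + i))) s)
     (Cminus (Cmult s' (Cminus (zeta s) Z)) (cpw (INR M + /2) s'))).
  { apply (cseries_shift (fun i => hterm (INR (S i)) s) _ M).
    rewrite csum_hterm. fold s' Z.
    match goal with |- cseries _ ?x => replace x with
      (Cminus (Cmult s' (zeta s)) (cpw (/2) s')) by ring end. exact H. }
  set (A := Cmod s' * (Cmod s * Cmod (Cplus s (RtoC 1)))).
  assert (HA : 0 <= A) by (repeat apply Rmult_le_pos; apply Cmod_ge_0).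
  set (P := Rpower (INR M) (- /2)).
  assert (HP : 0 < P) by apply exp_pos.
  assert (B : Cmod (Cminus (Cminus (Cmult s' (Cminus (zeta s) Z)) (cpw (INR M + /2) s')) (RtoC 0))
                <= A * (P / INR M)).
  { apply cseries_bound with (1 := T). exists 0%nat. intros n _.
    replace (Cminus (csum _ n) (RtoC 0)) with (csum (fun i => hterm (INR (S (M + i))) s) n) by ring.
    (* With n = M + i + 1 and x = M + i, (n - 1/2)^2 = (x + 1/2)^2 >= x (x + 1), so the inverse
       squares are dominated by a telescoping sum. *)
    eapply Rle_trans; [apply (Cmod_csum _ (fun i => A * P * (/ (INR M + INR i) - / (INR M + INR i + 1))))|].
    - intros i _. pose proof (pos_INR i).
      assert (E : INR (S (M + i)) = INR M + INR i + 1) by (rewrite S_INR, plus_INR; reflexivity).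
      eapply Rle_trans; [apply hterm_bound; [rewrite E; lra|unfold s, Re; simpl; lra]|].
      fold s' A. rewrite Rmult_assoc. apply Rmult_le_compat_l; [assumption|].
      rewrite E. set (x := INR M + INR i) in *. assert (INR M <= x) by (unfold x; lra).
      replace (- Re s - 2) with (- /2 + - INR 2) by (unfold s, Re; simpl; ring).
      rewrite Rpower_plus, (Rpower_Ropp _ (INR 2)), Rpower_pow by lra.
      apply Rmult_le_compat.
      + left; apply exp_pos.
      + left. apply Rinv_0_lt_compat, pow_lt. lra.
      + apply Rpower_antitone; lra.
      + replace (/ x - / (x + 1)) with (/ (x * (x + 1))) by (field; lra).
        apply Rinv_le_contravar; nra.
    - assert (E : Re (csum (fun i => RtoC (A * P * (/ (INR M + INR i) - / (INR M + INR i + 1)))) n)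
        = A * P * (/ INR M - / (INR M + INR n))).
      { clear -HM1. induction n as [|n IH].
        - simpl. unfold Re; simpl. rewrite Rplus_0_r. ring.
        - rewrite csum_S. unfold Re in *. simpl fst. rewrite IH, S_INR.
          rewrite <- (Rplus_assoc (INR M) (INR n) 1). ring. }
      rewrite E. unfold Rdiv. rewrite <- Rmult_assoc. apply Rmult_le_compat_l.
      + apply Rmult_le_pos; lra.
      + assert (0 < / (INR M + INR n)); [|lra].
        apply Rinv_0_lt_compat. pose proof (pos_INR n). lra. }
  assert (B' : Cmod s' * Cmod (Cminus (zeta s) Z) <= A * (P / INR M) + Rpower (INR M + /2) (/2)).
  { rewrite <- Cmod_mult.
    replace (Rpower (INR M + /2) (/2)) with (Cmod (cpw (INR M + /2) s')).
    - eapply Rle_trans; [|apply Rplus_le_compat_r, B].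
      eapply Rle_trans; [|apply Cmod_triangle]. right. f_equal. ring.
    - rewrite Cmod_cpw. f_equal. unfold s', s, Re; simpl. lra. }
  assert (E3 : Rpower (INR M) (- (3/2)) = P / INR M).
  { replace (- (3/2)) with (- /2 + - (1)) by field.
    rewrite Rpower_plus, (Rpower_Ropp _ 1), Rpower_1 by lra. reflexivity. }
  rewrite E3.
  apply (Rmult_le_reg_l (Cmod s')); [lra|].
  eapply Rle_trans; [exact B'|]. rewrite Rmult_plus_distr_l.
  rewrite Rplus_comm. apply Rplus_le_compat.
  - set (y := Rpower _ _). assert (0 < y) by apply exp_pos.
    apply Rle_trans with (t * (y / t)); [right; field; lra|].
    apply Rmult_le_compat_r; [apply Rdiv_le_0_compat; lra|assumption].
  - unfold A. right. ring.
Qed.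

Lemma analytic_at_continuous (f : C -> C) (z0 : C) : analytic_at f z0 ->
  forall eps, 0 < eps -> exists delta, 0 < delta /\
    forall z, Cmod (Cminus z z0) < delta -> Cmod (Cminus (f z) (f z0)) < eps.
Proof.
  intros [a [r [Hr Ha]]] eps He.
  assert (Hps : forall z, Cmod z < r -> cps a z (f (Cplus z0 z))).
  { intros z Hz. apply is_pseries_cps.
    replace z with (Cminus (Cplus z0 z) z0) at 1 by ring. apply Ha.
    replace (Cminus (Cplus z0 z) z0) with z by ring. assumption. }
  set (R0 := r / 2). assert (HR : 0 < R0) by (unfold R0; lra).
  destruct (cps_coeff_bounded a R0 (f (Cplus z0 (RtoC R0)))) as [C0 HC]; [lra| |].
  { apply Hps. rewrite Cmod_R, Rabs_right; unfold R0; lra. }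
  assert (HC0 : 0 <= C0).
  { eapply Rle_trans; [|apply (HC 0%nat)]. simpl. rewrite Rmult_1_r. apply Cmod_ge_0. }
  assert (E0 : f z0 = a 0%nat).
  { replace z0 with (Cplus z0 (RtoC 0)) by ring.
    assert (H0 : cps a (RtoC 0) (f (Cplus z0 (RtoC 0)))) by (apply Hps; rewrite Cmod_0; lra).
    apply (cseries_unique _ _ _ H0). intros e Hee. exists 1%nat. intros [|n] Hn; [lia|].
    rewrite (csum_single _ (S n) 0) by
      (lia || (intros [|i] _ Hi; [lia|]; rewrite Cpow_S; ring)).
    replace (Cminus _ _) with (RtoC 0) by (simpl; ring). rewrite Cmod_0. assumption. }
  (* For |w| <= d the tail is at most 2 C0 |w| / R0 < eps; the summand [eps] keeps the denominator
     positive when [C0 = 0]. *)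
  set (d := eps * R0 / (2 * C0 + eps)).
  assert (Hd : 0 < d) by (apply Rdiv_lt_0_compat; nra).
  exists (Rmin (R0 / 2) d). split; [apply Rmin_glb_lt; lra|].
  intros z Hz. pose proof (Rmin_l (R0 / 2) d). pose proof (Rmin_r (R0 / 2) d).
  set (w := Cminus z z0) in *. pose proof (Cmod_ge_0 w).
  set (q := Cmod w / R0).
  assert (Hq : 0 <= q <= /2).
  { unfold q. split; [apply Rdiv_le_0_compat; lra|]. apply (Rmult_le_reg_r R0); [lra|].
    unfold Rdiv. rewrite Rmult_assoc, Rinv_l; lra. }
  assert (T := cps_tail a w (f z) C0 R0 q 1 HR ltac:(lra) HC).
  specialize (T ltac:(unfold q; right; field; lra)).
  assert (Hw : cps a w (f z)).
  { replace z with (Cplus z0 w) at 1 by (unfold w; ring). apply Hps. unfold R0 in *. lra. }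
  specialize (T Hw). simpl in T. rewrite Rmult_1_r in T. rewrite E0.
  replace (Cminus (f z) (Cplus (RtoC 0) (Cmult (a 0%nat) (RtoC 1))))
    with (Cminus (f z) (a 0%nat)) in T by ring.
  eapply Rle_lt_trans; [exact T|].
  apply Rle_lt_trans with (2 * C0 * q).
  - apply (Rmult_le_reg_r (1 - q)); [lra|]. unfold Rdiv. rewrite Rmult_assoc, Rinv_l by lra.
    assert (0 <= C0 * q) by (apply Rmult_le_pos; lra). nra.
  - unfold q. apply (Rmult_lt_reg_r (R0 * (2 * C0 + eps))); [nra|].
    replace (2 * C0 * (Cmod w / R0) * (R0 * (2 * C0 + eps)))
      with (2 * C0 * (Cmod w * (2 * C0 + eps))) by (field; lra).
    assert (Cmod w * (2 * C0 + eps) < eps * R0).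
    { apply Rlt_le_trans with (d * (2 * C0 + eps)); [apply Rmult_lt_compat_r; lra|].
      unfold d. right. field. lra. }
    apply Rle_lt_trans with (2 * C0 * (eps * R0)).
    + apply Rmult_le_compat_l; lra.
    + assert (0 < eps * R0 * eps) by (apply Rmult_lt_0_compat; [apply Rmult_lt_0_compat|]; lra). nra.
Qed.

(** * Formal Dirichlet polynomials *)

Section Divisibility.
Import ssreflect ssrfun ssrbool ssrnat eqtype seq div prime.

Definition supp (U : nat -> Prop) (n : nat) : Prop :=
  leq 1 n /\ forall p, prime p -> dvdn p n -> U p.

Lemma supp_1 (U : nat -> Prop) : supp U 1.
Proof. split=> // p pp; rewrite dvdn1 => /eqP E; by rewrite E in pp. Qed.

Lemma supp_mul (U : nat -> Prop) (m n : nat) : supp U m -> supp U n -> supp U (Nat.mul m n).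
Proof.
  move=> [m0 Hm] [n0 Hn]; rewrite multE; split; first by rewrite muln_gt0 m0.
  move=> p pp; rewrite Euclid_dvdM // => /orP [H|H]; [exact: Hm|exact: Hn].
Qed.

Lemma supp_prime (U : nat -> Prop) (q : nat) : prime q -> U q -> supp U q.
Proof.
  move=> pq Uq; split; first exact: prime_gt0.
  move=> p pp; rewrite dvdn_prime2 // => /eqP ->; exact: Uq.
Qed.

Lemma supp_weaken (U V : nat -> Prop) (n : nat) : (forall p, U p -> V p) -> supp U n -> supp V n.
Proof. move=> UV [n0 H]; split=> // p pp pn; apply: UV; exact: H. Qed.

Lemma supp_coprime (U V : nat -> Prop) (m n : nat) :
  (forall p, U p -> V p -> False) -> supp U m -> supp V n -> coprime m n.
Proof.
  move=> UV [m0 Hm] [n0 Hn]; rewrite /coprime; apply/eqP.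
  have g0 : leq 1 (gcdn m n) by rewrite gcdn_gt0 m0.
  case: (leqP (gcdn m n) 1) => [g1|g1]; first by apply/eqP; rewrite eqn_leq g1 g0.
  have [p pp pg] := pdivP g1.
  exfalso; apply: (UV p); [apply: Hm|apply: Hn] => //; apply: (dvdn_trans pg);
    [exact: dvdn_gcdl|exact: dvdn_gcdr].
Qed.

Lemma dvdn_mul_coprime (a b a' b' : nat) : coprime a b' -> coprime a' b ->
  dvdn (Nat.mul a a') (Nat.mul b b') = andb (dvdn a b) (dvdn a' b').
Proof.
  move=> c1 c2; rewrite multE; apply/idP/andP => [H|[H1 H2]]; last exact: dvdn_mul.
  split.
  - have : dvdn a (muln b b') by apply: dvdn_trans H; exact: dvdn_mulr.
    by rewrite Gauss_dvdl.
  - have : dvdn a' (muln b b') by apply: dvdn_trans H; exact: dvdn_mull.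
    by rewrite Gauss_dvdr.
Qed.

Lemma eq_mul_coprime (a b a' b' : nat) : coprime a b' -> coprime a' b ->
  coprime b a' -> coprime b' a -> leq 1 a' -> leq 1 b ->
  Nat.mul a a' = Nat.mul b b' -> a = b /\ a' = b'.
Proof.
  move=> c1 c2 c3 c4 a0 b0 E.
  have H1 : andb (dvdn a b) (dvdn a' b') by rewrite -dvdn_mul_coprime // E.
  have H2 : andb (dvdn b a) (dvdn b' a') by rewrite -dvdn_mul_coprime // E.
  move/andP: H1 => [ab ab']; move/andP: H2 => [ba ba'].
  split; apply/eqP; rewrite eqn_dvd; by apply/andP.
Qed.

Lemma prime_ge2 (p : nat) : prime p -> (2 <= p)%coq_nat.
Proof. by move/prime_gt1/leP. Qed.

Lemma leq_1_le (n : nat) : leq 1 n -> (1 <= n)%coq_nat.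
Proof. by move/leP. Qed.

Lemma prime_dvd_mul_other (p q n : nat) : prime p -> prime q -> p <> q ->
  dvdn q (Nat.mul p n) -> dvdn q n.
Proof.
  move=> pp pq ne; rewrite multE Euclid_dvdM // dvdn_prime2 // => /orP [/eqP E|//].
  by case: ne.
Qed.

Lemma dvdn_mul_l (q n : nat) : dvdn q (Nat.mul q n).
Proof. rewrite multE; exact: dvdn_mulr. Qed.

Lemma prime_not_dvd_1 (q : nat) : prime q -> dvdn q 1 = false.
Proof. by move=> pq; rewrite dvdn1; apply: negbTE; apply: contraTneq pq => ->. Qed.

Lemma not_dvd_coprime (q n : nat) : prime q -> (forall p, prime p -> dvdn p n -> p <> q) -> coprime q n.
Proof.
  move=> pq H; rewrite prime_coprime //; apply/negP => qn; exact: (H q pq qn).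
Qed.

Lemma dvdn_mul_same (q a b : nat) : leq 1 q -> dvdn (Nat.mul q a) (Nat.mul q b) = dvdn a b.
Proof. move=> q0; rewrite multE; exact: dvdn_pmul2l. Qed.

Lemma dvdn_mulr_coprime (q a b : nat) : coprime q a -> dvdn a (Nat.mul q b) = dvdn a b.
Proof. move=> c; rewrite multE Gauss_dvdr // coprime_sym //. Qed.

Lemma dvdn_eq (a b : nat) : leq 1 a -> dvdn a b -> exists n, Nat.mul n a = b.
Proof. move=> a0 /dvdnP [n ->]; by exists n. Qed.

End Divisibility.

(* The entry [(c, (a, b))] stands for the function [t |-> c (b/a)^(it)]. *)
Definition bp := list (R * (nat * nat)).

(** One functional covers all uses: [phi] may be the cosine or sine of the frequency, giving the
    values at t, the mean value of a monomial, giving the diagonal terms, or the constant 1, giving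
    the value at t = 0. *)
Fixpoint ev (F : bp) (phi : nat -> nat -> R) : R :=
  match F with
  | [] => 0
  | (c, (a, b)) :: F' => c * phi a b + ev F' phi
  end.

Definition bscale (c : R) (F : bp) : bp := map (fun x => (c * fst x, snd x)) F.

(** Complex conjugation: the coefficients are real, so only the frequency changes sign. *)
Definition bconj (F : bp) : bp := map (fun x => (fst x, (snd (snd x), fst (snd x)))) F.

Definition bmul (F G : bp) : bp :=
  flat_map (fun x => map (fun y => (fst x * fst y,
    ((fst (snd x) * fst (snd y))%nat, (snd (snd x) * snd (snd y))%nat))) G) F.

Definition bone : bp := [(1, (1%nat, 1%nat))].

Fixpoint bpow (F : bp) (r : nat) : bp :=
  match r with O => bone | S r' => bmul F (bpow F r') end.

Lemma ev_app (F G : bp) (phi : nat -> nat -> R) : ev (F ++ G) phi = ev F phi + ev G phi.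
Proof.
  induction F as [|[c [a b]] F IH]; simpl; [ring|]. rewrite IH. ring.
Qed.

Lemma ev_bscale (c : R) (F : bp) (phi : nat -> nat -> R) : ev (bscale c F) phi = c * ev F phi.
Proof.
  induction F as [|[d [a b]] F IH]; simpl; [ring|]. unfold bscale in *. rewrite IH. ring.
Qed.

Lemma ev_bconj (F : bp) (phi : nat -> nat -> R) :
  ev (bconj F) phi = ev F (fun a b => phi b a).
Proof.
  induction F as [|[d [a b]] F IH]; simpl; [ring|]. unfold bconj in *. rewrite IH. ring.
Qed.

Lemma ev_bmul (F G : bp) (phi : nat -> nat -> R) :
  ev (bmul F G) phi = ev F (fun a b => ev G (fun a' b' => phi (a * a')%nat (b * b')%nat)).
Proof.
  induction F as [|[c [a b]] F IH]; [reflexivity|].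
  change (bmul ((c, (a, b)) :: F) G) with
    (map (fun y : R * (nat * nat) => (c * fst y,
      ((a * fst (snd y))%nat, (b * snd (snd y))%nat))) G ++ bmul F G).
  rewrite ev_app, IH. cbn [ev]. f_equal.
  clear. induction G as [|[d [a' b']] G IH]; simpl; [ring|]. rewrite IH. ring.
Qed.

Lemma ev_bone (phi : nat -> nat -> R) : ev bone phi = phi 1%nat 1%nat.
Proof. simpl. ring. Qed.

Lemma ev_ext_on (F : bp) (phi psi : nat -> nat -> R) :
  (forall c a b, In (c, (a, b)) F -> phi a b = psi a b) -> ev F phi = ev F psi.
Proof.
  induction F as [|[c [a b]] F IH]; intros H; [reflexivity|]. simpl.
  rewrite (H c a b) by (left; reflexivity). rewrite IH; [reflexivity|].
  intros c' a' b' Hin. apply (H c'). right. exact Hin.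
Qed.

Lemma ev_ext (F : bp) (phi psi : nat -> nat -> R) :
  (forall a b, phi a b = psi a b) -> ev F phi = ev F psi.
Proof. intros H. apply ev_ext_on. auto. Qed.

Lemma ev_le (F : bp) (phi psi : nat -> nat -> R) :
  (forall c a b, In (c, (a, b)) F -> 0 <= c /\ phi a b <= psi a b) -> ev F phi <= ev F psi.
Proof.
  induction F as [|[c [a b]] F IH]; intros H; [simpl; lra|]. simpl.
  destruct (H c a b (or_introl eq_refl)) as [H1 H2].
  apply Rplus_le_compat.
  - apply Rmult_le_compat_l; assumption.
  - apply IH. intros c' a' b' Hin. apply H. right. exact Hin.
Qed.

Lemma ev_plus (F : bp) (phi psi : nat -> nat -> R) :
  ev F (fun a b => phi a b + psi a b) = ev F phi + ev F psi.
Proof. induction F as [|[c [a b]] F IH]; simpl; [ring|]. rewrite IH. ring. Qed.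

Lemma ev_scal (F : bp) (k : R) (phi : nat -> nat -> R) :
  ev F (fun a b => k * phi a b) = k * ev F phi.
Proof. induction F as [|[c [a b]] F IH]; simpl; [ring|]. rewrite IH. ring. Qed.

Lemma ev_minus (F : bp) (phi psi : nat -> nat -> R) :
  ev F (fun a b => phi a b - psi a b) = ev F phi - ev F psi.
Proof. induction F as [|[c [a b]] F IH]; simpl; [ring|]. rewrite IH. ring. Qed.

Lemma ev_zero (F : bp) : ev F (fun _ _ => 0) = 0.
Proof. induction F as [|[c [a b]] F IH]; simpl; [ring|]. rewrite IH. ring. Qed.

Lemma ev_swap (F G : bp) (phi : nat -> nat -> nat -> nat -> R) :
  ev F (fun a b => ev G (fun a' b' => phi a b a' b'))
  = ev G (fun a' b' => ev F (fun a b => phi a b a' b')).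
Proof.
  induction F as [|[c [a b]] F IH]; simpl; [symmetry; apply ev_zero|].
  rewrite IH, <- ev_scal, <- ev_plus. reflexivity.
Qed.

(** Nonnegative coefficients make [ev F] monotone, the primes in [U] make mean values multiplicative
    over disjoint sets of primes, and the length [N] controls the off-diagonal terms. *)
Definition good (U : nat -> Prop) (N : R) (F : bp) : Prop :=
  forall c a b, In (c, (a, b)) F ->
    0 <= c /\ supp U a /\ supp U b /\ INR a <= N /\ INR b <= N.

Lemma good_nonneg (U : nat -> Prop) (N : R) (F : bp) (phi : nat -> nat -> R) :
  good U N F -> (forall a b, 0 <= phi a b) -> 0 <= ev F phi.
Proof.
  intros HF Hphi. rewrite <- (ev_zero F). apply ev_le.
  intros c a b Hin. split; [apply (HF c a b Hin)|apply Hphi].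
Qed.

Lemma good_app (U : nat -> Prop) (N : R) (F G : bp) : good U N F -> good U N G -> good U N (F ++ G).
Proof.
  intros H1 H2 c a b Hin. apply in_app_or in Hin. destruct Hin as [Hin|Hin]; [apply (H1 c)|apply (H2 c)]; exact Hin.
Qed.

Lemma good_bscale (U : nat -> Prop) (N k : R) (F : bp) : 0 <= k -> good U N F -> good U N (bscale k F).
Proof.
  intros Hk H c a b Hin. unfold bscale in Hin. apply in_map_iff in Hin.
  destruct Hin as [[c' [a' b']] [E Hin]]. simpl in E. injection E as <- <- <-.
  destruct (H _ _ _ Hin) as [H1 H2]. split; [apply Rmult_le_pos; assumption|exact H2].
Qed.

Lemma good_bconj (U : nat -> Prop) (N : R) (F : bp) : good U N F -> good U N (bconj F).
Proof.
  intros H c a b Hin. unfold bconj in Hin. apply in_map_iff in Hin.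
  destruct Hin as [[c' [a' b']] [E Hin]]. simpl in E. injection E as <- <- <-.
  destruct (H _ _ _ Hin) as [H1 [H2 [H3 [H4 H5]]]]. auto.
Qed.

Lemma in_bmul (F G : bp) (c : R) (a b : nat) : In (c, (a, b)) (bmul F G) ->
  exists c1 a1 b1 c2 a2 b2, In (c1, (a1, b1)) F /\ In (c2, (a2, b2)) G /\
    c = c1 * c2 /\ a = (a1 * a2)%nat /\ b = (b1 * b2)%nat.
Proof.
  intros Hin. unfold bmul in Hin. apply in_flat_map in Hin.
  destruct Hin as [[c1 [a1 b1]] [H1 Hin]]. apply in_map_iff in Hin.
  destruct Hin as [[c2 [a2 b2]] [E H2]]. simpl in E. injection E as <- <- <-.
  exists c1, a1, b1, c2, a2, b2. auto.
Qed.

Lemma good_bmul (U : nat -> Prop) (N N' : R) (F G : bp) :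
  good U N F -> good U N' G -> good U (N * N') (bmul F G).
Proof.
  intros HF HG c a b Hin.
  destruct (in_bmul _ _ _ _ _ Hin) as [c1 [a1 [b1 [c2 [a2 [b2 [H1 [H2 [-> [-> ->]]]]]]]]]].
  destruct (HF _ _ _ H1) as [A1 [A2 [A3 [A4 A5]]]].
  destruct (HG _ _ _ H2) as [B1 [B2 [B3 [B4 B5]]]].
  rewrite !mult_INR.
  split; [apply Rmult_le_pos; assumption|].
  split; [apply supp_mul; assumption|]. split; [apply supp_mul; assumption|].
  split; apply Rmult_le_compat; auto using pos_INR.
Qed.

Lemma good_weaken (U V : nat -> Prop) (N N' : R) (F : bp) :
  (forall p, U p -> V p) -> N <= N' -> good U N F -> good V N' F.
Proof.
  intros HUV HN H c a b Hin. destruct (H _ _ _ Hin) as [A1 [A2 [A3 [A4 A5]]]].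
  split; [assumption|]. split; [eapply supp_weaken; eassumption|].
  split; [eapply supp_weaken; eassumption|]. lra.
Qed.

Lemma good_bone (U : nat -> Prop) (N : R) : 1 <= N -> good U N bone.
Proof.
  intros HN c a b [E|[]]. injection E as <- <- <-. simpl.
  split; [lra|]. split; [apply supp_1|]. split; [apply supp_1|]. lra.
Qed.

Lemma good_bpow (U : nat -> Prop) (N : R) (F : bp) (r : nat) :
  good U N F -> good U (N ^ r) (bpow F r).
Proof.
  intros H. induction r as [|r IH]; simpl; [apply good_bone; lra|].
  apply good_bmul; assumption.
Qed.

Lemma good_ge1 (U : nat -> Prop) (N : R) (F : bp) (c : R) (a b : nat) :
  good U N F -> In (c, (a, b)) F -> 1 <= INR a /\ 1 <= INR b.
Proof.
  intros H Hin. destruct (H _ _ _ Hin) as [_ [[Ha _] [[Hb _] _]]].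
  split; apply (le_INR 1), leq_1_le; assumption.
Qed.

(* The mean value of [(b/a)^(it)]. *)
Definition diag (a b : nat) : R := if Nat.eqb a b then 1 else 0.

(* The mean value of [(b/a)^(it)] times a long partial sum of [zeta (1/2 + it)]. *)
Definition dvd_weight (a b : nat) : R := if div.dvdn a b then sqrt (INR a / INR b) else 0.

Lemma diag_pos (a b : nat) : 0 <= diag a b.
Proof. unfold diag. destruct (Nat.eqb a b); lra. Qed.

Lemma dvd_weight_pos (a b : nat) : 0 <= dvd_weight a b.
Proof. unfold dvd_weight. destruct (div.dvdn a b); [apply sqrt_pos|lra]. Qed.

Lemma ev_bmul_split (F G : bp) (phi : nat -> nat -> R) :
  (forall c a b c' a' b', In (c, (a, b)) F -> In (c', (a', b')) G ->
     phi (a * a')%nat (b * b')%nat = phi a b * phi a' b') ->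
  ev (bmul F G) phi = ev F phi * ev G phi.
Proof.
  intros H. rewrite ev_bmul, Rmult_comm, <- ev_scal. apply ev_ext_on. intros c a b Hin.
  rewrite (Rmult_comm (ev G phi)), <- ev_scal. apply ev_ext_on. intros c' a' b' Hin'.
  apply (H c _ _ c'); assumption.
Qed.

Section Coprime.
Variables (U V : nat -> Prop) (N N' : R) (F G : bp).
Hypothesis UV : forall p, U p -> V p -> False.
Hypothesis HF : good U N F.
Hypothesis HG : good V N' G.

(** Unique factorization: if a, b are coprime to a', b', then a a' = b b' forces a = b and a' = b'.
    Thus the diagonals of independent ranges multiply. *)
Lemma ev_diag_bmul : ev (bmul F G) diag = ev F diag * ev G diag.
Proof.
  apply ev_bmul_split. intros c a b c' a' b' H H'.
  destruct (HF _ _ _ H) as [_ [Sa [Sb _]]]. destruct (HG _ _ _ H') as [_ [Sa' [Sb' _]]].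
  assert (VU : forall p, V p -> U p -> False) by (intros p Hv Hu; apply (UV p); assumption).
  unfold diag.
  destruct (Nat.eqb_spec a b) as [->|Hab]; destruct (Nat.eqb_spec a' b') as [->|Hab'].
  - rewrite Nat.eqb_refl. ring.
  - destruct (Nat.eqb_spec (b * a')%nat (b * b')%nat) as [E|_]; [|ring].
    exfalso. apply Hab'.
    apply (eq_mul_coprime b b a' b'); eauto using supp_coprime; [apply Sa'|apply Sb].
  - destruct (Nat.eqb_spec (a * b')%nat (b * b')%nat) as [E|_]; [|ring].
    exfalso. apply Hab.
    apply (eq_mul_coprime a b b' b'); eauto using supp_coprime; [apply Sa'|apply Sb].
  - destruct (Nat.eqb_spec (a * a')%nat (b * b')%nat) as [E|_]; [|ring].
    exfalso. apply Hab.
    apply (eq_mul_coprime a b a' b'); eauto using supp_coprime; [apply Sa'|apply Sb].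
Qed.

Lemma ev_dvd_weight_bmul : ev (bmul F G) dvd_weight = ev F dvd_weight * ev G dvd_weight.
Proof.
  apply ev_bmul_split. intros c a b c' a' b' H H'.
  destruct (HF _ _ _ H) as [_ [Sa [Sb _]]]. destruct (HG _ _ _ H') as [_ [Sa' [Sb' _]]].
  destruct (good_ge1 _ _ _ _ _ _ HF H). destruct (good_ge1 _ _ _ _ _ _ HG H').
  assert (VU : forall p, V p -> U p -> False) by (intros p Hv Hu; apply (UV p); assumption).
  unfold dvd_weight. rewrite dvdn_mul_coprime by eauto using supp_coprime.
  destruct (div.dvdn a b), (div.dvdn a' b'); simpl; try ring.
  rewrite <- sqrt_mult by (apply Rdiv_le_0_compat; lra).
  f_equal. rewrite !mult_INR. field. lra.
Qed.
End Coprime.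

(** * Values and mean values *)

Definition val (F : bp) (t : R) : C :=
  (ev F (fun a b => cos (t * (ln (INR b) - ln (INR a)))),
   ev F (fun a b => sin (t * (ln (INR b) - ln (INR a))))).

Lemma val_app (F G : bp) (t : R) : val (F ++ G) t = Cplus (val F t) (val G t).
Proof. unfold val. rewrite !ev_app. reflexivity. Qed.

Lemma val_bscale (c : R) (F : bp) (t : R) : val (bscale c F) t = Cmult (RtoC c) (val F t).
Proof. unfold val, Cmult, RtoC; simpl. rewrite !ev_bscale. f_equal; ring. Qed.

Lemma val_bone (t : R) : val bone t = RtoC 1.
Proof.
  unfold val. rewrite !ev_bone. replace (ln (INR 1) - ln (INR 1)) with 0 by ring.
  rewrite Rmult_0_r, cos_0, sin_0. reflexivity.
Qed.

Lemma val_bconj (F : bp) (t : R) : val (bconj F) t = Cconj (val F t).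
Proof.
  unfold val, Cconj; simpl. rewrite !ev_bconj. f_equal.
  - apply ev_ext. intros a b. rewrite <- cos_neg. f_equal. ring.
  - replace (- ev F _) with (-1 * ev F (fun a b => sin (t * (ln (INR b) - ln (INR a))))) by ring.
    rewrite <- ev_scal. apply ev_ext. intros a b.
    replace (t * (ln (INR a) - ln (INR b))) with (- (t * (ln (INR b) - ln (INR a)))) by ring.
    rewrite sin_neg. ring.
Qed.

Lemma val_bmul (U : nat -> Prop) (N N' : R) (F G : bp) (t : R) :
  good U N F -> good U N' G -> val (bmul F G) t = Cmult (val F t) (val G t).
Proof.
  intros HF HG. unfold val, Cmult; simpl. rewrite !ev_bmul.
  assert (L : forall c a b c' a' b', In (c, (a, b)) F -> In (c', (a', b')) G ->
     t * (ln (INR (b * b')) - ln (INR (a * a')))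
     = t * (ln (INR b) - ln (INR a)) + t * (ln (INR b') - ln (INR a'))).
  { intros c a b c' a' b' H H'.
    destruct (good_ge1 _ _ _ _ _ _ HF H). destruct (good_ge1 _ _ _ _ _ _ HG H').
    rewrite !mult_INR, !ln_mult by lra. ring. }
  f_equal.
  - rewrite (Rmult_comm (ev F _)), (Rmult_comm (ev F _)), <- !ev_scal, <- ev_minus.
    apply ev_ext_on. intros c a b H.
    rewrite (Rmult_comm (ev G _)), (Rmult_comm (ev G _)), <- !ev_scal, <- ev_minus.
    apply ev_ext_on. intros c' a' b' H'.
    rewrite (L c _ _ c') by assumption. rewrite cos_plus. ring.
  - rewrite (Rmult_comm (ev F _)), (Rmult_comm (ev F _)), <- !ev_scal, <- ev_plus.
    apply ev_ext_on. intros c a b H.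
    rewrite (Rmult_comm (ev G _)), (Rmult_comm (ev G _)), <- !ev_scal, <- ev_plus.
    apply ev_ext_on. intros c' a' b' H'.
    rewrite (L c _ _ c') by assumption. rewrite sin_plus. ring.
Qed.

Lemma val_bpow (U : nat -> Prop) (N : R) (F : bp) (r : nat) (t : R) :
  good U N F -> val (bpow F r) t = Cpow (val F t) r.
Proof.
  intros HF. induction r as [|r IH]; [apply val_bone|].
  simpl bpow. rewrite (val_bmul U N (N ^ r)) by (auto using good_bpow). rewrite IH.
  symmetry. apply Cpow_S.
Qed.

Lemma Cmod_val_le (U : nat -> Prop) (N : R) (F : bp) (t : R) :
  good U N F -> Cmod (val F t) <= ev F (fun _ _ => 1).
Proof.
  intros HF. induction F as [|[c [a b]] F IH].
  - simpl. unfold val; simpl. change ((0, 0) : C) with (RtoC 0). rewrite Cmod_0. lra.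
  - assert (HF' : good U N F) by (intros c' a' b' H; apply (HF c' a' b'); right; exact H).
    destruct (HF c a b (or_introl eq_refl)) as [Hc _].
    replace (val ((c, (a, b)) :: F) t) with
      (Cplus (Cmult (RtoC c) (Cexp ((0, t * (ln (INR b) - ln (INR a))) : C))) (val F t)).
    + eapply Rle_trans; [apply Cmod_triangle|]. simpl. apply Rplus_le_compat; [|auto].
      rewrite Cmod_mult, Cmod_R, Cmod_Cexp, Rabs_right by lra. unfold Re; simpl.
      rewrite exp_0. lra.
    + unfold val, Cplus, Cmult, Cexp, Re, Im, RtoC. simpl. rewrite exp_0. f_equal; ring.
Qed.

Lemma continuous_ev (F : bp) (f : R -> R) (t : R) :
  (forall x, continuous f x) ->
  continuous (fun t => ev F (fun a b => f (t * (ln (INR b) - ln (INR a))))) t.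
Proof.
  intros Hf. induction F as [|[c [a b]] F IH]; simpl; [apply continuous_const|].
  apply (continuous_plus (V := R_NormedModule)); [|exact IH].
  apply (continuous_scal_r (K := R_AbsRing) (V := R_NormedModule) c).
  apply (continuous_comp (fun t => t * (ln (INR b) - ln (INR a))) f); [|apply Hf].
  apply (continuous_scal_l (K := R_AbsRing) (V := R_NormedModule) (fun t => t)).
  apply continuous_id.
Qed.

Lemma is_RInt_cst (a b c v : R) : v = (b - a) * c -> is_RInt (fun _ => c) a b v.
Proof. intros ->. exact (is_RInt_const (V := R_NormedModule) a b c). Qed.

Lemma is_RInt_cos (x T1 T2 : R) : x <> 0 ->
  is_RInt (fun t => cos (t * x)) T1 T2 ((sin (T2 * x) - sin (T1 * x)) / x).
Proof.
  intros Hx.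
  replace ((sin (T2 * x) - sin (T1 * x)) / x) with (minus (sin (T2 * x) / x) (sin (T1 * x) / x))
    by (unfold minus, plus, opp; simpl; field; assumption).
  apply (is_RInt_derive (fun t => sin (t * x) / x)).
  - intros t _. auto_derive; [trivial|]. field. assumption.
  - intros t _. apply (continuous_comp (fun t => t * x) cos); [|apply continuous_cos].
    apply (continuous_scal_l (K := R_AbsRing) (V := R_NormedModule) (fun t => t)).
    apply continuous_id.
Qed.

(** A diagonal term integrates to T2 - T1, and a term of frequency x to at most 2/|x| <= 2/g. *)
Lemma mean_value (F : bp) (T1 T2 g : R) : T1 <= T2 -> 0 < g ->
  (forall c a b, In (c, (a, b)) F -> 0 <= c /\ (a <> b -> g <= Rabs (ln (INR b) - ln (INR a)))) ->
  Rabs (RInt (fun t => Re (val F t)) T1 T2 - (T2 - T1) * ev F diag) <= 2 / g * ev F (fun _ _ => 1).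
Proof.
  intros HT Hg HF.
  set (I := fun a b => if Nat.eqb a b then T2 - T1 else
     let x := ln (INR b) - ln (INR a) in (sin (T2 * x) - sin (T1 * x)) / x).
  assert (HI : is_RInt (fun t => Re (val F t)) T1 T2 (ev F I)).
  { unfold val, Re; simpl. clear -HF Hg. induction F as [|[c [a b]] F IH]; simpl.
    - apply is_RInt_cst. ring.
    - apply (is_RInt_plus (V := R_NormedModule)).
      + apply (is_RInt_scal (V := R_NormedModule)).
        unfold I. destruct (Nat.eqb_spec a b) as [->|Hab].
        * apply (is_RInt_ext (fun _ => 1)).
          { intros x _. replace (ln (INR b) - ln (INR b)) with 0 by ring.
            rewrite Rmult_0_r, cos_0. reflexivity. }
          apply is_RInt_cst. ring.
        * cbv zeta. apply is_RInt_cos.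
          destruct (HF c a b (or_introl eq_refl)) as [_ H]. specialize (H Hab).
          intros E. rewrite E, Rabs_R0 in H. lra.
      + apply IH. intros c' a' b' H. apply HF. right. exact H. }
  rewrite (is_RInt_unique _ _ _ _ HI), <- ev_scal, <- ev_minus, <- ev_scal.
  assert (B : forall c a b, In (c, (a, b)) F ->
    Rabs (I a b - (T2 - T1) * diag a b) <= 2 / g * 1).
  { intros c a b Hin. destruct (HF _ _ _ Hin) as [_ Hx]. unfold I, diag.
    assert (0 < 2 / g) by (apply Rdiv_lt_0_compat; lra).
    destruct (Nat.eqb_spec a b) as [E|E].
    - replace (T2 - T1 - (T2 - T1) * 1) with 0 by ring. rewrite Rabs_R0. lra.
    - specialize (Hx E). cbv zeta. set (x := ln (INR b) - ln (INR a)) in *.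
      rewrite Rmult_0_r, Rminus_0_r, Rmult_1_r. unfold Rdiv. rewrite Rabs_mult, Rabs_inv.
      apply Rmult_le_compat; [apply Rabs_pos|left; apply Rinv_0_lt_compat; lra| |apply Rinv_le_contravar; lra].
      pose proof (SIN_bound (T2 * x)). pose proof (SIN_bound (T1 * x)). apply Rabs_le. lra. }
  apply Rabs_le. split.
  - replace (- ev F (fun _ _ => 2 / g * 1)) with (-1 * ev F (fun _ _ => 2 / g * 1)) by ring.
    rewrite <- ev_scal. apply ev_le. intros c a b Hin. specialize (B c a b Hin).
    apply Rabs_le_between in B. split; [apply (HF _ _ _ Hin)|lra].
  - apply ev_le. intros c a b Hin. specialize (B c a b Hin).
    apply Rabs_le_between in B. split; [apply (HF _ _ _ Hin)|lra].
Qed.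

(** * Sums over primes *)

Definition pint (x y : nat) : list nat := filter prime.prime (seq (S x) (y - x)).

Lemma in_pint (x y p : nat) : In p (pint x y) <-> prime.prime p = true /\ (x < p <= y)%nat.
Proof.
  unfold pint. rewrite filter_In, in_seq. intuition lia.
Qed.

Lemma NoDup_pint (x y : nat) : NoDup (pint x y).
Proof. apply NoDup_filter, seq_NoDup. Qed.

Lemma pint_app (x y z : nat) : (x <= y <= z)%nat -> pint x z = pint x y ++ pint y z.
Proof.
  intros H. unfold pint. rewrite <- filter_app.
  replace (z - x)%nat with ((y - x) + (z - y))%nat by lia.
  rewrite seq_app. replace (S x + (y - x))%nat with (S y) by lia. reflexivity.
Qed.

Definition prodl (l : list nat) : nat := fold_right Nat.mul 1%nat l.

(** * Chebyshev's upper bound and smooth numbers *)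

Section Binomial.
Import ssreflect ssrfun ssrbool ssrnat eqtype fintype seq div prime bigop binomial.

Lemma prodl_dvdn (l : list nat) (m : nat) :
  NoDup l -> (forall p, In p l -> prime p /\ dvdn p m) -> dvdn (prodl l) m.
Proof.
  elim: l m => [|q l IH] m nd H; first exact: dvd1n.
  inversion_clear nd as [|? ? nin nd'].
  have [pq qm] := H q (or_introl erefl).
  have /dvdnP [m' E] := qm.
  have -> : prodl (q :: l) = (prodl l * q)%N by rewrite mulnC.
  rewrite E dvdn_pmul2r ?prime_gt0 //.
  apply: IH => // p pl. have [pp pm] := H p (or_intror pl). split=> //.
  move: pm; rewrite E Euclid_dvdM // => /orP [//|].
  rewrite dvdn_prime2 // => /eqP Epq. by case: nin; rewrite -Epq.
Qed.

Lemma prime_dvdn_fact (p n : nat) : prime p -> dvdn p (factorial n) -> leq p n.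
Proof.
  move=> pp; elim: n => [|n IH]; first by rewrite dvdn1 => /eqP E; rewrite E in pp.
  rewrite factS Euclid_dvdM // => /orP [H|H]; first exact: dvdn_leq H.
  by apply: leqW; apply: IH.
Qed.

(** Such a prime divides (2n)! but not n!. *)
Lemma prime_dvdn_central_binomial (p n : nat) : prime p -> leq (S n) p -> leq p (n + n) ->
  dvdn p (binomial (n + n) n).
Proof.
  move=> pp np pn.
  have H : dvdn p (factorial (n + n)) by apply: dvdn_fact; rewrite prime_gt0.
  have E := @bin_fact (n + n)%N n (leq_addr n n).
  move: H; rewrite -E !Euclid_dvdM // => /or3P [//|H|].
  - by move: (prime_dvdn_fact _ _ pp H); rewrite leqNgt np.
  - rewrite addnK => H. by move: (prime_dvdn_fact _ _ pp H); rewrite leqNgt np.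
Qed.

Lemma binomial_le_pow2 (m n : nat) : leq (binomial m n) (expn 2 m).
Proof.
  elim: m n => [|m IH] [|n]; rewrite ?bin0n ?bin0 ?expn_gt0 //.
  by rewrite binS expnS mul2n -addnn leq_add.
Qed.

Lemma pow_length_le_prodl (b : nat) (l : list nat) :
  (forall p, In p l -> leq b p) -> leq (expn b (length l)) (prodl l).
Proof.
  elim: l => [|q l IH] H //=.
  rewrite expnS multE leq_mul //; first by apply: H; left.
  apply: IH => p pl; apply: H; by right.
Qed.

(** Chebyshev's argument with n = 2^u: the product of the primes in (n, 2n] divides the central
    binomial coefficient, which is at most 2^(2n), and each of them exceeds n. The claim compares
    exponents of 2. *)
Lemma pint_dyadic_length_aux (u : nat) : leq (u * length (pint (expn 2 u) (expn 2 u + expn 2 u))) (2 * expn 2 u).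
Proof.
  set n := expn 2 u; set l := pint n (n + n).
  rewrite -(@leq_exp2l 2) // expnM -/n.
  have H1 : leq (expn n (length l)) (prodl l).
  { apply: pow_length_le_prodl => p /in_pint [_ [H _]]. by apply/ltnW/ltP. }
  have H2 : dvdn (prodl l) (binomial (n + n) n).
  { apply: prodl_dvdn; first exact: NoDup_pint.
    move=> p /in_pint [pp [Ha Hb]]; split=> //.
    apply: prime_dvdn_central_binomial => //; apply/leP; lia. }
  apply: (leq_trans H1). rewrite mul2n -addnn.
  apply: leq_trans (binomial_le_pow2 _ n).
  apply: dvdn_leq H2. by rewrite bin_gt0 leq_addr.
Qed.

Lemma expn_pow (u : nat) : expn 2 u = Nat.pow 2 u.
Proof. elim: u => // u IH; by rewrite expnS IH. Qed.

Lemma pint_dyadic_length (u : nat) :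
  Peano.le (Nat.mul u (length (pint (Nat.pow 2 u) (Nat.pow 2 (S u))))) (Nat.mul 2 (Nat.pow 2 u)).
Proof.
  have := pint_dyadic_length_aux u. rewrite !expn_pow => /leP.
  have -> : Nat.pow 2 (S u) = Nat.add (Nat.pow 2 u) (Nat.pow 2 u) by rewrite /=; lia.
  exact.
Qed.

Definition smooth (l : list nat) (n : nat) : bool := all (fun p => List.existsb (Nat.eqb p) l) (primes n).

Lemma smoothP (l : list nat) (n : nat) : leq 1 n ->
  reflect (forall p, prime p -> dvdn p n -> In p l) (smooth l n).
Proof.
  move=> n0; apply: (iffP allP) => H p.
  - move=> pp pn. have : p \in primes n by rewrite mem_primes pp n0 pn.
    move/H => /List.existsb_exists [q [ql /PeanoNat.Nat.eqb_eq ->]] //.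
  - rewrite mem_primes => /and3P [pp _ pn]. apply/List.existsb_exists; exists p.
    split; [exact: H|exact: PeanoNat.Nat.eqb_refl].
Qed.

Lemma smooth_nil (n : nat) : smooth nil n -> leq 1 n -> n = 1%nat.
Proof.
  move=> /[swap] n0 /(smoothP _ _ n0) H.
  case: (leqP n 1) => [n1|n1]; first by apply/eqP; rewrite eqn_leq n1 n0.
  have [p pp pn] := pdivP n1. by case: (H p pp pn).
Qed.

Lemma smooth_cons (q : nat) (l : list nat) (n : nat) : prime q -> leq 1 n ->
  smooth (q :: l) n -> ~~ dvdn q n -> smooth l n.
Proof.
  move=> pq n0 /(smoothP _ _ n0) H nq; apply/(smoothP _ _ n0) => p pp pn.
  case: (H p pp pn) => // E; by rewrite E pn in nq.
Qed.

Lemma smooth_div (q : nat) (l : list nat) (n : nat) : prime q -> leq 1 n ->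
  smooth (q :: l) n -> dvdn q n -> smooth (q :: l) (divn n q).
Proof.
  move=> pq n0 /(smoothP _ _ n0) H qn.
  have d0 : leq 1 (divn n q) by rewrite divn_gt0 ?prime_gt0 // dvdn_leq.
  apply/(smoothP _ _ d0) => p pp pn. apply: H => //.
  apply: (dvdn_trans pn). by apply: dvdn_div.
Qed.

Lemma divn_S (q n : nat) : leq 1 q -> divn (S n) q = Nat.add (if dvdn q (S n) then S O else O) (divn n q).
Proof. move=> q0; rewrite divnS //; by case: (dvdn q (S n)). Qed.

Lemma mul_divn (q n : nat) : dvdn q n -> n = Nat.mul q (divn n q).
Proof. by move=> H; rewrite multE mulnC divnK. Qed.

Lemma divn_le (q n : nat) : (divn n q <= n)%coq_nat.
Proof. apply/leP; exact: leq_div. Qed.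

Lemma smooth_pint (y n : nat) : leq 1 n -> leq n y -> smooth (pint 1 y) n.
Proof.
  move=> n0 ny; apply/(smoothP _ _ n0) => p pp pn; apply/in_pint; split=> //.
  split; [exact/ltP/prime_gt1|apply/leP]. apply: leq_trans ny; exact: dvdn_leq.
Qed.
End Binomial.

(** * Sums of reciprocals of primes *)

Fixpoint rsum (f : nat -> R) (l : list nat) : R :=
  match l with [] => 0 | p :: l' => f p + rsum f l' end.

Lemma rsum_app (f : nat -> R) (l l' : list nat) : rsum f (l ++ l') = rsum f l + rsum f l'.
Proof. induction l as [|p l IH]; simpl; [ring|]. rewrite IH. ring. Qed.

Lemma rsum_le (f g : nat -> R) (l : list nat) :
  (forall p, In p l -> f p <= g p) -> rsum f l <= rsum g l.
Proof.
  induction l as [|p l IH]; intros H; simpl; [lra|].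
  apply Rplus_le_compat; [apply H; left; reflexivity|apply IH; intros; apply H; right; assumption].
Qed.

Lemma rsum_const (c : R) (l : list nat) : rsum (fun _ => c) l = INR (length l) * c.
Proof.
  induction l as [|p l IH]; [simpl; ring|].
  change (length (p :: l)) with (S (length l)). rewrite S_INR. simpl. rewrite IH. ring.
Qed.

Lemma rsum_scal (c : R) (f : nat -> R) (l : list nat) : rsum (fun p => c * f p) l = c * rsum f l.
Proof. induction l as [|p l IH]; simpl; [ring|]. rewrite IH. ring. Qed.

Lemma rsum_pos (f : nat -> R) (l : list nat) : (forall p, In p l -> 0 <= f p) -> 0 <= rsum f l.
Proof.
  intros H. apply Rle_trans with (rsum (fun _ => 0) l); [rewrite rsum_const; lra|].
  apply rsum_le. exact H.
Qed.

Definition rinv (p : nat) : R := / INR p.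

Lemma rsum_dyadic (u : nat) : (1 <= u)%nat ->
  rsum rinv (pint (2 ^ u) (2 ^ S u)) <= 2 / INR u.
Proof.
  intros Hu. pose proof (pint_dyadic_length u) as H. set (l := pint _ _) in *.
  assert (Hu0 : 0 < INR u) by (apply lt_0_INR; lia).
  assert (P0 : 0 < INR (2 ^ u)) by (apply lt_0_INR; pose proof (Nat.pow_nonzero 2 u); lia).
  apply Rle_trans with (rsum (fun _ => / INR (2 ^ u)) l).
  - apply rsum_le. intros p Hp. apply in_pint in Hp. unfold rinv.
    apply Rinv_le_contravar; [assumption|apply le_INR; lia].
  - rewrite rsum_const. apply le_INR in H. rewrite !mult_INR in H. simpl (INR 2) in H.
    apply (Rmult_le_reg_r (INR u * INR (2 ^ u))); [apply Rmult_lt_0_compat; assumption|].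
    replace (INR (length l) * / INR (2 ^ u) * (INR u * INR (2 ^ u))) with (INR u * INR (length l)) by (field; lra).
    replace (2 / INR u * (INR u * INR (2 ^ u))) with ((1 + 1) * INR (2 ^ u)) by (field; lra).
    exact H.
Qed.

Lemma pow2_mono (a b : nat) : (a <= b)%nat -> (2 ^ a <= 2 ^ b)%nat.
Proof. intros H. apply Nat.pow_le_mono_r; lia. Qed.

Lemma rsum_dyadic_range (u v : nat) : (1 <= u)%nat ->
  rsum rinv (pint (2 ^ u) (2 ^ (u + v))) <= INR v * (2 / INR u).
Proof.
  intros Hu. induction v as [|v IH].
  - rewrite Nat.add_0_r. unfold pint. rewrite Nat.sub_diag. simpl. lra.
  - rewrite (pint_app _ (2 ^ (u + v))) by (split; apply pow2_mono; lia).
    rewrite rsum_app, S_INR, Nat.add_succ_r.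
    pose proof (rsum_dyadic (u + v) ltac:(lia)) as H.
    assert (0 < INR u) by (apply lt_0_INR; lia).
    assert (2 / INR (u + v) <= 2 / INR u).
    { apply Rmult_le_compat_l; [lra|]. apply Rinv_le_contravar; [lra|apply le_INR; lia]. }
    lra.
Qed.

Definition dexp2 (i : nat) : nat := (2 ^ (2 ^ i))%nat.
Definition ilist (i : nat) : list nat := pint (dexp2 i) (dexp2 (S i)).

(** The range consists of 2^i dyadic blocks, whose exponents are at least 2^i, and each contributes
    at most 2 / 2^i. *)
Lemma rsum_ilist (i : nat) : rsum rinv (ilist i) <= 2.
Proof.
  unfold ilist, dexp2. simpl Nat.pow at 3.
  replace (2 ^ i + (2 ^ i + 0))%nat with (2 ^ i + 2 ^ i)%nat by lia.
  assert (H : (1 <= 2 ^ i)%nat) by (pose proof (Nat.pow_nonzero 2 i); lia).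
  eapply Rle_trans; [apply rsum_dyadic_range, H|].
  assert (0 < INR (2 ^ i)) by (apply lt_0_INR; lia). right. field. lra.
Qed.

(** The harmonic sum restricted to integers with all prime factors in [l], a partial sum of the
    expanded Euler product. *)
Fixpoint hsum (l : list nat) (n : nat) : R :=
  match n with O => 0 | S n' => hsum l n' + (if smooth l n then / INR n else 0) end.

Lemma hsum_mono (l : list nat) (m n : nat) : (m <= n)%nat -> hsum l m <= hsum l n.
Proof.
  induction 1 as [|n _ IH]; [lra|]. simpl.
  assert (0 < / INR (S n)) by (apply Rinv_0_lt_compat, lt_0_INR; lia).
  simpl in H. destruct (smooth l (S n)); lra.
Qed.

Lemma hsum_nil (n : nat) : hsum [] n <= 1.
Proof.
  destruct n as [|n]; [simpl; lra|]. induction n as [|n IH].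
  - simpl. destruct (smooth [] 1); lra.
  - change (hsum [] (S (S n))) with
      (hsum [] (S n) + (if smooth [] (S (S n)) then / INR (S (S n)) else 0)).
    destruct (smooth [] (S (S n))) eqn:E; [|lra].
    apply smooth_nil in E; [discriminate|reflexivity].
Qed.

(** Integers prime to q are smooth over [l]; the others are q m with m <= n/q. *)
Lemma hsum_cons (q : nat) (l : list nat) (n : nat) : prime.prime q = true ->
  hsum (q :: l) n <= hsum l n + / INR q * hsum (q :: l) (div.divn n q).
Proof.
  intros Hq. pose proof (prime_ge2 q Hq) as Hq2.
  assert (Q0 : 0 < INR q) by (apply lt_0_INR; lia).
  assert (Hq1 : ssrnat.leq 1 q = true) by (apply prime.prime_gt0; exact Hq).
  induction n as [|n IH]; [rewrite div.div0n; simpl; lra|].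
  rewrite (divn_S q n Hq1).
  change (hsum (q :: l) (S n)) with
    (hsum (q :: l) n + (if smooth (q :: l) (S n) then / INR (S n) else 0)).
  change (hsum l (S n)) with (hsum l n + (if smooth l (S n) then / INR (S n) else 0)).
  assert (P : 0 < / INR (S n)) by (apply Rinv_0_lt_compat, lt_0_INR; lia).
  destruct (div.dvdn q (S n)) eqn:Ed.
  - pose proof (mul_divn q (S n) Ed) as Em. rewrite (divn_S q n Hq1), Ed in Em.
    set (m := div.divn n q) in *. change (1 + m)%nat with (S m) in *.
    change (hsum (q :: l) (S m)) with
      (hsum (q :: l) m + (if smooth (q :: l) (S m) then / INR (S m) else 0)).
    destruct (smooth (q :: l) (S n)) eqn:E1.
    + assert (E2 : smooth (q :: l) (S m) = true).
      { pose proof (smooth_div q l (S n) Hq eq_refl E1 Ed) as H.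
        rewrite (divn_S q n Hq1), Ed in H. exact H. }
      assert (EI : / INR (S n) = / INR q * / INR (S m))
        by (rewrite Em, mult_INR, Rinv_mult; reflexivity).
      rewrite E2, Rmult_plus_distr_l.
      destruct (smooth l (S n)); lra.
    + assert (0 <= (if smooth l (S n) then / INR (S n) else 0)) by (destruct (smooth l (S n)); lra).
      assert (0 < / INR (S m)) by (apply Rinv_0_lt_compat, lt_0_INR; lia).
      assert (0 < / INR q) by (apply Rinv_0_lt_compat; lra).
      assert (0 < / INR q * / INR (S m)) by (apply Rmult_lt_0_compat; assumption).
      rewrite Rmult_plus_distr_l. destruct (smooth (q :: l) (S m)); lra.
  - change (0 + div.divn n q)%nat with (div.divn n q).
    destruct (smooth (q :: l) (S n)) eqn:E1.
    + rewrite (smooth_cons q l (S n) Hq eq_refl E1) by (rewrite Ed; reflexivity). lra.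
    + destruct (smooth l (S n)); lra.
Qed.

(** Euler's product bound. Enlarging n/q to n in [hsum_cons] gives H <= H' + H/q with H' the sum
    over the shorter list, hence H <= H' / (1 - 1/q). *)
Lemma hsum_exp (l : list nat) (n : nat) : (forall p, In p l -> prime.prime p = true) ->
  hsum l n <= exp (rsum (fun p => - ln (1 - rinv p)) l).
Proof.
  induction l as [|q l IH]; intros Hl.
  - simpl. rewrite exp_0. apply hsum_nil.
  - specialize (IH (fun p Hp => Hl p (or_intror Hp))).
    assert (Hq := Hl q (or_introl eq_refl)). pose proof (prime_ge2 q Hq) as Hq2.
    assert (Q0 : 2 <= INR q) by (apply (le_INR 2); assumption).
    assert (Q1 : 0 < / INR q <= /2).
    { split; [apply Rinv_0_lt_compat; lra|apply Rinv_le_contravar; lra]. }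
    pose proof (hsum_cons q l n Hq) as H.
    assert (M : hsum (q :: l) (div.divn n q) <= hsum (q :: l) n) by (apply hsum_mono, divn_le).
    cbn [rsum]. rewrite exp_plus, exp_Ropp, exp_ln by (unfold rinv; lra).
    assert (H' : hsum (q :: l) n * (1 - / INR q) <= hsum l n) by nra.
    unfold rinv at 1. apply (Rmult_le_reg_r (1 - / INR q)); [lra|].
    rewrite (Rmult_comm (/ _)), Rmult_assoc, Rinv_l, Rmult_1_r by lra. lra.
Qed.

(** Every integer up to y is composed of primes up to y, so this is the full harmonic sum. *)
Lemma ln_le_hsum (y : nat) : ln (INR (S y)) <= hsum (pint 1 y) y.
Proof.
  assert (G : forall m, (m <= y)%nat -> ln (INR (S m)) <= hsum (pint 1 y) m).
  { induction m as [|m IH]; intros Hm.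
    - simpl. rewrite ln_1. lra.
    - change (hsum (pint 1 y) (S m)) with
        (hsum (pint 1 y) m + (if smooth (pint 1 y) (S m) then / INR (S m) else 0)).
      rewrite smooth_pint by (reflexivity || (apply (ssrbool.introT ssrnat.leP); lia)).
      specialize (IH ltac:(lia)).
      assert (P : 0 < INR (S m)) by (apply lt_0_INR; lia).
      replace (ln (INR (S (S m)))) with (ln (INR (S m)) + ln (1 + / INR (S m))).
      + assert (ln (1 + / INR (S m)) <= / INR (S m)); [|lra].
        rewrite <- (ln_exp (/ INR (S m))) at 2.
        assert (0 < / INR (S m)) by (apply Rinv_0_lt_compat; assumption).
        apply ln_le; [lra|apply exp_ineq1_le].
      + rewrite <- ln_mult; [|assumption|assert (0 < / INR (S m)) by (apply Rinv_0_lt_compat; assumption); lra].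
        f_equal. rewrite (S_INR (S m)). field. lra. }
  apply G. lia.
Qed.

Lemma neg_ln_bound (x : R) : 0 <= x <= /2 -> - ln (1 - x) <= x + x ^ 2.
Proof.
  intros Hx. rewrite <- ln_Rinv by lra.
  rewrite <- (ln_exp (x + x ^ 2)). apply ln_le; [apply Rinv_0_lt_compat; lra|].
  (* The quadratic Taylor term is what makes the bound reach 1/(1 - x) up to x = 1/2, the value for
     p = 2. *)
  apply Rle_trans with (1 + (x + x ^ 2) + (x + x ^ 2) ^ 2 / 2).
  - apply (Rmult_le_reg_r (1 - x)); [lra|]. rewrite Rinv_l by lra.
    assert (0 <= x ^ 2) by nra. assert (0 <= x ^ 3) by (simpl; nra).
    assert (0 <= x ^ 2 * (1 - 2 * x)) by nra. nra.
  - pose proof (exp_ge_taylor (x + x ^ 2) 2 ltac:(nra)) as H. simpl in H.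
    replace (x + x * (x * 1)) with (x + x ^ 2) in H by ring. simpl. simpl in H. lra.
Qed.

Lemma rsum_inv_sq (n : nat) : rsum (fun p => rinv p ^ 2) (pint 1 (S n)) <= 1 - / INR (S n).
Proof.
  induction n as [|n IH].
  - unfold pint. simpl. lra.
  - rewrite (pint_app 1 (S n)) by lia. rewrite rsum_app.
    assert (H : rsum (fun p => rinv p ^ 2) (pint (S n) (S (S n))) <= rinv (S (S n)) ^ 2).
    { unfold pint. replace (S (S n) - S n)%nat with 1%nat by lia. cbn [seq filter].
      assert (0 <= rinv (S (S n)) ^ 2) by apply pow2_ge_0.
      destruct (prime.prime (S (S n))); cbn [rsum]; lra. }
    assert (rinv (S (S n)) ^ 2 <= / INR (S n) - / INR (S (S n))); [|lra].
    unfold rinv. rewrite (S_INR (S n)).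
    assert (0 < INR (S n)) by (apply lt_0_INR; lia). set (x := INR (S n)) in *.
    replace (/ x - / (x + 1)) with (/ (x * (x + 1))) by (field; lra).
    rewrite pow_inv. apply Rinv_le_contravar; nra.
Qed.

(** The logarithm of Euler's inequality; replacing - ln (1 - 1/p) by 1/p costs at most the sum of
    1/p^2, which is below 1. *)
Lemma mertens_lower (y : nat) : (2 <= y)%nat -> ln (ln (INR y)) <= rsum rinv (pint 1 y) + 1.
Proof.
  intros Hy. set (l := pint 1 y).
  assert (Hy' : 2 <= INR y) by (apply (le_INR 2); assumption).
  assert (L0 : 0 < ln (INR y)) by (rewrite <- ln_1; apply ln_increasing; lra).
  assert (Hl : forall p, In p l -> prime.prime p = true) by (intros p Hp; apply in_pint in Hp; tauto).
  assert (H : ln (INR y) <= exp (rsum (fun p => - ln (1 - rinv p)) l)).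
  { eapply Rle_trans; [|apply (hsum_exp l y Hl)].
    eapply Rle_trans; [|apply ln_le_hsum]. apply ln_le; [lra|apply le_INR; lia]. }
  apply ln_le in H; [|assumption]. rewrite ln_exp in H.
  eapply Rle_trans; [exact H|].
  apply Rle_trans with (rsum (fun p => rinv p + rinv p ^ 2) l).
  - apply rsum_le. intros p Hp. apply neg_ln_bound.
    pose proof (prime_ge2 p (Hl p Hp)). assert (2 <= INR p) by (apply (le_INR 2); assumption).
    unfold rinv. split; [left; apply Rinv_0_lt_compat; lra|apply Rinv_le_contravar; lra].
  - assert (E : rsum (fun p => rinv p + rinv p ^ 2) l = rsum rinv l + rsum (fun p => rinv p ^ 2) l).
    { clear. induction l as [|p l IH]; simpl; [ring|]. simpl in IH. rewrite IH. ring. }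
    rewrite E. unfold l. destruct y as [|y]; [lia|].
    pose proof (rsum_inv_sq y). assert (0 < / INR (S y)) by (apply Rinv_0_lt_compat, lt_0_INR; lia). lra.
Qed.

(** * Tuples of primes *)

Lemma rsum_plus (f g : nat -> R) (l : list nat) :
  rsum (fun p => f p + g p) l = rsum f l + rsum g l.
Proof. induction l as [|p l IH]; simpl; [ring|]. rewrite IH. ring. Qed.

Lemma rsum_ext (f g : nat -> R) (l : list nat) :
  (forall p, In p l -> f p = g p) -> rsum f l = rsum g l.
Proof.
  intros H. apply Rle_antisym; apply rsum_le; intros p Hp; rewrite (H p Hp); lra.
Qed.

Lemma rsum_indicator (q : nat) (c : R) (l : list nat) : 0 <= c -> NoDup l ->
  rsum (fun p => if Nat.eqb p q then c else 0) l <= c.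
Proof.
  intros Hc. induction 1 as [|p l Hp _ IH]; simpl; [lra|].
  destruct (Nat.eqb_spec p q) as [->|]; [|lra].
  rewrite (rsum_ext _ (fun _ => 0)).
  - rewrite rsum_const. lra.
  - intros p' Hp'. destruct (Nat.eqb_spec p' q) as [->|]; [contradiction|reflexivity].
Qed.

Definition isq (p : nat) : R := / sqrt (INR p).

Lemma isq_pos (p : nat) : prime.prime p = true -> 0 < isq p.
Proof.
  intros Hp. apply Rinv_0_lt_compat, sqrt_lt_R0, lt_0_INR. pose proof (prime_ge2 p Hp). lia.
Qed.

Lemma isq_sq (p : nat) : prime.prime p = true -> isq p * isq p = rinv p.
Proof.
  intros Hp. unfold isq, rinv. rewrite <- Rinv_mult, sqrt_sqrt; [reflexivity|apply pos_INR].
Qed.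

(** The sum of p^(-1/2-it) over [l]: the pair (p, 1) encodes p^(-it). *)
Definition Pl (l : list nat) : bp := map (fun p => (isq p, (p, 1%nat))) l.

(* [pw l r f] sums [f (p1 ... pr) / sqrt (p1 ... pr)] over [r]-tuples from [l]. *)
Fixpoint pw (l : list nat) (r : nat) (f : nat -> R) : R :=
  match r with
  | O => f 1%nat
  | S r' => rsum (fun p => isq p * pw l r' (fun a => f (p * a)%nat)) l
  end.

Lemma ev_Pl (l : list nat) (phi : nat -> nat -> R) :
  ev (Pl l) phi = rsum (fun p => isq p * phi p 1%nat) l.
Proof. induction l as [|p l IH]; simpl; [reflexivity|]. rewrite <- IH. reflexivity. Qed.

Lemma ev_bpow_Pl (l : list nat) (r : nat) (phi : nat -> nat -> R) :
  ev (bpow (Pl l) r) phi = pw l r (fun a => phi a 1%nat).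
Proof.
  revert phi. induction r as [|r IH]; intros phi; simpl; [ring|].
  rewrite ev_bmul, ev_Pl. apply rsum_ext. intros p _. rewrite IH. reflexivity.
Qed.

Definition primes_list (l : list nat) : Prop := forall p, In p l -> prime.prime p = true.

Section Pw.
Variable l : list nat.
Hypothesis Hl : primes_list l.

Lemma pw_le_on (r : nat) (f g : nat -> R) :
  (forall a, supp (fun p => In p l) a -> f a <= g a) -> pw l r f <= pw l r g.
Proof.
  revert f g. induction r as [|r IH]; intros f g H; simpl; [apply H, supp_1|].
  apply rsum_le. intros p Hp. apply Rmult_le_compat_l; [left; apply isq_pos, Hl, Hp|].
  apply IH. intros a Ha. apply H. apply supp_mul; [|assumption].
  apply supp_prime; [apply Hl, Hp|exact Hp].
Qed.

Lemma pw_ext_on (r : nat) (f g : nat -> R) :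
  (forall a, supp (fun p => In p l) a -> f a = g a) -> pw l r f = pw l r g.
Proof.
  intros H. apply Rle_antisym; apply pw_le_on; intros a Ha; rewrite (H a Ha); lra.
Qed.

Lemma pw_plus (r : nat) (f g : nat -> R) : pw l r (fun a => f a + g a) = pw l r f + pw l r g.
Proof.
  revert f g. induction r as [|r IH]; intros f g; simpl; [reflexivity|].
  rewrite <- rsum_plus. apply rsum_ext. intros p _. rewrite IH. ring.
Qed.

Lemma pw_scal (r : nat) (c : R) (f : nat -> R) : pw l r (fun a => c * f a) = c * pw l r f.
Proof.
  revert f. induction r as [|r IH]; intros f; simpl; [reflexivity|].
  rewrite <- rsum_scal. apply rsum_ext. intros p _. rewrite IH. ring.
Qed.

Lemma pw_0 (r : nat) : pw l r (fun _ => 0) = 0.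
Proof.
  rewrite (pw_ext_on r _ (fun _ => 0 * 0)) by (intros; ring).
  rewrite (pw_scal r 0 (fun _ => 0)). ring.
Qed.

Lemma pw_pos (r : nat) (f : nat -> R) : (forall a, 0 <= f a) -> 0 <= pw l r f.
Proof. intros H. rewrite <- (pw_0 r). apply pw_le_on. auto. Qed.

Lemma pw_rsum (r : nat) (f : nat -> nat -> R) (l' : list nat) :
  pw l r (fun a => rsum (f a) l') = rsum (fun q => pw l r (fun a => f a q)) l'.
Proof.
  induction l' as [|q l' IH]; simpl; [apply pw_0|]. rewrite <- IH, <- pw_plus. reflexivity.
Qed.

Lemma pw_swap (r s : nat) (f : nat -> nat -> R) :
  pw l r (fun a => pw l s (f a)) = pw l s (fun b => pw l r (fun a => f a b)).
Proof.
  revert f. induction s as [|s IH]; intros f; simpl; [reflexivity|].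
  rewrite pw_rsum. apply rsum_ext. intros p _. rewrite pw_scal. f_equal.
  rewrite IH. reflexivity.
Qed.

(* A tuple whose product is divisible by [q] contains [q] in one of its [r] slots. *)
Lemma pw_divisible (q r : nat) (f : nat -> R) : NoDup l -> prime.prime q = true ->
  (forall a, 0 <= f a) -> (forall a, div.dvdn q a = false -> f a = 0) ->
  pw l r f <= INR r * isq q * pw l (pred r) (fun a => f (q * a)%nat).
Proof.
  intros Hnd Hq. revert f. induction r as [|r IH]; intros f Hf Hd.
  - simpl. rewrite Hd by (apply prime_not_dvd_1, Hq). lra.
  - simpl pred. simpl pw at 1.
    set (X0 := pw l r (fun a => f (q * a)%nat)).
    assert (HX : 0 <= X0) by (apply pw_pos; auto).
    pose proof (isq_pos q Hq) as Hiq.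
    apply Rle_trans with (rsum (fun p => (if Nat.eqb p q then isq q * X0 else 0)
       + INR r * isq q * (isq p * pw l (pred r) (fun a => f (q * (p * a))%nat))) l).
    + apply rsum_le. intros p Hp. pose proof (isq_pos p (Hl p Hp)) as Hip.
      assert (Hpos : 0 <= INR r * isq q * (isq p * pw l (pred r) (fun a => f (q * (p * a))%nat))).
      { apply Rmult_le_pos; [apply Rmult_le_pos; [apply pos_INR|lra]|].
        apply Rmult_le_pos; [lra|apply pw_pos; auto]. }
      destruct (Nat.eqb_spec p q) as [->|Hne]; [unfold X0; lra|].
      rewrite Rplus_0_l.
      replace (INR r * isq q * (isq p * pw l (pred r) (fun a => f (q * (p * a))%nat)))
        with (isq p * (INR r * isq q * pw l (pred r) (fun a => f (q * (p * a))%nat))) by ring.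
      apply Rmult_le_compat_l; [lra|].
      eapply Rle_trans; [apply (IH (fun a => f (p * a)%nat))|].
      * auto.
      * intros a Ha. apply Hd. destruct (div.dvdn q (p * a)) eqn:E; [|reflexivity].
        rewrite <- Ha. symmetry. apply (prime_dvd_mul_other p); auto.
      * right. f_equal. apply pw_ext_on. intros a _. f_equal. lia.
    + rewrite rsum_plus, rsum_scal. rewrite S_INR.
      pose proof (rsum_indicator q (isq q * X0) l ltac:(apply Rmult_le_pos; lra) Hnd).
      destruct r as [|r].
      * simpl INR in *. unfold X0 in *. lra.
      * simpl pred.
        change (rsum (fun p => isq p * pw l r (fun a => f (q * (p * a))%nat)) l)
          with X0. lra.
Qed.

(** The mean value of P^r conj(P)^s. A prime q of the second tuple divides the product of the first,
    so it fills one of its r slots; removing it from both tuples leaves r/q times the same problem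
    for r - 1 and s - 1. *)
Lemma pw_diag (r s : nat) : NoDup l ->
  pw l s (fun b => pw l r (fun a => diag a b))
    <= if Nat.eqb r s then INR (fact r) * rsum rinv l ^ r else 0.
Proof.
  intros Hnd. revert r. induction s as [|s IH]; intros r.
  - simpl. destruct r as [|r]; simpl; [unfold diag; simpl; lra|].
    rewrite (rsum_ext _ (fun _ => 0)); [rewrite rsum_const; lra|].
    intros p Hp. rewrite (pw_ext_on r _ (fun _ => 0)); [rewrite pw_0; ring|].
    intros a _. unfold diag. destruct (Nat.eqb_spec (p * a) 1) as [E|]; [|reflexivity].
    apply Nat.eq_mul_1 in E. pose proof (prime_ge2 p (Hl p Hp)). lia.
  - simpl pw at 1.
    assert (S0 : 0 <= rsum rinv l).
    { apply rsum_pos. intros p Hp. unfold rinv. left.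
      apply Rinv_0_lt_compat, lt_0_INR. pose proof (prime_ge2 p (Hl p Hp)). lia. }
    assert (H : rsum (fun q => isq q * pw l s (fun b => pw l r (fun a => diag a (q * b)%nat))) l
      <= rsum (fun q => rinv q * (INR r * pw l s (fun b => pw l (pred r) (fun a => diag a b)))) l).
    { apply rsum_le. intros q Hq. pose proof (isq_pos q (Hl q Hq)).
      rewrite <- (isq_sq q (Hl q Hq)), Rmult_assoc. apply Rmult_le_compat_l; [lra|].
      rewrite <- pw_scal, <- pw_scal. apply pw_le_on. intros b Hb.
      eapply Rle_trans; [apply (pw_divisible q)|].
      - assumption.
      - apply Hl, Hq.
      - intros a. apply diag_pos.
      - intros a Ha. unfold diag. destruct (Nat.eqb_spec a (q * b)%nat) as [->|]; [|reflexivity].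
        rewrite dvdn_mul_l in Ha. discriminate.
      - right. rewrite Rmult_comm, <- (Rmult_assoc (isq q)), (Rmult_comm (isq q)), Rmult_comm. f_equal. apply pw_ext_on. intros a _. unfold diag.
        pose proof (prime_ge2 q (Hl q Hq)).
        destruct (Nat.eqb_spec (q * a) (q * b)) as [E|E], (Nat.eqb_spec a b) as [E'|E']; try reflexivity; nia. }
    set (c := INR r * pw l s (fun b => pw l (pred r) (fun a => diag a b))) in *.
    assert (E : rsum (fun q => rinv q * c) l = c * rsum rinv l)
      by (rewrite <- rsum_scal; apply rsum_ext; intros; ring).
    rewrite E in H. unfold c in H. eapply Rle_trans; [exact H|].
    destruct r as [|r]; [simpl; lra|]. specialize (IH r). simpl pred.
    change (Nat.eqb (S r) (S s)) with (Nat.eqb r s).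
    pose proof (pos_INR (S r)).
    destruct (Nat.eqb r s).
    + apply Rle_trans with (INR (S r) * (INR (fact r) * rsum rinv l ^ r) * rsum rinv l).
      * apply Rmult_le_compat_r; [assumption|]. apply Rmult_le_compat_l; assumption.
      * right. rewrite fact_simpl, mult_INR. simpl pow. ring.
    + assert (0 <= pw l s (fun b => pw l r (fun a => diag a b)))
        by (apply pw_pos; intros; apply pw_pos; intros; apply diag_pos).
      replace (pw l s (fun b => pw l r (fun a => diag a b))) with 0 by lra. lra.
Qed.
End Pw.

(** For a lower bound, only the tuples in which q occurs at most once are kept: not at all, or in
    exactly one of the r slots. *)
Lemma pw_cons_ge (q : nat) (l : list nat) (r : nat) (f : nat -> R) :
  primes_list (q :: l) -> (forall a, 0 <= f a) ->
  pw l r f + INR r * isq q * pw l (pred r) (fun a => f (q * a)%nat) <= pw (q :: l) r f.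
Proof.
  intros Hl. assert (Hl' : primes_list l) by (intros p Hp; apply Hl; right; exact Hp).
  assert (Hq : 0 < isq q) by (apply isq_pos, Hl; left; reflexivity).
  revert f. induction r as [|r IH]; intros f Hf; [simpl; lra|].
  simpl pred. cbn [pw rsum].
  assert (H1 : isq q * pw l r (fun a => f (q * a)%nat)
     <= isq q * pw (q :: l) r (fun a => f (q * a)%nat)).
  { apply Rmult_le_compat_l; [lra|]. eapply Rle_trans; [|apply IH; auto].
    assert (0 <= INR r * isq q * pw l (pred r) (fun a => f (q * (q * a))%nat)); [|lra].
    apply Rmult_le_pos; [apply Rmult_le_pos; [apply pos_INR|lra]|apply pw_pos; auto]. }
  assert (H2 : rsum (fun p => isq p * pw l r (fun a => f (p * a)%nat)
      + INR r * isq q * (isq p * pw l (pred r) (fun a => f (q * (p * a))%nat))) l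
     <= rsum (fun p => isq p * pw (q :: l) r (fun a => f (p * a)%nat)) l).
  { apply rsum_le. intros p Hp. pose proof (isq_pos p (Hl' p Hp)).
    specialize (IH (fun a => f (p * a)%nat) (fun a => Hf (p * a)%nat)).
    replace (INR r * isq q * (isq p * pw l (pred r) (fun a => f (q * (p * a))%nat)))
      with (isq p * (INR r * isq q * pw l (pred r) (fun a => f (q * (p * a))%nat))) by ring.
    rewrite <- Rmult_plus_distr_l. apply Rmult_le_compat_l; [lra|].
    eapply Rle_trans; [|exact IH]. right. f_equal. f_equal. apply pw_ext_on; [assumption|].
    intros a _. f_equal. lia. }
  rewrite rsum_plus, rsum_scal in H2. rewrite S_INR.
  destruct r as [|r].
  - simpl INR in *. simpl pw in *. lra.
  - simpl pred in *.
    change (rsum (fun p => isq p * pw l r (fun a => f (q * (p * a))%nat)) l)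
      with (pw l (S r) (fun a => f (q * a)%nat)) in H2. lra.
Qed.

(** * Lower bound for the mean value of zeta times prime sums *)

(** The elementary symmetric polynomial of degree s in the reciprocals 1/p; it collects the
    squarefree products, which are those that the lower bound retains. *)
Fixpoint esym (s : nat) (l : list nat) : R :=
  match l with
  | [] => match s with O => 1 | S _ => 0 end
  | q :: l' => esym s l' + match s with O => 0 | S s' => rinv q * esym s' l' end
  end.

(** The binomial coefficient, in the form of Pascal's rule that matches the recursion of
    [twisted_pw_cons]. *)
Fixpoint binr (s r : nat) : R :=
  match s, r with
  | _, O => 1
  | O, S _ => 0
  | S s', S r' => binr s' r' + binr s' r
  end.

Lemma binr_0 (s : nat) : binr s 0 = 1.
Proof. destruct s; reflexivity. Qed.

Lemma binr_pos (s r : nat) : 0 <= binr s r.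
Proof.
  revert r. induction s as [|s IH]; intros [|r]; simpl; try lra.
  pose proof (IH r). pose proof (IH (S r)). lra.
Qed.

Lemma esym_0 (l : list nat) : esym 0 l = 1.
Proof. induction l as [|q l IH]; simpl; [reflexivity|]. rewrite IH. ring. Qed.

Lemma rinv_pos (p : nat) : prime.prime p = true -> 0 < rinv p.
Proof.
  intros Hp. apply Rinv_0_lt_compat, lt_0_INR. pose proof (prime_ge2 p Hp). lia.
Qed.

Lemma esym_pos (s : nat) (l : list nat) : primes_list l -> 0 <= esym s l.
Proof.
  revert s. induction l as [|q l IH]; intros s Hl; simpl; [destruct s; lra|].
  assert (Hl' : primes_list l) by (intros p Hp; apply Hl; right; exact Hp).
  pose proof (rinv_pos q (Hl q (or_introl eq_refl))).
  pose proof (IH s Hl'). destruct s as [|s]; [lra|]. pose proof (IH s Hl'). nra.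
Qed.

Lemma dvd_weight_mul_r (q a b : nat) : prime.prime q = true -> div.coprime q a = true -> (1 <= b)%nat ->
  dvd_weight a (q * b) = isq q * dvd_weight a b.
Proof.
  intros Hq Hc Hb. unfold dvd_weight. rewrite dvdn_mulr_coprime by exact Hc.
  destruct (div.dvdn a b); [|ring].
  assert (0 < INR b) by (apply lt_0_INR; lia).
  assert (0 < INR q) by (apply lt_0_INR; pose proof (prime_ge2 q Hq); lia).
  unfold isq. rewrite <- sqrt_inv.
  rewrite <- sqrt_mult; [|left; apply Rinv_0_lt_compat; lra|].
  - f_equal. rewrite mult_INR. field. lra.
  - apply Rdiv_le_0_compat; [apply pos_INR|lra].
Qed.

Lemma dvd_weight_mul_both (q a b : nat) : prime.prime q = true -> (1 <= b)%nat ->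
  dvd_weight (q * a) (q * b) = dvd_weight a b.
Proof.
  intros Hq Hb. unfold dvd_weight. rewrite dvdn_mul_same by (apply prime.prime_gt0, Hq).
  destruct (div.dvdn a b); [|reflexivity]. f_equal. rewrite !mult_INR.
  assert (0 < INR b) by (apply lt_0_INR; lia).
  assert (0 < INR q) by (apply lt_0_INR; pose proof (prime_ge2 q Hq); lia). field. lra.
Qed.

(** The mean value of zeta P^r conj(P)^s, since n a = b has a solution n exactly if a divides b, and
    n^(-1/2) is then the weight. *)
Definition twisted_pw (l : list nat) (r s : nat) : R := pw l r (fun a => pw l s (fun b => dvd_weight a b)).

(** The three terms have q in neither tuple, in b only, where it is matched by zeta, or in both. In
    a alone it would violate divisibility. Each of the last two cases carries the factor 1/q, from
    two factors q^(-1/2). *)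
Lemma twisted_pw_cons (q : nat) (l : list nat) (r s : nat) :
  primes_list (q :: l) -> NoDup (q :: l) ->
  twisted_pw l r s + INR s * rinv q * twisted_pw l r (pred s) + INR r * INR s * rinv q * twisted_pw l (pred r) (pred s)
    <= twisted_pw (q :: l) r s.
Proof.
  intros Hl Hnd. inversion_clear Hnd as [|? ? Hnin Hnd'].
  assert (Hl' : primes_list l) by (intros p Hp; apply Hl; right; exact Hp).
  assert (Hq : prime.prime q = true) by (apply Hl; left; reflexivity).
  pose proof (isq_pos q Hq) as Hiq. pose proof (isq_sq q Hq) as Hsq.
  unfold twisted_pw at 4. eapply Rle_trans; [|apply pw_cons_ge].
  2: assumption.
  2: { intros a. apply pw_pos; [assumption|]. intros b. apply dvd_weight_pos. }
  apply Rplus_le_compat.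
  - unfold twisted_pw. rewrite <- pw_scal, <- pw_plus. apply pw_le_on; [assumption|]. intros a Ha.
    eapply Rle_trans; [|apply pw_cons_ge; [assumption|intros; apply dvd_weight_pos]].
    apply Rplus_le_compat_l. rewrite <- Hsq. right.
    replace (INR s * (isq q * isq q) * pw l (pred s) (fun b => dvd_weight a b))
      with (INR s * isq q * (isq q * pw l (pred s) (fun b => dvd_weight a b))) by ring.
    f_equal. rewrite <- pw_scal. apply pw_ext_on; [assumption|]. intros b Hb. symmetry.
    apply dvd_weight_mul_r; [assumption| |apply leq_1_le, Hb].
    apply not_dvd_coprime; [assumption|]. intros p Hp Hpa ->. apply Hnin, Ha; assumption.
  - unfold twisted_pw. rewrite <- Hsq.
    replace (INR r * INR s * (isq q * isq q) * pw l (pred r) (fun a => pw l (pred s) (fun b => dvd_weight a b)))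
      with (INR r * isq q * (INR s * isq q * pw l (pred r) (fun a => pw l (pred s) (fun b => dvd_weight a b)))) by ring.
    apply Rmult_le_compat_l; [apply Rmult_le_pos; [apply pos_INR|lra]|].
    rewrite <- pw_scal. apply pw_le_on; [assumption|]. intros a Ha.
    eapply Rle_trans; [|apply pw_cons_ge; [assumption|intros; apply dvd_weight_pos]].
    assert (0 <= pw l s (dvd_weight (q * a))) by (apply pw_pos; [assumption|intros; apply dvd_weight_pos]).
    assert (E : pw l (pred s) (fun b => dvd_weight (q * a) (q * b)) = pw l (pred s) (fun b => dvd_weight a b)).
    { apply pw_ext_on; [assumption|]. intros b Hb. apply dvd_weight_mul_both; [assumption|apply leq_1_le, Hb]. }
    cbv beta. rewrite E. match goal with |- _ <= ?x + _ => assert (0 <= x) by exact H end. lra.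
Qed.

(** A squarefree b with s prime factors has binom(s, r) divisors a with r factors; the orderings
    give r! s!, and the weights multiply to 1/b. *)
Lemma twisted_pw_ge (l : list nat) (r s : nat) : primes_list l -> NoDup l ->
  INR (fact r) * INR (fact s) * (binr s r * esym s l) <= twisted_pw l r s.
Proof.
  revert r s. induction l as [|q l IH]; intros r s Hl Hnd.
  - simpl esym. destruct s as [|s].
    + destruct r as [|r]; simpl binr.
      * unfold twisted_pw; simpl. unfold dvd_weight; simpl. rewrite Rdiv_1_r, sqrt_1. lra.
      * rewrite Rmult_0_l, Rmult_0_r. apply pw_pos; [assumption|]. intros. apply pw_pos; [assumption|].
        intros. apply dvd_weight_pos.
    + rewrite !Rmult_0_r. apply pw_pos; [assumption|]. intros. apply pw_pos; [assumption|].
      intros. apply dvd_weight_pos.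
  - eapply Rle_trans; [|apply twisted_pw_cons; assumption].
    assert (Hl' : primes_list l) by (intros p Hp; apply Hl; right; exact Hp).
    assert (Hq : prime.prime q = true) by (apply Hl; left; reflexivity).
    inversion_clear Hnd as [|? ? Hnin Hnd'].
    pose proof (rinv_pos q Hq) as Hrq.
    destruct s as [|s].
    + simpl INR. rewrite !Rmult_0_l, !Rmult_0_r, !Rmult_0_l, !Rplus_0_r.
      eapply Rle_trans; [|apply IH; assumption]. rewrite !esym_0. simpl (INR (fact 0)). lra.
    + simpl pred. simpl esym.
      pose proof (IH r (S s) Hl' Hnd') as I1. pose proof (IH r s Hl' Hnd') as I2.
      assert (Es : INR (fact (S s)) = INR (S s) * INR (fact s)) by (rewrite fact_simpl, mult_INR; reflexivity).
      pose proof (pos_INR (S s)) as Ps.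
      assert (J2 : INR (S s) * rinv q * (INR (fact r) * INR (fact s) * (binr s r * esym s l))
               <= INR (S s) * rinv q * twisted_pw l r s).
      { apply Rmult_le_compat_l; [apply Rmult_le_pos; lra|assumption]. }
      destruct r as [|r].
      * rewrite binr_0 in *. simpl (INR 0). rewrite Es in *.
        set (z1 := twisted_pw l 0 (S s)) in *. set (z2 := twisted_pw l 0 s) in *. set (z3 := twisted_pw l (pred 0) s) in *.
        set (F := INR (fact s)) in *. set (S1 := INR (S s)) in *. set (e1 := esym (S s) l) in *.
        set (e0 := esym s l) in *. set (R0 := INR (fact 0)) in *. nra.
      * pose proof (IH r s Hl' Hnd') as I3. simpl pred.
        assert (Er : INR (fact (S r)) = INR (S r) * INR (fact r)) by (rewrite fact_simpl, mult_INR; reflexivity).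
        pose proof (pos_INR (S r)) as Pr.
        assert (J3 : INR (S r) * INR (S s) * rinv q * (INR (fact r) * INR (fact s) * (binr s r * esym s l))
                 <= INR (S r) * INR (S s) * rinv q * twisted_pw l r s).
        { apply Rmult_le_compat_l; [apply Rmult_le_pos; [apply Rmult_le_pos|]; lra|assumption]. }
        change (binr (S s) (S r)) with (binr s r + binr s (S r)) in *.
        rewrite Es, Er in *. lra.
Qed.

(** * Truncated exponentials of prime sums *)

Fixpoint sumr (f : nat -> R) (m : nat) : R :=
  match m with O => 0 | S m' => sumr f m' + f m' end.

Lemma sumr_le (f g : nat -> R) (m : nat) :
  (forall r, (r < m)%nat -> f r <= g r) -> sumr f m <= sumr g m.
Proof.
  induction m as [|m IH]; intros H; simpl; [lra|].
  apply Rplus_le_compat; [apply IH; intros; apply H; lia|apply H; lia].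
Qed.

Lemma sumr_ext (f g : nat -> R) (m : nat) :
  (forall r, (r < m)%nat -> f r = g r) -> sumr f m = sumr g m.
Proof.
  intros H. apply Rle_antisym; apply sumr_le; intros r Hr; rewrite (H r Hr); lra.
Qed.

Lemma sumr_scal (c : R) (f : nat -> R) (m : nat) : sumr (fun r => c * f r) m = c * sumr f m.
Proof. induction m as [|m IH]; simpl; [ring|]. rewrite IH. ring. Qed.

Lemma sumr_plus (f g : nat -> R) (m : nat) : sumr (fun r => f r + g r) m = sumr f m + sumr g m.
Proof. induction m as [|m IH]; simpl; [ring|]. rewrite IH. ring. Qed.

Lemma sumr_0 (m : nat) : sumr (fun _ => 0) m = 0.
Proof. induction m as [|m IH]; simpl; [ring|]. rewrite IH. ring. Qed.

Lemma sumr_pos (f : nat -> R) (m : nat) : (forall r, (r < m)%nat -> 0 <= f r) -> 0 <= sumr f m.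
Proof. intros H. rewrite <- (sumr_0 m). apply sumr_le. exact H. Qed.

Lemma sumr_swap (f : nat -> nat -> R) (m n : nat) :
  sumr (fun r => sumr (f r) n) m = sumr (fun s => sumr (fun r => f r s) m) n.
Proof.
  induction m as [|m IH]; simpl; [symmetry; apply sumr_0|].
  rewrite IH, <- sumr_plus. reflexivity.
Qed.

Lemma sumr_single (c : R) (r m : nat) : 0 <= c ->
  sumr (fun s => if Nat.eqb r s then c else 0) m <= c.
Proof.
  intros Hc.
  assert (G : forall m, (m <= r)%nat -> sumr (fun s => if Nat.eqb r s then c else 0) m = 0).
  { induction m0 as [|m0 IH]; intros H; simpl; [reflexivity|]. rewrite IH by lia.
    destruct (Nat.eqb_spec r m0); [lia|ring]. }
  induction m as [|m IH]; simpl; [lra|].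
  destruct (Nat.eqb_spec r m) as [->|]; [|lra]. rewrite G by lia. lra.
Qed.

Lemma sumr_widen (f : nat -> R) (m n : nat) : (m <= n)%nat -> (forall r, 0 <= f r) -> sumr f m <= sumr f n.
Proof. intros H Hf. induction H as [|n _ IH]; [lra|]. simpl. specialize (Hf n). lra. Qed.

Lemma sumr_incr (f : nat -> R) (m : nat) : sumr f (S m) = f 0%nat + sumr (fun r => f (S r)) m.
Proof.
  induction m as [|m IH]; [simpl; ring|].
  change (sumr f (S (S m))) with (sumr f (S m) + f (S m)). rewrite IH. simpl. ring.
Qed.

Lemma sumr_exp (x : R) (m : nat) : 0 <= x -> sumr (fun r => x ^ r / INR (fact r)) m <= exp x.
Proof.
  intros Hx. destruct m as [|m]; [simpl; left; apply exp_pos|].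
  eapply Rle_trans; [|apply (exp_ge_taylor x m Hx)]. right.
  induction m as [|m IH]; [simpl; lra|]. rewrite tech5, <- IH. reflexivity.
Qed.

Definition cf (x : R) (r : nat) : R := x ^ r / INR (fact r).

Lemma cf_pos (x : R) (r : nat) : 0 <= x -> 0 <= cf x r.
Proof. intros H. apply Rdiv_le_0_compat; [apply pow_le, H|apply INR_fact_lt_0]. Qed.

(* The Dirichlet polynomial [sum_{r < m} (x P)^r / r!], with [P] the prime sum over [l]. *)
Fixpoint exp_poly (x : R) (m : nat) (l : list nat) : bp :=
  match m with O => [] | S m' => exp_poly x m' l ++ bscale (cf x m') (bpow (Pl l) m') end.

Lemma ev_exp_poly (x : R) (m : nat) (l : list nat) (phi : nat -> nat -> R) :
  ev (exp_poly x m l) phi = sumr (fun r => cf x r * pw l r (fun a => phi a 1%nat)) m.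
Proof.
  induction m as [|m IH]; [reflexivity|].
  cbn [exp_poly sumr]. rewrite ev_app, IH, ev_bscale, ev_bpow_Pl. reflexivity.
Qed.

Lemma good_Pl (l : list nat) (N : R) : primes_list l -> (forall p, In p l -> INR p <= N) ->
  1 <= N -> good (fun p => In p l) N (Pl l).
Proof.
  intros Hl HN H1 c a b Hin. unfold Pl in Hin. apply in_map_iff in Hin.
  destruct Hin as [p [E Hp]]. injection E as <- <- <-.
  split; [left; apply isq_pos, Hl, Hp|]. split; [apply supp_prime; [apply Hl, Hp|exact Hp]|].
  split; [apply supp_1|]. simpl. auto.
Qed.

Lemma good_exp_poly (x : R) (m : nat) (l : list nat) (N : R) : 0 <= x -> primes_list l ->
  (forall p, In p l -> INR p <= N) -> 1 <= N -> good (fun p => In p l) (N ^ m) (exp_poly x m l).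
Proof.
  intros Hx Hl HN H1. induction m as [|m IH]; [intros c a b []|]. cbn [exp_poly].
  apply good_app.
  - eapply good_weaken; [| |exact IH]; [auto|]. apply Rle_pow; [assumption|lia].
  - apply good_bscale; [apply cf_pos, Hx|].
    eapply good_weaken; [| |apply good_bpow, good_Pl; eassumption]; [auto|].
    apply Rle_pow; [assumption|lia].
Qed.

Lemma val_exp_poly (x : R) (m : nat) (l : list nat) (t : R) : primes_list l ->
  val (exp_poly x m l) t = texp m (Cmult (RtoC x) (val (Pl l) t)).
Proof.
  intros Hl.
  assert (exists N, 1 <= N /\ forall p, In p l -> INR p <= N) as [N [H1 HN]].
  { clear Hl. induction l as [|q l [N [H1 HN]]]; [exists 1; split; [lra|intros p []]|].
    exists (Rmax N (INR q)). split; [eapply Rle_trans; [exact H1|apply Rmax_l]|].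
    intros p [<-|Hp]; [apply Rmax_r|eapply Rle_trans; [apply HN, Hp|apply Rmax_l]]. }
  induction m as [|m IH]; [reflexivity|].
  cbn [exp_poly]. rewrite val_app, IH, val_bscale.
  rewrite (val_bpow (fun p => In p l) N) by (apply good_Pl; assumption).
  unfold texp. rewrite csum_S. f_equal. rewrite Cpow_mult_l, <- RtoC_pow.
  unfold cf, Rdiv. rewrite RtoC_mult. ring.
Qed.

Lemma pw_sumr (l : list nat) (r m : nat) (f : nat -> nat -> R) : primes_list l ->
  pw l r (fun a => sumr (f a) m) = sumr (fun s => pw l r (fun a => f a s)) m.
Proof.
  intros Hl. induction m as [|m IH]; simpl; [apply pw_0, Hl|].
  rewrite pw_plus, IH. reflexivity.
Qed.

Lemma ev_exp_poly_mul (x y : R) (b m : nat) (l : list nat) (phi : nat -> nat -> R) :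
  primes_list l ->
  ev (bmul (exp_poly x b l) (bconj (exp_poly y m l))) phi
  = sumr (fun r => sumr (fun s => cf x r * cf y s * pw l r (fun a => pw l s (fun c => phi a c))) m) b.
Proof.
  intros Hl. rewrite ev_bmul, ev_exp_poly. apply sumr_ext. intros r _.
  transitivity (cf x r * pw l r (fun a => sumr (fun s => cf y s * pw l s (fun c => phi a c)) m)).
  - f_equal. apply (pw_ext_on l Hl). intros a _. rewrite ev_bconj, ev_exp_poly.
    apply sumr_ext. intros s _. f_equal.
    apply (pw_ext_on l Hl). intros c _. f_equal; lia.
  - rewrite pw_sumr by assumption. rewrite <- sumr_scal. apply sumr_ext. intros s _.
    rewrite pw_scal. ring.
Qed.

(** Only equal degrees contribute, and degree r gives at most (x^r / r!)^2 r! S^r, a term of the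
    series of exp (x^2 S). *)
Lemma mean_square_exp_poly (x : R) (m : nat) (l : list nat) :
  0 <= x -> primes_list l -> NoDup l ->
  ev (bmul (exp_poly x m l) (bconj (exp_poly x m l))) diag <= exp (x ^ 2 * rsum rinv l).
Proof.
  intros Hx Hl Hnd. rewrite ev_exp_poly_mul by assumption.
  set (S0 := rsum rinv l).
  assert (HS : 0 <= S0) by (apply rsum_pos; intros p Hp; left; apply rinv_pos, Hl, Hp).
  eapply Rle_trans; [|apply (sumr_exp (x ^ 2 * S0) m)].
  2: { apply Rmult_le_pos; [apply pow2_ge_0|assumption]. }
  apply sumr_le. intros r _.
  set (c := cf x r * cf x r * (INR (fact r) * S0 ^ r)).
  assert (Hc : 0 <= c).
  { unfold c. pose proof (cf_pos x r Hx). apply Rmult_le_pos; [apply Rmult_le_pos; assumption|].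
    apply Rmult_le_pos; [apply pos_INR|apply pow_le, HS]. }
  apply Rle_trans with c.
  - eapply Rle_trans; [|apply (sumr_single c r m Hc)]. apply sumr_le. intros s _.
    rewrite pw_swap by assumption.
    pose proof (pw_diag l Hl r s Hnd) as D. fold S0 in D.
    pose proof (cf_pos x r Hx). pose proof (cf_pos x s Hx).
    eapply Rle_trans; [apply Rmult_le_compat_l; [apply Rmult_le_pos; assumption|exact D]|].
    unfold c. destruct (Nat.eqb_spec r s) as [->|]; lra.
  - right. unfold c, cf. rewrite Rpow_mult_distr, <- pow_mult. rewrite Nat.mul_comm, pow_mult.
    field. apply INR_fact_neq_0.
Qed.

Lemma mean_square_pow (m : nat) (l : list nat) : primes_list l -> NoDup l ->
  ev (bmul (bpow (Pl l) m) (bconj (bpow (Pl l) m))) diag <= INR (fact m) * rsum rinv l ^ m.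
Proof.
  intros Hl Hnd. rewrite ev_bmul, ev_bpow_Pl.
  rewrite (pw_ext_on l Hl m _ (fun a => pw l m (fun b => diag a b))).
  - rewrite pw_swap by assumption. pose proof (pw_diag l Hl m m Hnd) as D.
    rewrite Nat.eqb_refl in D. exact D.
  - intros a _. rewrite ev_bconj, ev_bpow_Pl. apply (pw_ext_on l Hl). intros c _. f_equal; lia.
Qed.

Lemma sumr_binr (x : R) (s n : nat) : (s < n)%nat -> sumr (fun r => x ^ r * binr s r) n = (1 + x) ^ s.
Proof.
  revert n. induction s as [|s IH]; intros n Hn; destruct n as [|n]; try lia.
  - rewrite sumr_incr. simpl. rewrite (sumr_ext _ (fun _ => 0)) by (intros; simpl; ring).
    rewrite sumr_0. ring.
  - rewrite sumr_incr. rewrite binr_0.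
    rewrite (sumr_ext _ (fun r => x * (x ^ r * binr s r) + x ^ (S r) * binr s (S r)))
      by (intros; simpl; ring).
    rewrite sumr_plus, sumr_scal, (IH n) by lia.
    pose proof (IH (S n) ltac:(lia)) as E. rewrite sumr_incr, binr_0 in E.
    set (u := sumr (fun r => x ^ S r * binr s (S r)) n) in *.
    rewrite <- tech_pow_Rmult, pow_O in *. lra.
Qed.

(** The factorials cancel, and summing x^r binom(s, r) over r gives (1 + x)^s. With x = k - 1 and y
    = k the base is k^2, the exponent sought; as r <= s matters, truncating both degrees at b
    suffices. *)
Lemma twisted_mean_exp_poly (x y : R) (b m : nat) (l : list nat) :
  0 <= x -> 0 <= y -> (b <= m)%nat -> primes_list l -> NoDup l ->
  sumr (fun s => ((1 + x) * y) ^ s * esym s l) b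
    <= ev (bmul (exp_poly x b l) (bconj (exp_poly y m l))) dvd_weight.
Proof.
  intros Hx Hy Hbm Hl Hnd. rewrite ev_exp_poly_mul by assumption.
  apply Rle_trans with
    (sumr (fun r => sumr (fun s => x ^ r * y ^ s * (binr s r * esym s l)) b) b).
  - rewrite sumr_swap. apply sumr_le. intros s Hs.
    rewrite (sumr_ext _ (fun r => y ^ s * esym s l * (x ^ r * binr s r))) by (intros; ring).
    rewrite sumr_scal, sumr_binr, Rpow_mult_distr by assumption. lra.
  - apply sumr_le. intros r Hr.
    apply Rle_trans with (sumr (fun s => x ^ r * y ^ s * (binr s r * esym s l)) m).
    + apply sumr_widen; [assumption|]. intros s.
      repeat apply Rmult_le_pos; auto using pow_le, binr_pos, esym_pos.
    + apply sumr_le. intros s _. pose proof (twisted_pw_ge l r s Hl Hnd) as Z.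
      fold (twisted_pw l r s).
      apply Rle_trans with (cf x r * cf y s * (INR (fact r) * INR (fact s) * (binr s r * esym s l))).
      * right. unfold cf. field. split; apply INR_fact_neq_0.
      * apply Rmult_le_compat_l; [apply Rmult_le_pos; apply cf_pos; assumption|exact Z].
Qed.

(** * Euler products and their truncation *)

(** The generating function of [esym], that is, the limit of the truncated sums. *)
Fixpoint eprod (y : R) (l : list nat) : R :=
  match l with [] => 1 | q :: l' => (1 + y * rinv q) * eprod y l' end.

Lemma eprod_ge1 (y : R) (l : list nat) : 0 <= y -> primes_list l -> 1 <= eprod y l.
Proof.
  intros Hy. induction l as [|q l IH]; intros Hl; simpl; [lra|].
  assert (Hl' : primes_list l) by (intros p Hp; apply Hl; right; exact Hp).
  specialize (IH Hl'). pose proof (rinv_pos q (Hl q (or_introl eq_refl))).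
  assert (0 <= y * rinv q) by (apply Rmult_le_pos; lra).
  rewrite <- (Rmult_1_l 1). apply Rmult_le_compat; lra.
Qed.

Lemma eprod_mono (y y' : R) (l : list nat) : 0 <= y <= y' -> primes_list l -> eprod y l <= eprod y' l.
Proof.
  intros Hy. induction l as [|q l IH]; intros Hl; simpl; [lra|].
  assert (Hl' : primes_list l) by (intros p Hp; apply Hl; right; exact Hp).
  specialize (IH Hl'). pose proof (rinv_pos q (Hl q (or_introl eq_refl))).
  pose proof (eprod_ge1 y l ltac:(lra) Hl').
  apply Rmult_le_compat; nra.
Qed.

Lemma eprod_le (y : R) (l : list nat) : 0 <= y -> primes_list l -> eprod y l <= exp (y * rsum rinv l).
Proof.
  intros Hy. induction l as [|q l IH]; intros Hl; simpl; [rewrite Rmult_0_r, exp_0; lra|].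
  assert (Hl' : primes_list l) by (intros p Hp; apply Hl; right; exact Hp).
  specialize (IH Hl'). pose proof (rinv_pos q (Hl q (or_introl eq_refl))).
  pose proof (eprod_ge1 y l Hy Hl').
  rewrite Rmult_plus_distr_l, exp_plus.
  apply Rmult_le_compat; [nra|lra|apply exp_ineq1_le|assumption].
Qed.

Lemma one_plus_ge_exp (x : R) : 0 <= x -> exp (x - x ^ 2) <= 1 + x.
Proof.
  intros Hx. rewrite <- (exp_ln (1 + x)) by lra. apply exp_le_exp.
  assert (H : ln (/ (1 + x)) <= / (1 + x) - 1).
  { pose proof (exp_ineq1_le (ln (/ (1 + x)))) as E.
    rewrite exp_ln in E by (apply Rinv_0_lt_compat; lra). lra. }
  rewrite ln_Rinv in H by lra.
  assert (x - x ^ 2 <= 1 - / (1 + x)); [|lra].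
  apply (Rmult_le_reg_r (1 + x)); [lra|]. replace ((1 - / (1 + x)) * (1 + x)) with x by (field; lra).
  assert (0 <= x ^ 3) by (apply pow_le, Hx). simpl in *. nra.
Qed.

Lemma eprod_ge (y : R) (l : list nat) : 0 <= y -> primes_list l ->
  exp (y * rsum rinv l - y ^ 2 * rsum (fun p => rinv p ^ 2) l) <= eprod y l.
Proof.
  intros Hy. induction l as [|q l IH]; intros Hl; cbn [eprod rsum].
  - rewrite !Rmult_0_r, Rminus_0_r, exp_0. lra.
  - assert (Hl' : primes_list l) by (intros p Hp; apply Hl; right; exact Hp).
    specialize (IH Hl'). pose proof (rinv_pos q (Hl q (or_introl eq_refl))).
    assert (0 <= y * rinv q) by nra.
    pose proof (one_plus_ge_exp (y * rinv q) ltac:(assumption)) as E.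
    match goal with |- exp ?u <= _ => replace u with ((y * rinv q - (y * rinv q) ^ 2)
      + (y * rsum rinv l - y ^ 2 * rsum (fun p => rinv p ^ 2) l)) by ring end.
    rewrite exp_plus. apply Rmult_le_compat; try assumption; left; apply exp_pos.
Qed.

(* Rankin's trick: the terms of degree at least [b] are bounded with the weight [2^(s-b)]. *)
Lemma esym_truncated (y : R) (b : nat) (l : list nat) : 0 <= y -> primes_list l ->
  eprod y l - (/2) ^ b * eprod (2 * y) l <= sumr (fun s => y ^ s * esym s l) b.
Proof.
  intros Hy. revert b. induction l as [|q l IH]; intros b Hl.
  - simpl eprod. destruct b as [|b]; [simpl; lra|].
    rewrite sumr_incr. simpl esym. rewrite (sumr_ext _ (fun _ => 0)) by (intros; simpl; ring).
    rewrite sumr_0. assert (0 < (/2) ^ S b) by (apply pow_lt; lra). simpl (y ^ 0). lra.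
  - assert (Hl' : primes_list l) by (intros p Hp; apply Hl; right; exact Hp).
    pose proof (rinv_pos q (Hl q (or_introl eq_refl))) as Hq.
    destruct b as [|b].
    + simpl sumr. simpl pow. rewrite Rmult_1_l.
      pose proof (eprod_mono y (2 * y) (q :: l) ltac:(lra) Hl). lra.
    + assert (E : sumr (fun s => y ^ s * esym s (q :: l)) (S b)
        = sumr (fun s => y ^ s * esym s l) (S b) + y * rinv q * sumr (fun s => y ^ s * esym s l) b).
      { rewrite !sumr_incr, <- sumr_scal. rewrite !esym_0.
        rewrite (sumr_ext _ (fun s => y ^ S s * esym (S s) l + y * rinv q * (y ^ s * esym s l)))
          by (intros; simpl; ring).
        rewrite sumr_plus. ring. }
      rewrite E. pose proof (IH (S b) Hl') as I1. pose proof (IH b Hl') as I2.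
      assert (I3 : y * rinv q * (eprod y l - (/2) ^ b * eprod (2 * y) l)
        <= y * rinv q * sumr (fun s => y ^ s * esym s l) b).
      { apply Rmult_le_compat_l; [apply Rmult_le_pos; lra|assumption]. }
      cbn [eprod]. simpl pow in *.
      set (h := (/2) ^ b) in *. set (e := eprod y l) in *. set (e2 := eprod (2 * y) l) in *.
      lra.
Qed.

(** * Resonators *)

Lemma rpow_pos (x y : R) : 0 <= rpow x y.
Proof. unfold rpow. destruct (Rlt_dec 0 x); [left; apply exp_pos|lra]. Qed.

Lemma rpow_mult (x x' y : R) : 0 <= x -> 0 <= x' -> rpow (x * x') y = rpow x y * rpow x' y.
Proof.
  intros Hx Hx'. unfold rpow.
  destruct (Rlt_dec 0 x) as [H|H], (Rlt_dec 0 x') as [H'|H'].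
  - destruct (Rlt_dec 0 (x * x')) as [_|N]; [symmetry; apply Rpower_mult_distr; assumption|].
    exfalso. apply N, Rmult_lt_0_compat; assumption.
  - replace x' with 0 by lra. rewrite Rmult_0_r. destruct (Rlt_dec 0 0); [lra|ring].
  - replace x with 0 by lra. rewrite Rmult_0_l. destruct (Rlt_dec 0 0); [lra|ring].
  - replace x with 0 by lra. rewrite Rmult_0_l. destruct (Rlt_dec 0 0); [lra|ring].
Qed.

Lemma rpow_le_exp (x y u : R) : 0 <= y -> x <= exp u -> rpow x y <= exp (y * u).
Proof.
  intros Hy Hx. unfold rpow. destruct (Rlt_dec 0 x) as [H|H]; [|left; apply exp_pos].
  unfold Rpower. apply exp_le_exp. apply Rmult_le_compat_l; [assumption|].
  rewrite <- (ln_exp u). apply ln_le; assumption.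
Qed.

Lemma Cmod_texp_le (b : nat) (z : C) :
  Cmod (texp b z) <= sumr (fun r => Cmod z ^ r / INR (fact r)) b.
Proof.
  induction b as [|b IH]; unfold texp in *; simpl csum.
  - rewrite Cmod_0. simpl. lra.
  - eapply Rle_trans; [apply Cmod_triangle|]. simpl sumr. apply Rplus_le_compat; [exact IH|].
    rewrite Cmod_mult, Cmod_pow, Cmod_R, Rabs_right.
    + unfold Rdiv. lra.
    + apply Rle_ge. left. apply Rinv_0_lt_compat, INR_fact_lt_0.
Qed.

(** For |w| <= V both Taylor polynomials have small relative error, and exp ((k-1) w) raised to the
    power 2k/(k-1) has the modulus of exp (k w) squared. For |w| > V, |B| is at most (|w|/V)^(b-1)
    exp ((k-1) V). The number b of terms is tied to m (k-1)/k from both sides: large enough for the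
    first case, and such that 2k/(k-1) times the degree b - 1 is at most 2m in the second, so that
    the 2m-th power of |w| dominates. *)
Lemma truncated_exp_pointwise (k eps : R) (m b : nat) (w : C) :
  1 < k -> (1 <= m)%nat -> (1 <= b)%nat ->
  INR m * (k - 1) / k <= INR b -> INR b - 1 <= INR m * (k - 1) / k ->
  exp (2 * k / (k - 1) * (/2) ^ b) <= (1 + eps) * (1 - (/2) ^ m) ^ 2 ->
  0 <= eps ->
  let V := INR m / (10 * k) in
  rpow (Cmod (texp b (Cmult (RtoC (k - 1)) w))) (2 * k / (k - 1))
   <= (1 + eps) * Cmod (texp m (Cmult (RtoC k) w)) ^ 2
      + exp (2 * k * V) / V ^ (2 * m) * Cmod w ^ (2 * m).
Proof.
  intros Hk Hm Hb Hb1 Hb2 Heps He V.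
  assert (HM : 1 <= INR m) by (apply (le_INR 1); assumption).
  assert (HB : 1 <= INR b) by (apply (le_INR 1); assumption).
  assert (HV : 0 < V) by (apply Rdiv_lt_0_compat; lra).
  pose proof (Cmod_ge_0 w) as Hw.
  set (p := 2 * k / (k - 1)) in *.
  assert (Hp : 0 < p) by (apply Rdiv_lt_0_compat; lra).
  assert (Mod : forall x, 0 <= x -> Cmod (Cmult (RtoC x) w) = x * Cmod w).
  { intros x Hx. rewrite Cmod_mult, Cmod_R, Rabs_right by lra. reflexivity. }
  assert (Rem : forall x, Re (Cmult (RtoC x) w) = x * Re w) by (intros; unfold Re; simpl; ring).
  assert (Q0 : 0 <= exp (2 * k * V) / V ^ (2 * m) * Cmod w ^ (2 * m)).
  { apply Rmult_le_pos; [|apply pow_le, Hw].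
    apply Rdiv_le_0_compat; [left; apply exp_pos|apply pow_lt, HV]. }
  assert (A0 : 0 <= (1 + eps) * Cmod (texp m (Cmult (RtoC k) w)) ^ 2).
  { apply Rmult_le_pos; [lra|apply pow2_ge_0]. }
  destruct (Rle_lt_dec (Cmod w) V) as [Hle|Hgt].
  - assert (HkV : k * V = INR m / 10) by (unfold V; field; lra).
    destruct (texp_relative (Cmult (RtoC k) w) m) as [LA _].
    { rewrite Mod by lra. nra. }
    destruct (texp_relative (Cmult (RtoC (k - 1)) w) b) as [_ UB].
    { rewrite Mod by lra. apply Rle_trans with ((k - 1) * V); [apply Rmult_le_compat_l; lra|].
      replace ((k - 1) * V) with (INR m * (k - 1) / k / 10) by (unfold V; field; lra). lra. }
    rewrite Rem in LA, UB.
    set (h := (/2) ^ b) in *. assert (Hh : 0 < h) by (apply pow_lt; lra).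
    assert (UB' : Cmod (texp b (Cmult (RtoC (k - 1)) w)) <= exp ((k - 1) * Re w + h)).
    { rewrite exp_plus. eapply Rle_trans; [exact UB|].
      apply Rmult_le_compat_l; [left; apply exp_pos|apply exp_ineq1_le]. }
    apply (rpow_le_exp _ p) in UB'; [|lra].
    eapply Rle_trans; [exact UB'|].
    replace (p * ((k - 1) * Re w + h)) with (k * Re w + k * Re w + p * h) by (unfold p; field; lra).
    rewrite !exp_plus.
    assert (H2 : (/2) ^ m <= 1) by (rewrite <- (pow1 m); apply pow_incr; lra).
    assert (LA2 : (exp (k * Re w) * (1 - (/2) ^ m)) ^ 2 <= Cmod (texp m (Cmult (RtoC k) w)) ^ 2).
    { apply pow_incr. split; [|exact LA]. apply Rmult_le_pos; [left; apply exp_pos|lra]. }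
    apply Rle_trans with ((1 + eps) * (exp (k * Re w) * (1 - (/2) ^ m)) ^ 2).
    + replace ((1 + eps) * (exp (k * Re w) * (1 - (/ 2) ^ m)) ^ 2)
        with (exp (k * Re w) * exp (k * Re w) * ((1 + eps) * (1 - (/ 2) ^ m) ^ 2)) by ring.
      apply Rmult_le_compat_l; [|exact Heps].
      apply Rmult_le_pos; left; apply exp_pos.
    + assert ((1 + eps) * (exp (k * Re w) * (1 - (/ 2) ^ m)) ^ 2
         <= (1 + eps) * Cmod (texp m (Cmult (RtoC k) w)) ^ 2) by (apply Rmult_le_compat_l; lra).
      lra.
  - set (y := Cmod w / V).
    assert (Hy : 1 <= y).
    { unfold y. apply (Rmult_le_reg_r V); [assumption|]. unfold Rdiv.
      rewrite Rmult_assoc, Rinv_l by lra. lra. }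
    assert (Hly : 0 <= ln y) by (rewrite <- ln_1; apply ln_le; lra).
    assert (UB : Cmod (texp b (Cmult (RtoC (k - 1)) w)) <= exp ((INR b - 1) * ln y + (k - 1) * V)).
    { eapply Rle_trans; [apply Cmod_texp_le|]. rewrite Mod by lra.
      (* As [y >= 1] and the degree is [b - 1], the excess of |w| over [V] is extracted as a single
         power of [y]. *)
      apply Rle_trans with (y ^ (b - 1) * sumr (fun r => ((k - 1) * V) ^ r / INR (fact r)) b).
      - rewrite <- sumr_scal. apply sumr_le. intros r Hr.
        replace ((k - 1) * Cmod w) with (y * ((k - 1) * V)) by (unfold y; field; lra).
        rewrite Rpow_mult_distr. unfold Rdiv. rewrite Rmult_assoc.
        apply Rmult_le_compat_r.
        + apply Rmult_le_pos; [apply pow_le; apply Rmult_le_pos; lra|].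
          left. apply Rinv_0_lt_compat, INR_fact_lt_0.
        + apply Rle_pow; [assumption|lia].
      - rewrite exp_plus. apply Rmult_le_compat.
        + apply pow_le. lra.
        + apply sumr_pos. intros r _. apply Rdiv_le_0_compat; [|apply INR_fact_lt_0].
          apply pow_le, Rmult_le_pos; lra.
        + right. rewrite <- Rpower_pow by lra. unfold Rpower. rewrite minus_INR by assumption.
          reflexivity.
        + apply sumr_exp. apply Rmult_le_pos; lra. }
    apply (rpow_le_exp _ p) in UB; [|lra].
    eapply Rle_trans; [exact UB|].
    assert (E : exp (2 * k * V) / V ^ (2 * m) * Cmod w ^ (2 * m)
                = exp (2 * k * V + INR (2 * m) * ln y)).
    { rewrite exp_plus. fold (Rpower y (INR (2 * m))). rewrite Rpower_pow by lra.
      unfold y, Rdiv. rewrite Rpow_mult_distr, pow_inv. ring. }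
    assert (exp (p * ((INR b - 1) * ln y + (k - 1) * V)) <= exp (2 * k * V + INR (2 * m) * ln y)).
    { apply exp_le_exp.
      replace (p * ((INR b - 1) * ln y + (k - 1) * V))
        with (2 * k * V + p * (INR b - 1) * ln y) by (unfold p; field; lra).
      apply Rplus_le_compat_l. apply Rmult_le_compat_r; [assumption|].
      apply Rle_trans with (p * (INR m * (k - 1) / k)); [apply Rmult_le_compat_l; lra|].
      rewrite mult_INR. simpl (INR 2). right. unfold p. field. lra. }
    lra.
Qed.

Definition in_range (lo hi p : nat) : Prop := (lo < p <= hi)%nat.

(* [f] dominates [|B|^(2k/(k-1))]; [N] bounds the lengths and [W] the values at [t = 0];
   [lv], [lw] and [lg] are logarithmic bounds for the mean values of [|A|^2], [f] and
   [zeta B conj(A)]. *)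
Definition resonator (k : R) (lo hi : nat) (N W lv lw lg : R) : Prop :=
  exists A B f : bp,
    good (in_range lo hi) N A /\ good (in_range lo hi) N B /\ good (in_range lo hi) (N ^ 2) f /\
    (forall t, rpow (Cmod (val B t)) (2 * k / (k - 1)) <= Re (val f t) /\ Im (val f t) = 0) /\
    ev (bmul A (bconj A)) diag <= exp lv /\ ev f diag <= exp lw /\
    exp lg <= ev (bmul B (bconj A)) dvd_weight /\
    ev A (fun _ _ => 1) <= W /\ ev B (fun _ _ => 1) <= W /\ ev f (fun _ _ => 1) <= W ^ 2.

Lemma resonator_nil (k : R) (lo : nat) : 1 < k -> resonator k lo lo 1 1 0 0 0.
Proof.
  intros Hk. exists bone, bone, bone.
  assert (G : good (in_range lo lo) 1 bone) by (apply good_bone; lra).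
  assert (Ed : ev (bmul bone (bconj bone)) diag = 1) by (simpl; unfold diag; simpl; ring).
  assert (Ez : ev (bmul bone (bconj bone)) dvd_weight = 1).
  { simpl. unfold dvd_weight; simpl. rewrite Rdiv_1_r, sqrt_1. ring. }
  split; [exact G|]. split; [exact G|]. split; [apply good_bone; lra|]. split.
  - intros t. rewrite val_bone. unfold Re, Im; simpl. split; [|reflexivity].
    rewrite Cmod_1. unfold rpow. destruct (Rlt_dec 0 1); [|lra].
    unfold Rpower. rewrite ln_1, Rmult_0_r, exp_0. lra.
  - rewrite Ed, Ez, !ev_bone, exp_0. unfold diag; simpl. repeat split; lra.
Qed.

Lemma ev_bmul4 (A A' B B' : bp) (phi : nat -> nat -> R) :
  ev (bmul (bmul A A') (bconj (bmul B B'))) phi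
  = ev (bmul (bmul A (bconj B)) (bmul A' (bconj B'))) phi.
Proof.
  rewrite !ev_bmul. apply ev_ext. intros a b.
  transitivity (ev A' (fun a' b' => ev (bconj B) (fun c d => ev (bconj B')
     (fun c' d' => phi (a * c * (a' * c'))%nat (b * d * (b' * d'))%nat)))).
  - apply ev_ext. intros a' b'. rewrite ev_bconj, ev_bmul, ev_bconj.
    apply ev_ext. intros c d. rewrite ev_bconj. apply ev_ext. intros c' d'. f_equal; lia.
  - rewrite ev_swap. apply ev_ext. intros c d. rewrite ev_bmul.
    apply ev_ext. intros a' b'. reflexivity.
Qed.

Lemma ev_one_bmul (F G : bp) :
  ev (bmul F G) (fun _ _ => 1) = ev F (fun _ _ => 1) * ev G (fun _ _ => 1).
Proof. apply ev_bmul_split. intros. ring. Qed.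

(** Disjoint ranges of primes make all three mean values multiply, so the logarithmic bounds add.
    The condition that [f] is real at each t lets the pointwise majorants multiply too. *)
Lemma resonator_app (k : R) (lo mid hi : nat) (N N' W W' lv lv' lw lw' lg lg' : R) :
  (lo <= mid <= hi)%nat ->
  resonator k lo mid N W lv lw lg -> resonator k mid hi N' W' lv' lw' lg' ->
  resonator k lo hi (N * N') (W * W') (lv + lv') (lw + lw') (lg + lg').
Proof.
  intros Hlo [A [B [f [GA [GB [Gf [Hf [HA [Hw [Hg [WA [WB Wf]]]]]]]]]]]]
    [A' [B' [f' [GA' [GB' [Gf' [Hf' [HA' [Hw' [Hg' [WA' [WB' Wf']]]]]]]]]]]].
  exists (bmul A A'), (bmul B B'), (bmul f f').
  assert (U1 : forall p, in_range lo mid p -> in_range lo hi p) by (unfold in_range; intros; lia).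
  assert (U2 : forall p, in_range mid hi p -> in_range lo hi p) by (unfold in_range; intros; lia).
  assert (Dj : forall p, in_range lo mid p -> in_range mid hi p -> False) by (unfold in_range; intros; lia).
  assert (W1 : forall M F, good (in_range lo mid) M F -> good (in_range lo hi) M F)
    by (intros M F; apply good_weaken; [assumption|lra]).
  assert (W2 : forall M F, good (in_range mid hi) M F -> good (in_range lo hi) M F)
    by (intros M F; apply good_weaken; [assumption|lra]).
  assert (P1 : forall M F, good (in_range lo mid) M F -> 0 <= ev F (fun _ _ => 1))
    by (intros M F HF; apply (good_nonneg _ _ _ _ HF); intros; lra).
  assert (P2 : forall M F, good (in_range mid hi) M F -> 0 <= ev F (fun _ _ => 1))
    by (intros M F HF; apply (good_nonneg _ _ _ _ HF); intros; lra).
  assert (BA : good (in_range lo mid) (N * N) (bmul B (bconj A))) by (apply good_bmul; [|apply good_bconj]; assumption).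
  assert (BA' : good (in_range mid hi) (N' * N') (bmul B' (bconj A'))) by (apply good_bmul; [|apply good_bconj]; assumption).
  assert (AA : good (in_range lo mid) (N * N) (bmul A (bconj A))) by (apply good_bmul; [|apply good_bconj]; assumption).
  assert (AA' : good (in_range mid hi) (N' * N') (bmul A' (bconj A'))) by (apply good_bmul; [|apply good_bconj]; assumption).
  split; [apply good_bmul; auto|]. split; [apply good_bmul; auto|].
  split; [rewrite Rpow_mult_distr; apply good_bmul; auto|].
  split.
  { intros t. rewrite (val_bmul (in_range lo hi) N N' B B'), (val_bmul (in_range lo hi) (N ^ 2) (N' ^ 2) f f') by auto.
    destruct (Hf t) as [F1 F2]. destruct (Hf' t) as [F1' F2'].
    destruct (val f t) as [x0 y0], (val f' t) as [x1 y1].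
    unfold Re, Im in *. cbn [fst snd Cmult] in *. subst y0 y1. split; [|ring].
    rewrite Cmod_mult, rpow_mult by apply Cmod_ge_0.
    rewrite Rmult_0_l, Rminus_0_r. apply Rmult_le_compat; try assumption; apply rpow_pos. }
  rewrite !ev_bmul4, !exp_plus.
  rewrite (ev_diag_bmul _ _ _ _ _ _ Dj AA AA'), (ev_dvd_weight_bmul _ _ _ _ _ _ Dj BA BA'),
    (ev_diag_bmul _ _ _ _ _ _ Dj Gf Gf'), !ev_one_bmul.
  split; [apply Rmult_le_compat; try assumption; eapply good_nonneg; eauto using diag_pos|].
  split; [apply Rmult_le_compat; try assumption; eapply good_nonneg; eauto using diag_pos|].
  split; [apply Rmult_le_compat; try assumption; left; apply exp_pos|].
  split; [apply Rmult_le_compat; eauto|]. split; [apply Rmult_le_compat; eauto|].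
  rewrite Rpow_mult_distr. apply Rmult_le_compat; eauto.
Qed.

Lemma dexp2_S (i : nat) : INR (dexp2 (S i)) = INR (dexp2 i) ^ 2.
Proof.
  unfold dexp2. rewrite <- pow_INR. f_equal. rewrite Nat.pow_succ_r', Nat.mul_comm, Nat.pow_mul_r. reflexivity.
Qed.

Lemma dexp2_ge (i : nat) : (1 <= i)%nat -> 4 ^ i <= INR (dexp2 i).
Proof.
  intros Hi. replace 4 with (2 ^ 2) by ring. rewrite <- pow_mult. unfold dexp2. rewrite pow_INR.
  simpl (INR 2). replace (1 + 1) with 2 by ring. apply Rle_pow; [lra|].
  destruct i as [|i]; [lia|]. clear Hi. induction i as [|i IH]; [simpl; lia|].
  rewrite (Nat.pow_succ_r' 2 (S i)). pose proof (Nat.pow_nonzero 2 (S i)). lia.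
Qed.

Lemma primes_ilist (i : nat) : primes_list (ilist i).
Proof. intros p Hp. apply in_pint in Hp. tauto. Qed.

Lemma NoDup_ilist (i : nat) : NoDup (ilist i).
Proof. apply NoDup_pint. Qed.

Lemma ilist_range (i p : nat) : In p (ilist i) -> INR (dexp2 i) <= INR p <= INR (dexp2 i) ^ 2.
Proof.
  intros Hp. apply in_pint in Hp. rewrite <- dexp2_S. split; apply le_INR; lia.
Qed.

Lemma pw_one (l : list nat) (r : nat) : pw l r (fun _ => 1) = rsum isq l ^ r.
Proof.
  induction r as [|r IH]; [reflexivity|]. cbn [pw pow]. rewrite <- IH.
  rewrite (Rmult_comm (rsum isq l)), <- rsum_scal. apply rsum_ext. intros. ring.
Qed.

(** * Resonators on a single range *)

Section Interval.
Variables (i : nat).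
Let l := ilist i.
Let Xi := INR (dexp2 i).
Let S0 := rsum rinv l.
Hypothesis HX : 16 <= Xi.

Lemma S0_bounds : 0 <= S0 <= 2.
Proof.
  split; [|apply rsum_ilist]. apply rsum_pos. intros p Hp. left.
  apply rinv_pos, (primes_ilist i), Hp.
Qed.

Lemma rsum_sq_ilist : rsum (fun p => rinv p ^ 2) l <= 2 / Xi.
Proof.
  apply Rle_trans with (rsum (fun p => / Xi * rinv p) l).
  - apply rsum_le. intros p Hp. destruct (ilist_range i p Hp) as [H1 _]. fold Xi in H1.
    assert (0 < rinv p) by apply rinv_pos, (primes_ilist i), Hp.
    assert (rinv p <= / Xi) by (apply Rinv_le_contravar; lra). simpl. nra.
  - rewrite rsum_scal. fold S0. pose proof S0_bounds.
    assert (0 < / Xi) by (apply Rinv_0_lt_compat; lra). unfold Rdiv. nra.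
Qed.

Lemma rsum_isq_ilist : 0 <= rsum isq l <= 2 * Xi.
Proof.
  split; [apply rsum_pos; intros p Hp; left; apply isq_pos, (primes_ilist i), Hp|].
  apply Rle_trans with (rsum (fun p => Xi * rinv p) l).
  - apply rsum_le. intros p Hp. destruct (ilist_range i p Hp) as [H1 H2]. fold Xi in H1, H2.
    assert (Hq : 0 < isq p) by apply isq_pos, (primes_ilist i), Hp.
    rewrite <- isq_sq by apply (primes_ilist i), Hp.
    assert (1 <= Xi * isq p); [|nra].
    unfold isq. assert (0 < sqrt (INR p)) by (apply sqrt_lt_R0; lra).
    apply (Rmult_le_reg_r (sqrt (INR p))); [assumption|].
    rewrite Rmult_assoc, Rinv_l, Rmult_1_r, Rmult_1_l by lra.
    rewrite <- (sqrt_pow2 Xi) by lra. apply sqrt_le_1_alt. lra.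
  - rewrite rsum_scal. fold S0. pose proof S0_bounds. nra.
Qed.

(** Degrees stay below m, which explains the exponent m - 1; the spare factor Xi^2 later absorbs the
    numerical constants, so that length and weight obey the same bound. The 3 bounds e. *)
Lemma exp_poly_weight (k x : R) (b m : nat) : 0 <= x <= k -> (b <= m)%nat -> (1 <= m)%nat -> 2 * k <= Xi ->
  ev (exp_poly x b l) (fun _ _ => 1) <= 3 * (Xi ^ 2) ^ (m - 1).
Proof.
  intros Hx Hbm Hm Hk. rewrite ev_exp_poly. pose proof rsum_isq_ilist as HP.
  apply Rle_trans with (sumr (fun r => (Xi ^ 2) ^ (m - 1) * (1 ^ r / INR (fact r))) m).
  - eapply Rle_trans; [|apply (sumr_widen _ b m Hbm)].
    + apply sumr_le. intros r Hr. rewrite pw_one.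
      unfold cf, Rdiv. rewrite pow1, Rmult_1_l.
      assert (0 < / INR (fact r)) by (apply Rinv_0_lt_compat, INR_fact_lt_0).
      rewrite Rmult_assoc, (Rmult_comm (/ _)), <- Rmult_assoc.
      apply Rmult_le_compat_r; [lra|]. rewrite <- Rpow_mult_distr.
      apply Rle_trans with ((Xi ^ 2) ^ r); [|apply Rle_pow; [simpl; nra|lia]].
      apply pow_incr. split; [apply Rmult_le_pos; lra|]. simpl. nra.
    + intros r. apply Rmult_le_pos; [apply pow_le, pow2_ge_0|].
      rewrite pow1. apply Rdiv_le_0_compat; [lra|apply INR_fact_lt_0].
  - rewrite sumr_scal, Rmult_comm. apply Rmult_le_compat_r; [apply pow_le, pow2_ge_0|].
    eapply Rle_trans; [apply sumr_exp; lra|apply exp_le_3].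
Qed.

Lemma good_exp_poly_ilist (x : R) (b m : nat) : 0 <= x -> (b <= m)%nat ->
  good (in_range (dexp2 i) (dexp2 (S i))) ((Xi ^ 2) ^ m) (exp_poly x b l).
Proof.
  intros Hx Hbm. assert (1 <= Xi ^ 2) by (simpl; nra).
  apply good_weaken with (U := fun p => In p l) (N := (Xi ^ 2) ^ b).
  - intros p Hp. apply in_pint in Hp. unfold in_range. tauto.
  - apply Rle_pow; assumption.
  - apply good_exp_poly; try assumption; [apply primes_ilist|].
    intros p Hp. apply (ilist_range i p Hp).
Qed.

Lemma one_minus_ge_exp (h : R) : 0 <= h <= /2 -> exp (- (2 * h)) <= 1 - h.
Proof.
  intros Hh. rewrite exp_Ropp. pose proof (exp_ineq1_le (2 * h)).
  apply Rle_trans with (/ (1 + 2 * h)); [apply Rinv_le_contravar; lra|].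
  apply (Rmult_le_reg_r (1 + 2 * h)); [lra|]. rewrite Rinv_l by lra. nra.
Qed.

Lemma exp_pow2 (n : nat) : exp (INR n * ln 2) = 2 ^ n.
Proof. rewrite <- Rpower_pow by lra. reflexivity. Qed.

(** Rankin's error is 2^(-b) exp (2 y S0) <= 2^(-b) e^(4y). Since ln 2 > 1/2, e^(4y) <= 2^(8y), and
    the condition on b leaves an error of 2^(-n-1), whose relative effect is at most exp (-2^(-n)).
    The maximum with 0 comes from the term of degree 0, which alone is 1; it keeps the exponent
    nonnegative. *)
Lemma twisted_lower (x k : R) (b m n : nat) :
  0 <= x -> 0 <= k -> (b <= m)%nat -> 8 * ((1 + x) * k) + INR n + 1 <= INR b ->
  let y := (1 + x) * k in
  exp (Rmax 0 (y * S0 - y ^ 2 * (2 / Xi) - (/2) ^ n))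
    <= ev (bmul (exp_poly x b l) (bconj (exp_poly k m l))) dvd_weight.
Proof.
  intros Hx Hk Hbm Hb y. fold y in Hb.
  assert (Hy : 0 <= y) by (apply Rmult_le_pos; lra).
  pose proof S0_bounds as HS. pose proof (pos_INR n) as Hn.
  assert (Hl : primes_list l) by apply primes_ilist.
  eapply Rle_trans; [|apply twisted_mean_exp_poly; try assumption; apply NoDup_ilist]. fold y.
  set (G := sumr _ b).
  assert (Hb1 : (n + 1 <= b)%nat) by (apply INR_le; rewrite plus_INR; simpl; lra).
  assert (G1 : 1 <= G).
  { unfold G. destruct b as [|b]; [lia|]. rewrite sumr_incr, esym_0.
    assert (0 <= sumr (fun r => y ^ S r * esym (S r) l) b); [|simpl (y ^ 0); lra].
    apply sumr_pos. intros r _. apply Rmult_le_pos; [apply pow_le, Hy|apply esym_pos, Hl]. }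
  assert (G2 : exp (y * S0 - y ^ 2 * (2 / Xi) - (/2) ^ n) <= G).
  { eapply Rle_trans; [|apply esym_truncated; assumption].
    pose proof (eprod_ge y l Hy Hl) as E1. pose proof (eprod_le (2 * y) l ltac:(lra) Hl) as E2.
    pose proof (eprod_ge1 y l Hy Hl) as E3. fold S0 in E1, E2.
    set (h := (/2) ^ (n + 1)).
    assert (Hh : 0 < h <= /2).
    { unfold h. rewrite pow_add, pow_1. assert (0 < (/2) ^ n <= 1); [|lra].
      split; [apply pow_lt; lra|]. rewrite <- (pow1 n). apply pow_incr. lra. }
    assert (E4 : (/2) ^ b * eprod (2 * y) l <= h).
    { replace b with ((n + 1) + (b - (n + 1)))%nat by lia. rewrite pow_add. fold h.
      rewrite Rmult_assoc. rewrite <- (Rmult_1_r h) at 2. apply Rmult_le_compat_l; [lra|].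
      rewrite pow_inv. apply (Rmult_le_reg_l (2 ^ (b - (n + 1)))); [apply pow_lt; lra|].
      rewrite <- Rmult_assoc, Rinv_r, Rmult_1_l, Rmult_1_r by (apply pow_nonzero; lra).
      eapply Rle_trans; [exact E2|]. rewrite <- exp_pow2. apply exp_le_exp.
      rewrite minus_INR, plus_INR by assumption. simpl (INR 1).
      pose proof ln_lt_2. nra. }
    assert (E5 : eprod y l * (1 - h) <= eprod y l - (/2) ^ b * eprod (2 * y) l) by nra.
    eapply Rle_trans; [|exact E5].
    unfold Rminus at 1. rewrite exp_plus. apply Rmult_le_compat; try (left; apply exp_pos).
    - eapply Rle_trans; [|exact E1]. apply exp_le_exp.
      pose proof rsum_sq_ilist. assert (0 <= y ^ 2) by apply pow2_ge_0. nra.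
    - replace ((/2) ^ n) with (2 * h) by (unfold h; rewrite pow_add, pow_1; field).
      apply one_minus_ge_exp. lra. }
  unfold Rmax. destruct (Rle_dec 0 _); [exact G2|rewrite exp_0; exact G1].
Qed.

Lemma exp_poly_weight_le (k x : R) (b m : nat) : 0 <= x <= k -> (b <= m)%nat -> (1 <= m)%nat -> 2 * k <= Xi ->
  ev (exp_poly x b l) (fun _ _ => 1) <= (Xi ^ 2) ^ m.
Proof.
  intros Hx Hbm Hm Hk. eapply Rle_trans; [apply (exp_poly_weight k x b m); assumption|].
  replace m with (S (m - 1)) at 2 by lia. rewrite <- tech_pow_Rmult.
  apply Rmult_le_compat_r; [apply pow_le, pow2_ge_0|]. simpl. nra.
Qed.

Lemma interval_middle (k : R) (n : nat) :
  1 < k -> 16 * k ^ 2 <= INR n -> 2 * k <= Xi ->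
  resonator k (dexp2 i) (dexp2 (S i)) ((Xi ^ 2) ^ (4 * n ^ 2)) ((Xi ^ 2) ^ (4 * n ^ 2))
    (k ^ 2 * S0) 0 (Rmax 0 (k * S0 - k ^ 2 * (2 / Xi) - (/2) ^ n)).
Proof.
  intros Hk Hn HkX. set (m := (4 * n ^ 2)%nat).
  assert (Hn16 : 16 <= INR n) by nra.
  assert (Hmn : INR m = 4 * INR n ^ 2).
  { unfold m. rewrite mult_INR, pow_INR. simpl (INR 4). ring. }
  assert (Hm1 : (1 <= m)%nat) by (apply INR_le; rewrite Hmn; simpl; nra).
  assert (Hl : primes_list l) by apply primes_ilist.
  assert (HN : 1 <= (Xi ^ 2) ^ m) by (apply pow_R1_Rle; simpl; nra).
  assert (HN2 : 1 <= ((Xi ^ 2) ^ m) ^ 2) by (apply pow_R1_Rle, HN).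
  (* The polynomial [exp_poly 0 m l] is constantly 1; this form of B = 1 lets [twisted_lower] apply
     with [x = 0]. *)
  exists (exp_poly k m l), (exp_poly 0 m l), bone.
  split; [apply good_exp_poly_ilist; [lra|lia]|]. split; [apply good_exp_poly_ilist; [lra|lia]|].
  split; [apply good_bone; exact HN2|].
  split.
  { intros t. rewrite val_bone, val_exp_poly by assumption. rewrite Cmult_0_l.
    replace m with (S (m - 1)) by lia. rewrite texp_S_0, Cmod_1. unfold Re, Im; simpl.
    split; [|reflexivity]. unfold rpow. destruct (Rlt_dec 0 1); [|lra].
    unfold Rpower. rewrite ln_1, Rmult_0_r, exp_0. lra. }
  split; [apply mean_square_exp_poly; [lra|assumption|apply NoDup_ilist]|].
  split; [rewrite ev_bone, exp_0; unfold diag; simpl; lra|].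
  split.
  { pose proof (twisted_lower 0 k m m n ltac:(lra) ltac:(lra) ltac:(lia)) as H.
    cbv zeta in H. rewrite Rplus_0_r, Rmult_1_l in H. apply H. rewrite Hmn. nra. }
  split; [apply (exp_poly_weight_le k); [lra|lia|assumption|assumption]|].
  split; [apply (exp_poly_weight_le k); [lra|lia|assumption|assumption]|].
  rewrite ev_bone. exact HN2.
Qed.

Lemma fact_le_pow (m : nat) : INR (fact m) <= INR m ^ m.
Proof.
  assert (G : forall j, (j <= m)%nat -> INR (fact j) <= INR m ^ j).
  { induction j as [|j IH]; intros Hj; [simpl; lra|].
    rewrite fact_simpl, mult_INR. rewrite <- tech_pow_Rmult. apply Rmult_le_compat.
    - apply pos_INR.
    - apply pos_INR.
    - apply le_INR. assumption.
    - apply IH. lia. }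
  apply G. lia.
Qed.

Lemma exp_fifth : exp (/5) <= 2.
Proof.
  apply Rnot_lt_le. intros H.
  assert (E : exp (/5) ^ 5 = exp 1) by (simpl; rewrite Rmult_1_r, <- !exp_plus; f_equal; lra).
  assert (2 ^ 5 <= exp (/5) ^ 5) by (apply pow_incr; lra).
  pose proof exp_le_3. lra.
Qed.

Lemma exp_INR_mult (m : nat) (x : R) : exp (INR m * x) = exp x ^ m.
Proof.
  induction m as [|m IH]; [simpl; rewrite Rmult_0_l; apply exp_0|].
  rewrite S_INR, Rmult_plus_distr_r, exp_plus, IH, Rmult_1_l. simpl. ring.
Qed.

Lemma pow2_ge_INR (n : nat) : INR n <= 2 ^ n.
Proof.
  induction n as [|n IH]; [simpl; lra|]. rewrite S_INR. simpl.
  assert (1 <= 2 ^ n) by (apply pow_R1_Rle; lra). lra.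
Qed.

(** The majorant [f] is (1 + eps) |A|^2 + kap |P^m|^2 from [truncated_exp_pointwise]. The condition
    on 2k^2/(k-1) makes m (k-1)/k at least 8 k n, so that B has enough terms; the condition on 16k^2
    makes m large compared with k^2, so that the mean value of the second summand is negligible. *)
Lemma interval_full (k : R) (n : nat) :
  1 < k -> 16 * k ^ 2 <= INR n -> 2 * k ^ 2 / (k - 1) <= INR n -> 2 * k <= Xi ->
  resonator k (dexp2 i) (dexp2 (S i)) ((Xi ^ 2) ^ (4 * n ^ 2)) ((Xi ^ 2) ^ (4 * n ^ 2))
    (k ^ 2 * S0) (k ^ 2 * S0 + 2 * (/2) ^ n)
    (Rmax 0 (k ^ 2 * S0 - k ^ 4 * (2 / Xi) - (/2) ^ n)).
Proof.
  intros Hk Hn Hn2 HkX. set (m := (4 * n ^ 2)%nat).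
  assert (Hn16 : 16 <= INR n) by nra.
  assert (Hmn : INR m = 4 * INR n ^ 2).
  { unfold m. rewrite mult_INR, pow_INR. simpl (INR 4). ring. }
  assert (Hm1 : (1 <= m)%nat) by (apply INR_le; rewrite Hmn; simpl; nra).
  assert (Hmnat : (n + 3 <= m)%nat) by (apply INR_le; rewrite Hmn, plus_INR; simpl; nra).
  assert (Hl : primes_list l) by apply primes_ilist.
  pose proof S0_bounds as HS.
  set (x := INR m * (k - 1) / k).
  assert (Hx8 : 8 * k * INR n <= x).
  { unfold x. rewrite Hmn. apply (Rmult_le_reg_r (/ (k - 1))); [apply Rinv_0_lt_compat; lra|].
    replace (4 * INR n ^ 2 * (k - 1) / k * / (k - 1)) with (4 * INR n / k * INR n) by (field; lra).
    replace (8 * k * INR n * / (k - 1)) with (4 * INR n / k * (2 * k ^ 2 / (k - 1))) by (field; lra).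
    apply Rmult_le_compat_l; [apply Rdiv_le_0_compat; lra|assumption]. }
  (* The number of terms of B is one more than the integer part of m (k-1)/k, so its degree is that
     integer part. *)
  destruct (nfloor_ex x ltac:(nra)) as [b' [Hb1 Hb2]].
  set (b := S b').
  assert (Hb : INR b = INR b' + 1) by apply S_INR.
  assert (Hbm : (b <= m)%nat).
  { apply INR_le. rewrite Hb. assert (x + 1 <= INR m); [|lra].
    unfold x. replace (INR m * (k - 1) / k) with (INR m - INR m / k) by (field; lra).
    assert (1 <= INR m / k); [|lra]. apply (Rmult_le_reg_r k); [lra|].
    unfold Rdiv. rewrite Rmult_assoc, Rinv_l by lra. rewrite Hmn. nra. }
  assert (Hbn : (8 * n <= b)%nat).
  { apply INR_le. rewrite mult_INR. simpl (INR 8). nra. }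
  set (eps := (/2) ^ n).
  assert (He : 0 < eps <= 1).
  { unfold eps. split; [apply pow_lt; lra|]. rewrite <- (pow1 n). apply pow_incr. lra. }
  assert (Hpow3 : forall j, (n + 3 <= j)%nat -> (/2) ^ j <= eps / 8).
  { intros j Hj. unfold eps. replace j with (n + 3 + (j - (n + 3)))%nat by lia. rewrite !pow_add.
    assert (0 < (/2) ^ (j - (n + 3)) <= 1).
    { split; [apply pow_lt; lra|]. rewrite <- (pow1 (j - (n + 3))). apply pow_incr. lra. }
    assert (0 < (/2) ^ n) by (apply pow_lt; lra). simpl ((/2) ^ 3). nra. }
  set (V := INR m / (10 * k)).
  assert (HV1 : 1 <= V).
  { unfold V. apply (Rmult_le_reg_r (10 * k)); [lra|]. unfold Rdiv.
    rewrite Rmult_assoc, Rinv_l by lra. rewrite Hmn. nra. }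
  set (kap := exp (2 * k * V) / V ^ (2 * m)).
  assert (Hkap : 0 < kap) by (apply Rdiv_lt_0_compat; [apply exp_pos|apply pow_lt; lra]).
  assert (HkV : exp (2 * k * V) <= 2 ^ m).
  { replace (2 * k * V) with (INR m * /5) by (unfold V; field; lra).
    rewrite exp_INR_mult. apply pow_incr. pose proof exp_fifth. pose proof (exp_pos (/5)). lra. }
  set (A := exp_poly k m l). set (B := exp_poly (k - 1) b l). set (Q := bpow (Pl l) m).
  assert (GP : good (fun p => In p l) (Xi ^ 2) (Pl l)).
  { apply good_Pl; [assumption| |simpl; nra]. intros p Hp. apply (ilist_range i p Hp). }
  assert (GA : good (in_range (dexp2 i) (dexp2 (S i))) ((Xi ^ 2) ^ m) A) by (apply good_exp_poly_ilist; [lra|lia]).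
  assert (GQ : good (in_range (dexp2 i) (dexp2 (S i))) ((Xi ^ 2) ^ m) Q).
  { apply good_weaken with (U := fun p => In p l) (N := (Xi ^ 2) ^ m).
    - intros p Hp. apply in_pint in Hp. unfold in_range. tauto.
    - lra.
    - apply good_bpow, GP. }
  exists A, B, (bscale (1 + eps) (bmul A (bconj A)) ++ bscale kap (bmul Q (bconj Q))).
  split; [exact GA|]. split; [apply good_exp_poly_ilist; [lra|assumption]|].
  split.
  { replace (((Xi ^ 2) ^ m) ^ 2) with ((Xi ^ 2) ^ m * (Xi ^ 2) ^ m) by ring.
    apply good_app; apply good_bscale; try lra; apply good_bmul; try assumption;
      apply good_bconj; assumption. }
  split.
  { intros t. rewrite val_app, !val_bscale.
    rewrite (val_bmul _ _ _ A (bconj A) t GA (good_bconj _ _ _ GA)).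
    rewrite (val_bmul _ _ _ Q (bconj Q) t GQ (good_bconj _ _ _ GQ)).
    rewrite !val_bconj. set (w := val (Pl l) t).
    assert (EA : val A t = texp m (Cmult (RtoC k) w)) by (apply val_exp_poly; assumption).
    assert (EB : val B t = texp b (Cmult (RtoC (k - 1)) w)) by (apply val_exp_poly; assumption).
    assert (EQ : val Q t = Cpow w m) by (apply (val_bpow _ _ _ _ _ GP)).
    assert (EC : forall z, Cmult z (Cconj z) = RtoC (Cmod z ^ 2)).
    { intros z. symmetry. apply Cmod2_conj. }
    rewrite !EC, <- !RtoC_mult, <- RtoC_plus. split; [|reflexivity].
    match goal with |- _ <= Re (RtoC ?x) => change (Re (RtoC x)) with x end.
    rewrite EA, EB, EQ, Cmod_pow, <- pow_mult, (Nat.mul_comm m 2).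
    apply truncated_exp_pointwise; try assumption; try lia; try (fold x; lra).
    set (p := 2 * k / (k - 1)).
    assert (Hp : 0 < p <= INR n).
    { split; [apply Rdiv_lt_0_compat; lra|]. eapply Rle_trans; [|exact Hn2].
      unfold p, Rdiv. apply Rmult_le_compat_r; [left; apply Rinv_0_lt_compat; lra|]. nra. }
    assert (Hpb : p * (/2) ^ b <= eps / 8).
    { apply Rle_trans with (2 ^ n * (/2) ^ (n + (n + 3))).
      - apply Rmult_le_compat; [lra|apply pow_le; lra| |].
        + eapply Rle_trans; [apply Hp|apply pow2_ge_INR].
        + replace b with ((n + (n + 3)) + (b - (n + (n + 3))))%nat.
          * rewrite (pow_add _ (n + (n + 3))). rewrite <- (Rmult_1_r ((/2) ^ (n + (n + 3)))) at 2.
            apply Rmult_le_compat_l; [apply pow_le; lra|].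
            rewrite <- (pow1 (b - (n + (n + 3)))). apply pow_incr. lra.
          * assert (16 <= n)%nat by (apply INR_le; simpl; lra). lia.
      - rewrite pow_add, <- Rmult_assoc, <- Rpow_mult_distr.
        replace (2 * /2) with 1 by field. rewrite pow1, Rmult_1_l. apply Hpow3. lia. }
    assert (Hmm : (/2) ^ m <= eps / 8) by (apply Hpow3; assumption).
    assert (Hm0 : 0 < (/2) ^ m) by (apply pow_lt; lra).
    assert (Hpb0 : 0 < p * (/2) ^ b) by (apply Rmult_lt_0_compat; [lra|apply pow_lt; lra]).
    set (u := p * (/2) ^ b) in *. set (v := (/2) ^ m) in *.
    (* An upper bound for exp at small u, through exp (-u) >= 1 - u and inversion. *)
    assert (Hu : exp u <= 1 + 2 * u).
    { pose proof (one_minus_ge_exp (u / 2) ltac:(lra)) as H.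
      replace (- (2 * (u / 2))) with (- u) in H by field.
      rewrite exp_Ropp in H. apply Rinv_le_contravar in H; [|apply Rinv_0_lt_compat, exp_pos].
      rewrite Rinv_inv in H.
      pose proof (exp_ineq1_le (- u)) as H2. rewrite exp_Ropp in H2.
      apply Rinv_le_contravar in H2; [|lra]. rewrite Rinv_inv in H2.
      eapply Rle_trans; [exact H2|]. apply (Rmult_le_reg_r (1 + - u)); [lra|].
      rewrite Rinv_l by lra. nra. }
    nra. }
  split; [apply mean_square_exp_poly; [lra|assumption|apply NoDup_ilist]|].
  split.
  { rewrite ev_app, !ev_bscale, exp_plus.
    pose proof (mean_square_exp_poly k m l ltac:(lra) Hl (NoDup_ilist i)) as M1. fold S0 A in M1.
    pose proof (mean_square_pow m l Hl (NoDup_ilist i)) as M2. fold S0 Q in M2.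
    assert (E1 : 1 <= exp (k ^ 2 * S0)).
    { rewrite <- exp_0. apply exp_le_exp. apply Rmult_le_pos; [apply pow2_ge_0|lra]. }
    assert (M3 : kap * (INR (fact m) * S0 ^ m) <= eps).
    { apply Rle_trans with ((/2) ^ m).
      - unfold kap. apply Rle_trans with (2 ^ m / V ^ (2 * m) * (INR m ^ m * 2 ^ m)).
        + apply Rmult_le_compat.
          * left. exact Hkap.
          * apply Rmult_le_pos; [apply pos_INR|apply pow_le; lra].
          * unfold Rdiv. apply Rmult_le_compat_r; [|exact HkV].
            left. apply Rinv_0_lt_compat, pow_lt. lra.
          * apply Rmult_le_compat; [apply pos_INR|apply pow_le; lra|apply fact_le_pow|apply pow_incr; lra].
        + unfold Rdiv. rewrite pow_mult, <- pow_inv.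
          rewrite <- !Rpow_mult_distr. apply pow_incr.
          assert (Em : 2 * / V ^ 2 * (INR m * 2) = 400 * k ^ 2 / INR m).
          { unfold V. field. rewrite Hmn. split; [nra|lra]. }
          rewrite Em. split.
          * apply Rdiv_le_0_compat; [pose proof (pow2_ge_0 k); lra|rewrite Hmn; nra].
          * apply (Rmult_le_reg_r (INR m)); [rewrite Hmn; nra|].
            unfold Rdiv. rewrite Rmult_assoc, Rinv_l, Rmult_1_r by (rewrite Hmn; nra).
            rewrite Hmn. nra.
      - eapply Rle_trans; [apply Hpow3; assumption|]. lra. }
    assert (M4 : kap * ev (bmul Q (bconj Q)) diag <= eps).
    { eapply Rle_trans; [|exact M3]. apply Rmult_le_compat_l; lra. }
    assert (M5 : (1 + eps) * ev (bmul A (bconj A)) diag <= (1 + eps) * exp (k ^ 2 * S0))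
      by (apply Rmult_le_compat_l; lra).
    apply Rle_trans with (exp (k ^ 2 * S0) * (1 + 2 * eps)); [nra|].
    apply Rmult_le_compat_l; [lra|apply exp_ineq1_le]. }
  split.
  { pose proof (twisted_lower (k - 1) k b m n ltac:(lra) ltac:(lra) Hbm) as H.
    cbv zeta in H. replace ((1 + (k - 1)) * k) with (k ^ 2) in H by ring.
    replace ((k ^ 2) ^ 2) with (k ^ 4) in H by ring. apply H. nra. }
  split; [apply (exp_poly_weight_le k); [lra|lia|assumption|assumption]|].
  split; [apply (exp_poly_weight_le k); [lra|assumption|assumption|assumption]|].
  rewrite ev_app, !ev_bscale, !ev_one_bmul, !ev_bconj.
  pose proof (exp_poly_weight k k m m ltac:(lra) (Nat.le_refl m) Hm1 HkX) as WA. fold A in WA.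
  assert (EQ1 : ev Q (fun _ _ => 1) = rsum isq l ^ m) by (unfold Q; rewrite ev_bpow_Pl; apply pw_one).
  rewrite EQ1. pose proof rsum_isq_ilist as HP.
  assert (WA0 : 0 <= ev A (fun _ _ => 1)) by (apply (good_nonneg _ _ _ _ GA); intros; lra).
  set (Y := Xi ^ 2) in *. assert (HY : 256 <= Y) by (unfold Y; simpl; nra).
  set (a1 := ev A (fun _ _ => 1)) in *. set (Z := Y ^ (m - 1)) in *.
  assert (EZ : Y ^ m = Y * Z) by (unfold Z; rewrite tech_pow_Rmult; f_equal; lia).
  assert (HZ : 0 < Z) by (apply pow_lt; lra).
  assert (T1 : (1 + eps) * (a1 * a1) <= 18 * Z ^ 2).
  { apply Rle_trans with (2 * (3 * Z * (3 * Z))); [|right; ring].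
    apply Rmult_le_compat; [lra|nra|lra|]. apply Rmult_le_compat; assumption. }
  assert (T2 : kap * (rsum isq l ^ m * rsum isq l ^ m) <= /2 * (Y ^ m) ^ 2).
  { apply Rle_trans with (2 ^ m * ((2 * Xi) ^ m * (2 * Xi) ^ m)).
    - apply Rmult_le_compat; [lra| | |].
      + apply Rmult_le_pos; apply pow_le; lra.
      + unfold kap. eapply Rle_trans; [|exact HkV].
        apply (Rmult_le_reg_r (V ^ (2 * m))); [apply pow_lt; lra|].
        unfold Rdiv. rewrite Rmult_assoc, Rinv_l, Rmult_1_r by (apply pow_nonzero; lra).
        rewrite <- (Rmult_1_r (exp _)) at 1. apply Rmult_le_compat_l; [left; apply exp_pos|].
        apply pow_R1_Rle. assumption.
      + apply Rmult_le_compat; try (apply pow_le; lra); apply pow_incr; lra.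
    - rewrite <- !Rpow_mult_distr.
      replace (2 * (2 * Xi * (2 * Xi))) with (8 * Y) by (unfold Y; ring).
      apply Rle_trans with ((/2 * (Y * Y)) ^ m).
      + apply pow_incr. nra.
      + rewrite Rpow_mult_distr. replace ((Y ^ m) ^ 2) with ((Y * Y) ^ m) by (rewrite Rpow_mult_distr; ring).
        apply Rmult_le_compat_r; [apply pow_le; nra|].
        replace m with (S (m - 1)) by lia. rewrite <- tech_pow_Rmult.
        assert ((/2) ^ (m - 1) <= 1) by (rewrite <- (pow1 (m - 1)); apply pow_incr; lra). lra. }
  rewrite EZ in *.
  assert (T3 : 18 * Z ^ 2 <= /2 * (Y * Z) ^ 2).
  { replace (/2 * (Y * Z) ^ 2) with (Y * Y / 2 * Z ^ 2) by field.
    apply Rmult_le_compat_r; [apply pow2_ge_0|nra]. }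
  lra.
Qed.
End Interval.

(** * The partial sum of zeta and off-diagonal terms *)

Fixpoint zpoly (M : nat) : bp :=
  match M with O => [] | S M' => zpoly M' ++ [(isq M, (M, 1%nat))] end.

Lemma in_zpoly (M : nat) (c : R) (a b : nat) :
  In (c, (a, b)) (zpoly M) <-> c = isq a /\ b = 1%nat /\ (1 <= a <= M)%nat.
Proof.
  induction M as [|M IH]; cbn [zpoly].
  - split; [intros []|lia].
  - rewrite in_app_iff, IH. cbn [In]. split.
    + intros [H|[H|[]]]; [intuition lia|]. injection H as <- <- <-. intuition lia.
    + intros [-> [-> H]]. destruct (Nat.eq_dec a (S M)) as [->|]; [right; left; reflexivity|].
      left. intuition lia.
Qed.

Lemma isq_nonneg (n : nat) : 0 <= isq n.
Proof.
  unfold isq. destruct (Rle_lt_or_eq_dec 0 (sqrt (INR n)) (sqrt_pos _)) as [H|H].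
  - left. apply Rinv_0_lt_compat, H.
  - rewrite <- H, Rinv_0. lra.
Qed.

Lemma good_zpoly (M : nat) : good (fun _ => True) (INR M) (zpoly M).
Proof.
  intros c a b Hin. apply in_zpoly in Hin. destruct Hin as [-> [-> H]].
  assert (supp (fun _ => True) a).
  { split; [|auto]. apply (ssrbool.introT ssrnat.leP). lia. }
  split; [apply isq_nonneg|]. split; [assumption|]. split; [apply supp_1|].
  split; apply le_INR; lia.
Qed.

Lemma val_zpoly (M : nat) (t : R) : val (zpoly M) t = csum (fun i => cpw (INR (S i)) (/2, t)) M.
Proof.
  induction M as [|M IH]; [reflexivity|].
  cbn [zpoly]. rewrite val_app, IH, csum_S. f_equal.
  assert (HM : 0 < INR (S M)) by (apply lt_0_INR; lia).
  unfold val, cpw, Cexp, Re, Im. cbn [ev]. cbn [fst snd Cmult Copp RtoC].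
  set (x := ln (INR (S M))).
  assert (E : exp (x * - /2 - 0 * - t) = isq (S M)).
  { unfold isq. rewrite <- sqrt_inv. replace (x * - /2 - 0 * - t) with (- x * / 2) by ring.
    unfold x. rewrite <- ln_Rinv by assumption.
    rewrite <- Rpower_sqrt by (apply Rinv_0_lt_compat; assumption).
    unfold Rpower. f_equal. ring. }
  rewrite E. simpl (INR 1). rewrite ln_1.
  replace (x * - t + 0 * - / 2) with (t * (0 - x)) by ring. f_equal; ring.
Qed.

Lemma ev_zpoly_ge (M n : nat) (psi : nat -> nat -> R) : (1 <= n <= M)%nat ->
  (forall a b, 0 <= psi a b) -> isq n * psi n 1%nat <= ev (zpoly M) psi.
Proof.
  intros Hn Hpsi. induction M as [|M IH]; [lia|]. cbn [zpoly]. rewrite ev_app. cbn [ev].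
  pose proof (Rmult_le_pos _ _ (isq_nonneg (S M)) (Hpsi (S M) 1%nat)).
  destruct (Nat.eq_dec n (S M)) as [->|].
  - assert (0 <= ev (zpoly M) psi) by (apply (good_nonneg _ _ _ _ (good_zpoly M)), Hpsi). lra.
  - specialize (IH ltac:(lia)). lra.
Qed.

Lemma ev_zpoly_one (M : nat) : ev (zpoly M) (fun _ _ => 1) <= 2 * sqrt (INR M).
Proof.
  induction M as [|M IH]; [simpl; rewrite sqrt_0; lra|].
  cbn [zpoly]. rewrite ev_app. cbn [ev].
  assert (isq (S M) <= 2 * (sqrt (INR (S M)) - sqrt (INR M))); [|lra].
  set (u := sqrt (INR (S M))). set (v := sqrt (INR M)).
  assert (Hu : 0 < u) by (apply sqrt_lt_R0, lt_0_INR; lia).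
  assert (Hv : 0 <= v) by apply sqrt_pos.
  assert (Eu : u * u = INR M + 1) by (unfold u; rewrite sqrt_sqrt by apply pos_INR; apply S_INR).
  assert (Ev : v * v = INR M) by (unfold v; apply sqrt_sqrt, pos_INR).
  unfold isq. fold u. apply (Rmult_le_reg_r u); [assumption|]. rewrite Rinv_l by lra. nra.
Qed.

(** If a divides b, the quotient n = b/a is at most N <= M, so the partial sum contains n^(-1/2-it),
    which completes (a, b) to a diagonal term. *)
Lemma ev_zpoly_bmul (U : nat -> Prop) (N : R) (M : nat) (G : bp) :
  good U N G -> N <= INR M -> ev G dvd_weight <= ev (bmul (zpoly M) G) diag.
Proof.
  intros HG HM. rewrite ev_bmul, ev_swap. apply ev_le. intros c a b Hin.
  destruct (HG _ _ _ Hin) as [Hc [[Ha _] [[Hb _] [_ HbN]]]].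
  split; [assumption|].
  destruct (good_ge1 _ _ _ _ _ _ HG Hin) as [Ha1 Hb1].
  unfold dvd_weight. destruct (div.dvdn a b) eqn:E.
  - destruct (dvdn_eq a b Ha E) as [n En].
    assert (Hn : (1 <= n)%nat).
    { destruct n; [|lia]. simpl in En. subst b. simpl in Hb1. lra. }
    assert (HnM : (n <= M)%nat).
    { apply INR_le. apply Rle_trans with (INR b); [|lra].
      apply le_INR. rewrite <- En. apply leq_1_le in Ha. nia. }
    eapply Rle_trans; [|apply (ev_zpoly_ge M n); [lia|intros; apply diag_pos]].
    unfold diag. rewrite En, Nat.mul_1_l, Nat.eqb_refl, Rmult_1_r.
    unfold isq. rewrite <- sqrt_inv. right. f_equal. rewrite <- En, mult_INR.
    assert (1 <= INR n) by (apply (le_INR 1); assumption). field. lra.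
  - apply (good_nonneg _ _ _ _ (good_zpoly M)). intros. apply diag_pos.
Qed.

(** A bound for one of the two numbers suffices: if a > b, the gap is at least ln ((b+1)/b). This
    matters for zeta, where multiplication by [zpoly] makes a as long as M N while b stays below N,
    so the long partial sum does not narrow the gap. *)
Lemma ln_gap (a b : nat) (N : R) : (1 <= a)%nat -> (1 <= b)%nat -> INR b <= N -> a <> b ->
  / (2 * N) <= Rabs (ln (INR b) - ln (INR a)).
Proof.
  intros Ha Hb HN Hab.
  assert (HA : 1 <= INR a) by (apply (le_INR 1); assumption).
  assert (HB : 1 <= INR b) by (apply (le_INR 1); assumption).
  assert (L : forall x y, 1 <= x -> 1 <= y -> 1 - x / y <= ln y - ln x).
  { intros x y Hx Hy. rewrite <- ln_div by lra.
    pose proof (exp_ineq1_le (ln (x / y))) as E.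
    rewrite exp_ln in E by (apply Rdiv_lt_0_compat; lra).
    rewrite !ln_div in * by lra. lra. }
  assert (0 < / (2 * N)) by (apply Rinv_0_lt_compat; lra).
  destruct (Nat.lt_total a b) as [H0|[H0|H0]]; [|contradiction|].
  - assert (Hlt : INR a + 1 <= INR b) by (rewrite <- S_INR; apply le_INR; lia).
    specialize (L (INR a) (INR b) HA HB).
    assert (/ (2 * N) <= 1 - INR a / INR b).
    { apply Rle_trans with (/ INR b); [apply Rinv_le_contravar; lra|].
      apply (Rmult_le_reg_r (INR b)); [lra|]. rewrite Rinv_l by lra.
      replace ((1 - INR a / INR b) * INR b) with (INR b - INR a) by (field; lra). lra. }
    rewrite Rabs_right; lra.
  - assert (Hlt : INR b + 1 <= INR a) by (rewrite <- S_INR; apply le_INR; lia).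
    specialize (L (INR b) (INR a) HB HA).
    assert (/ (2 * N) <= 1 - INR b / INR a).
    { apply Rle_trans with (/ (INR b + 1)); [apply Rinv_le_contravar; lra|].
      apply (Rmult_le_reg_r (INR a * (INR b + 1))); [nra|].
      replace (/ (INR b + 1) * (INR a * (INR b + 1))) with (INR a) by (field; lra).
      replace ((1 - INR b / INR a) * (INR a * (INR b + 1))) with ((INR a - INR b) * (INR b + 1)) by (field; lra).
      nra. }
    rewrite Rabs_left; lra.
Qed.

Lemma mean_value_good (U : nat -> Prop) (N T1 T2 : R) (F : bp) :
  good U N F -> 0 < N -> T1 <= T2 ->
  Rabs (RInt (fun t => Re (val F t)) T1 T2 - (T2 - T1) * ev F diag) <= 4 * N * ev F (fun _ _ => 1).
Proof.
  intros HF HN HT.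
  replace (4 * N) with (2 / (/ (2 * N))) by (field; lra).
  apply mean_value; [assumption|apply Rinv_0_lt_compat; lra|].
  intros c a b Hin. destruct (HF _ _ _ Hin) as [Hc [[Ha _] [[Hb _] [_ HbN]]]].
  split; [assumption|]. apply ln_gap; auto using leq_1_le.
Qed.

(** * Continuity on the critical line *)

Lemma continuous_of_eps (f : R -> R) (x : R) :
  (forall eps, 0 < eps -> exists d, 0 < d /\ forall y, Rabs (y - x) < d -> Rabs (f y - f x) < eps) ->
  continuous f x.
Proof.
  intros H. apply continuity_pt_filterlim. intros eps He.
  destruct (H eps He) as [d [Hd Hy]]. exists d. split; [exact Hd|].
  intros y [_ Hxy]. apply Hy. exact Hxy.
Qed.

Lemma continuous_rpow (y x : R) : 0 < y -> continuous (fun x => rpow x y) x.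
Proof.
  intros Hy. destruct (Rtotal_order x 0) as [H|[H|H]].
  - apply continuous_of_eps. intros eps He. exists (- x). split; [lra|]. intros z Hz.
    apply Rabs_def2 in Hz. unfold rpow. destruct (Rlt_dec 0 z); [lra|]. destruct (Rlt_dec 0 x); [lra|].
    rewrite Rminus_0_r, Rabs_R0. assumption.
  - subst x. apply continuous_of_eps. intros eps He.
    exists (Rpower eps (/ y)). split; [apply exp_pos|]. intros z Hz.
    rewrite Rminus_0_r in Hz. unfold rpow. destruct (Rlt_dec 0 0); [lra|]. rewrite Rminus_0_r.
    destruct (Rlt_dec 0 z) as [Hz0|]; [|rewrite Rabs_R0; assumption].
    rewrite Rabs_right in * by (try (apply Rle_ge; left; apply exp_pos); lra).
    apply Rlt_le_trans with (Rpower (Rpower eps (/ y)) y).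
    + apply Rlt_Rpower_l; [assumption|split; assumption].
    + rewrite Rpower_mult, Rinv_l, Rpower_1 by lra. lra.
  - apply (continuous_ext_loc _ (fun x => exp (y * ln x))).
    + exists (mkposreal x H). intros z Hz. change (Rabs (z - x) < x) in Hz.
      apply Rabs_def2 in Hz. unfold rpow. destruct (Rlt_dec 0 z); [reflexivity|lra].
    + apply (continuous_comp (fun x => y * ln x) exp); [|apply continuous_exp].
      apply (continuous_scal_r (K := R_AbsRing) (V := R_NormedModule) y ln).
      apply continuous_ln. exact H.
Qed.

Lemma zeta_line_continuous (zeta : C -> C) (t : R) : is_riemann_zeta zeta ->
  forall eps, 0 < eps -> exists d, 0 < d /\ forall u, Rabs (u - t) < d ->
    Cmod (Cminus (zeta (/2, u)) (zeta (/2, t))) < eps.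
Proof.
  intros [_ Han] eps He.
  destruct (analytic_at_continuous zeta (/2, t)) with (eps := eps) as [d [Hd H]]; [|assumption|].
  - apply Han. unfold RtoC. intros E. injection E as E _. lra.
  - exists d. split; [assumption|]. intros u Hu. apply H.
    replace (Cminus (/2, u) (/2, t)) with (Cmult Ci (RtoC (u - t))).
    + rewrite Cmod_mult, Cmod_Ci, Cmod_R. lra.
    + unfold Cmult, Cminus, Cplus, Copp, Ci, RtoC; simpl. f_equal; ring.
Qed.

Section ZetaCont.
Variables (zeta : C -> C) (Hz : is_riemann_zeta zeta).

Lemma continuous_Cmod_zeta (t : R) : continuous (fun t => Cmod (zeta (/2, t))) t.
Proof.
  apply continuous_of_eps. intros eps He.
  destruct (zeta_line_continuous zeta t Hz eps He) as [d [Hd H]].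
  exists d. split; [assumption|]. intros u Hu. specialize (H u Hu).
  set (a := zeta (/2, u)) in *. set (b := zeta (/2, t)) in *.
  assert (Cmod a <= Cmod (Cminus a b) + Cmod b).
  { eapply Rle_trans; [|apply Cmod_triangle]. right. f_equal. ring. }
  assert (Cmod b <= Cmod (Cminus a b) + Cmod a).
  { rewrite <- (Cmod_opp (Cminus a b)). eapply Rle_trans; [|apply Cmod_triangle]. right. f_equal. ring. }
  change (Rabs (Cmod a - Cmod b) < eps). apply Rabs_def1; lra.
Qed.

Lemma continuous_Re_zeta (t : R) : continuous (fun t => Re (zeta (/2, t))) t.
Proof.
  apply continuous_of_eps. intros eps He.
  destruct (zeta_line_continuous zeta t Hz eps He) as [d [Hd H]].
  exists d. split; [assumption|]. intros u Hu. eapply Rle_lt_trans; [|apply (H u Hu)].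
  eapply Rle_trans; [|apply re_le_Cmod]. right. unfold Re; simpl. reflexivity.
Qed.

Lemma continuous_Im_zeta (t : R) : continuous (fun t => Im (zeta (/2, t))) t.
Proof.
  apply continuous_of_eps. intros eps He.
  destruct (zeta_line_continuous zeta t Hz eps He) as [d [Hd H]].
  exists d. split; [assumption|]. intros u Hu. eapply Rle_lt_trans; [|apply (H u Hu)].
  eapply Rle_trans; [|apply Rmax_Cmod]. eapply Rle_trans; [|apply Rmax_r].
  right. unfold Im; simpl. reflexivity.
Qed.

Lemma continuous_moment (k t : R) : 0 < k ->
  continuous (fun t => rpow (Cmod (zeta (/2, t))) (2 * k)) t.
Proof.
  intros Hk. apply (continuous_comp (fun t => Cmod (zeta (/2, t))) (fun x => rpow x (2 * k))).
  - apply continuous_Cmod_zeta.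
  - apply continuous_rpow. lra.
Qed.

Lemma continuous_Re_val (F : bp) (t : R) : continuous (fun t => Re (val F t)) t.
Proof. unfold val, Re; simpl. apply continuous_ev. apply continuous_cos. Qed.

Lemma continuous_Im_val (F : bp) (t : R) : continuous (fun t => Im (val F t)) t.
Proof. unfold val, Im; simpl. apply continuous_ev. apply continuous_sin. Qed.

Lemma continuous_twist (G : bp) (t : R) :
  continuous (fun t => Re (Cmult (zeta (/2, t)) (val G t))) t.
Proof.
  apply (continuous_ext (fun t => Re (zeta (/2, t)) * Re (val G t) - Im (zeta (/2, t)) * Im (val G t))).
  - intros x. reflexivity.
  - apply (continuous_minus (V := R_NormedModule));
      apply (continuous_mult (K := R_AbsRing));
      auto using continuous_Re_zeta, continuous_Im_zeta, continuous_Re_val, continuous_Im_val.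
Qed.

Lemma ex_RInt_cont (f : R -> R) (a b : R) : (forall t, continuous f t) -> ex_RInt f a b.
Proof. intros H. apply (ex_RInt_continuous (V := R_CompleteNormedModule)). auto. Qed.

Lemma is_RInt_of_cont (f : R -> R) (a b : R) :
  (forall t, continuous f t) -> is_RInt f a b (RInt f a b).
Proof.
  intros H. apply (RInt_correct (V := R_CompleteNormedModule)). apply ex_RInt_cont, H.
Qed.

(** * Hoelder's inequality and the bound for the moment *)

(** Convexity of exp: each exponential lies above the tangent at the weighted mean [s], and the
    linear parts cancel. *)
Lemma weighted_am_gm (al be ga a b c : R) : 0 <= al -> 0 <= be -> 0 <= ga -> al + be + ga = 1 ->
  exp (al * a + be * b + ga * c) <= al * exp a + be * exp b + ga * exp c.
Proof.
  intros Ha Hb Hc E. set (s := al * a + be * b + ga * c).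
  assert (T : forall x, exp s * (1 + (x - s)) <= exp x).
  { intros x. replace x with (s + (x - s)) at 2 by ring. rewrite exp_plus.
    apply Rmult_le_compat_l; [left; apply exp_pos|apply exp_ineq1_le]. }
  pose proof (Rmult_le_compat_l _ _ _ Ha (T a)). pose proof (Rmult_le_compat_l _ _ _ Hb (T b)).
  pose proof (Rmult_le_compat_l _ _ _ Hc (T c)).
  assert (Es : al * (exp s * (1 + (a - s))) + be * (exp s * (1 + (b - s))) + ga * (exp s * (1 + (c - s)))
    = exp s * ((al + be + ga) + (s - (al + be + ga) * s))) by (unfold s; ring).
  rewrite E in Es. replace (exp s * (1 + (s - 1 * s))) with (exp s) in Es by ring. lra.
Qed.

(** The pointwise form of Hoelder's inequality with exponents 2k, 2 and 2k/(k-1), which only has to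
    be integrated. [Lu] is chosen so that Lu/(2k) + Lv/2 + (k-1) Lw/(2k) = Lg; it is the lower bound
    for the logarithm of the mean of |zeta|^2k that the argument yields. *)
Lemma young3 (k x y z Lg Lv Lw : R) : 1 < k -> 0 <= x -> 0 <= y -> 0 <= z ->
  let Lu := 2 * k * Lg - k * Lv - (k - 1) * Lw in
  x * y * z <= exp Lg * (rpow x (2 * k) * (exp (- Lu) / (2 * k)) + y ^ 2 * (exp (- Lv) / 2)
     + rpow z (2 * k / (k - 1)) * (exp (- Lw) * ((k - 1) / (2 * k)))).
Proof.
  intros Hk Hx Hy Hz' Lu.
  assert (R0 : 0 <= exp Lg * (rpow x (2 * k) * (exp (- Lu) / (2 * k)) + y ^ 2 * (exp (- Lv) / 2)
     + rpow z (2 * k / (k - 1)) * (exp (- Lw) * ((k - 1) / (2 * k))))).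
  { apply Rmult_le_pos; [left; apply exp_pos|]. repeat apply Rplus_le_le_0_compat.
    - apply Rmult_le_pos; [apply rpow_pos|]. apply Rdiv_le_0_compat; [left; apply exp_pos|lra].
    - apply Rmult_le_pos; [apply pow2_ge_0|]. apply Rdiv_le_0_compat; [left; apply exp_pos|lra].
    - apply Rmult_le_pos; [apply rpow_pos|]. apply Rmult_le_pos; [left; apply exp_pos|].
      apply Rdiv_le_0_compat; lra. }
  destruct (Req_dec x 0) as [->|Nx]; [rewrite !Rmult_0_l; exact R0|].
  destruct (Req_dec y 0) as [->|Ny]; [rewrite Rmult_0_r, Rmult_0_l; exact R0|].
  destruct (Req_dec z 0) as [->|Nz]; [rewrite Rmult_0_r; exact R0|].
  unfold rpow. destruct (Rlt_dec 0 x) as [Px|]; [|lra]. destruct (Rlt_dec 0 z) as [Pz|]; [|lra].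
  assert (Py : 0 < y) by lra. clear R0.
  set (a := ln x). set (b := ln y). set (c := ln z).
  replace (x * y * z) with (exp Lg * exp (a + b + c - Lg)).
  2: { rewrite <- exp_plus. replace (Lg + (a + b + c - Lg)) with (a + b + c) by ring.
       rewrite !exp_plus. unfold a, b, c. rewrite !exp_ln by assumption. ring. }
  apply Rmult_le_compat_l; [left; apply exp_pos|].
  pose proof (weighted_am_gm (/ (2 * k)) (/2) ((k - 1) / (2 * k))
    (2 * k * a - Lu) (2 * b - Lv) (2 * k / (k - 1) * c - Lw)) as H.
  replace (/ (2 * k) * (2 * k * a - Lu) + / 2 * (2 * b - Lv) + (k - 1) / (2 * k) * (2 * k / (k - 1) * c - Lw))
    with (a + b + c - Lg) in H by (unfold Lu; field; lra).
  eapply Rle_trans; [apply H|].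
  - left. apply Rinv_0_lt_compat. lra.
  - lra.
  - apply Rdiv_le_0_compat; lra.
  - field. lra.
  - unfold Rpower. fold a c. unfold Rminus. rewrite !exp_plus.
    replace (exp (2 * b)) with (y ^ 2).
    2: { unfold b. replace (2 * ln y) with (ln y + ln y) by ring. rewrite exp_plus, exp_ln by assumption. ring. }
    right. field. lra.
Qed.

(** The two error conditions make the off-diagonal terms and the approximation error of zeta small
    against T. Since each diagonal mean has a bound of at least 1, this changes it by at most a
    factor 2, whence the shifts by ln 2. *)
Lemma moment_from_resonator (k : R) (lo hi : nat) (N W lv lw lg T ez : R) (M : nat) :
  1 < k -> resonator k lo hi N W lv lw lg -> 0 <= lv -> 0 <= lw -> 0 <= lg -> 0 < T -> 1 <= N ->
  1 <= W -> N ^ 2 <= INR M ->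
  (forall t, T / 2 <= t <= T ->
     Cmod (Cminus (zeta (/2, t)) (csum (fun i => cpw (INR (S i)) (/2, t)) M)) <= ez) ->
  64 * N ^ 2 * W ^ 2 * sqrt (INR M) <= T -> ez * W ^ 2 <= /4 ->
  T / 2 * exp (2 * k * (lg - ln 2) - k * (lv + ln 2) - (k - 1) * (lw + ln 2))
    <= zeta_moment zeta k T.
Proof.
  intros Hk [A [B [f [GA [GB [Gf [Hf [HA [Hw [Hg [WA [WB Wf]]]]]]]]]]]] Hlv Hlw Hlg HT HN HW HM Hez Herr Hez2.
  assert (HN2 : 1 <= N ^ 2) by (apply pow_R1_Rle, HN).
  assert (HW2 : 1 <= W ^ 2) by (apply pow_R1_Rle, HW).
  assert (HM1 : 1 <= sqrt (INR M)).
  { rewrite <- sqrt_1. apply sqrt_le_1_alt. lra. }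
  assert (Herr2 : 8 * (N ^ 2 * W ^ 2) <= T).
  { assert (1 <= N ^ 2 * W ^ 2) by nra. nra. }
  set (U := in_range lo hi) in *.
  set (AA := bmul A (bconj A)). set (G := bmul B (bconj A)).
  assert (GAA : good U (N ^ 2) AA).
  { replace (N ^ 2) with (N * N) by ring. apply good_bmul; [|apply good_bconj]; assumption. }
  assert (GG : good U (N ^ 2) G).
  { replace (N ^ 2) with (N * N) by ring. apply good_bmul; [|apply good_bconj]; assumption. }
  assert (PA : 0 <= ev A (fun _ _ => 1)) by (apply (good_nonneg _ _ _ _ GA); intros; lra).
  assert (PB : 0 <= ev B (fun _ _ => 1)) by (apply (good_nonneg _ _ _ _ GB); intros; lra).
  assert (Pf : 0 <= ev f (fun _ _ => 1)) by (apply (good_nonneg _ _ _ _ Gf); intros; lra).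
  assert (WAA : 0 <= ev AA (fun _ _ => 1) <= W ^ 2).
  { unfold AA. rewrite ev_one_bmul, ev_bconj. split; [apply Rmult_le_pos; assumption|].
    simpl. rewrite Rmult_1_r. apply Rmult_le_compat; assumption. }
  assert (WG : 0 <= ev G (fun _ _ => 1) <= W ^ 2).
  { unfold G. rewrite ev_one_bmul, ev_bconj. split; [apply Rmult_le_pos; assumption|].
    simpl. rewrite Rmult_1_r. apply Rmult_le_compat; assumption. }
  assert (E2 : exp (ln 2) = 2) by (apply exp_ln; lra).
  assert (IA : RInt (fun t => Re (val AA t)) (T / 2) T <= T / 2 * exp (lv + ln 2)).
  { pose proof (mean_value_good U (N ^ 2) (T / 2) T AA GAA ltac:(lra) ltac:(lra)) as H.
    apply Rabs_le_between in H. rewrite exp_plus, E2. fold AA in HA.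
    assert (1 <= exp lv) by (rewrite <- exp_0; apply exp_le_exp; assumption).
    assert (4 * N ^ 2 * ev AA (fun _ _ => 1) <= 4 * N ^ 2 * W ^ 2) by (apply Rmult_le_compat_l; lra).
    nra. }
  assert (If : RInt (fun t => Re (val f t)) (T / 2) T <= T / 2 * exp (lw + ln 2)).
  { pose proof (mean_value_good U (N ^ 2) (T / 2) T f Gf ltac:(lra) ltac:(lra)) as H.
    apply Rabs_le_between in H. rewrite exp_plus, E2.
    assert (1 <= exp lw) by (rewrite <- exp_0; apply exp_le_exp; assumption).
    assert (4 * N ^ 2 * ev f (fun _ _ => 1) <= 4 * N ^ 2 * W ^ 2) by (apply Rmult_le_compat_l; lra).
    nra. }
  assert (IG : T / 2 * exp (lg - ln 2) <= RInt (fun t => Re (Cmult (zeta (/2, t)) (val G t))) (T / 2) T).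
  { assert (G1 : good (fun _ => True) (N ^ 2) G) by (apply (good_weaken U _ (N ^ 2)); auto; lra).
    set (ZG := bmul (zpoly M) G).
    assert (Hin : forall c a b, In (c, (a, b)) ZG -> 0 <= c /\ (a <> b -> / (2 * N ^ 2) <= Rabs (ln (INR b) - ln (INR a)))).
    { intros c a b Hin. unfold ZG in Hin.
      destruct (in_bmul _ _ _ _ _ Hin) as [c1 [a1 [b1 [c2 [a2 [b2 [H1 [H2 [-> [-> ->]]]]]]]]]].
      destruct (good_zpoly M _ _ _ H1) as [Hc1 [[Ha1 _] _]].
      apply in_zpoly in H1. destruct H1 as [_ [-> Hb1]].
      destruct (GG _ _ _ H2) as [Hc2 [[Ha2 _] [[Hb2 _] [_ HbN]]]].
      apply leq_1_le in Ha2, Hb2.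
      split; [apply Rmult_le_pos; assumption|]. intros Hne. apply ln_gap; [nia|lia| |assumption].
      rewrite Nat.mul_1_l. assumption. }
    pose proof (mean_value ZG (T / 2) T (/ (2 * N ^ 2)) ltac:(lra)
      ltac:(apply Rinv_0_lt_compat; lra) Hin) as H.
    apply Rabs_le_between in H. destruct H as [H _].
    replace (2 / / (2 * N ^ 2)) with (4 * N ^ 2) in H by (field; lra).
    pose proof (ev_zpoly_bmul U (N ^ 2) M G GG HM) as Hd. fold ZG in Hd. fold G in Hg.
    (* The off-diagonal terms cost T/8, and so does the error 1/4 in the integrand over a length
       T/2; of the main term T/2 exp lg, at least half remains. *)
    assert (W3 : 4 * N ^ 2 * ev ZG (fun _ _ => 1) <= T / 8).
    { unfold ZG. rewrite ev_one_bmul.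
      pose proof (ev_zpoly_one M) as HZ.
      assert (0 <= ev (zpoly M) (fun _ _ => 1)) by (apply (good_nonneg _ _ _ _ (good_zpoly M)); intros; lra).
      apply Rle_trans with (4 * N ^ 2 * (2 * sqrt (INR M) * W ^ 2)).
      - apply Rmult_le_compat_l; [lra|]. apply Rmult_le_compat; lra.
      - lra. }
    assert (Elg : exp (lg - ln 2) = exp lg / 2).
    { unfold Rminus. rewrite exp_plus, exp_Ropp, E2. reflexivity. }
    assert (1 <= exp lg) by (rewrite <- exp_0; apply exp_le_exp; assumption).
    apply Rle_trans with (RInt (fun t => Re (val ZG t) + - /4) (T / 2) T).
    - assert (EI : is_RInt (fun t => Re (val ZG t) + - /4) (T / 2) T
        (RInt (fun t => Re (val ZG t)) (T / 2) T + (T - T / 2) * (- /4))).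
      { apply (is_RInt_plus (V := R_NormedModule)).
        - apply is_RInt_of_cont. apply continuous_Re_val.
        - apply is_RInt_cst. reflexivity. }
      rewrite (is_RInt_unique _ _ _ _ EI). rewrite Elg. nra.
    - apply RInt_le; [lra| | |].
      + apply ex_RInt_cont. intros t. apply (continuous_plus (V := R_NormedModule));
          [apply continuous_Re_val|apply continuous_const].
      + apply ex_RInt_cont. apply continuous_twist.
      + intros t Ht. unfold ZG.
        rewrite (val_bmul (fun _ => True) (INR M) (N ^ 2)) by (assumption || apply good_zpoly).
        rewrite val_zpoly. specialize (Hez t ltac:(lra)).
        set (Zt := csum _ M) in *. set (zt := zeta (/2, t)) in *.
        assert (Hd2 : Cmod (Cmult (Cminus zt Zt) (val G t)) <= /4).
        { rewrite Cmod_mult. eapply Rle_trans; [|exact Hez2].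
          pose proof (Cmod_val_le U (N ^ 2) G t GG).
          apply Rmult_le_compat; try apply Cmod_ge_0; [assumption|]. lra. }
        pose proof (re_le_Cmod (Cmult (Cminus zt Zt) (val G t))) as Hre.
        apply Rabs_le_between in Hre.
        replace (Cmult zt (val G t)) with (Cplus (Cmult Zt (val G t)) (Cmult (Cminus zt Zt) (val G t))) by ring.
        unfold Re in *. cbn [Cplus fst]. lra. }
  set (Lg := lg - ln 2) in *. set (Lv := lv + ln 2) in *. set (Lw := lw + ln 2) in *.
  set (Lu := 2 * k * Lg - k * Lv - (k - 1) * Lw).
  set (Iz := RInt (fun t => rpow (Cmod (zeta (/2, t))) (2 * k)) (T / 2) T).
  assert (Hmom : Iz <= zeta_moment zeta k T).
  { unfold zeta_moment.
    rewrite (RInt_ext _ (fun t => rpow (Cmod (zeta (/2, t))) (2 * k)))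
      by (intros x _; replace (1 / 2) with (/2) by field; reflexivity).
    assert (Ex : forall a b, ex_RInt (fun t => rpow (Cmod (zeta (/2, t))) (2 * k)) a b).
    { intros a b. apply ex_RInt_cont. intros t. apply continuous_moment. lra. }
    rewrite <- (RInt_Chasles _ 0 (T / 2) T) by apply Ex. fold Iz.
    assert (0 <= RInt (fun t => rpow (Cmod (zeta (/2, t))) (2 * k)) 0 (T / 2)).
    { apply RInt_ge_0; [lra|apply Ex|]. intros x _. apply rpow_pos. }
    unfold plus; simpl. lra. }
  eapply Rle_trans; [|exact Hmom].
  set (c1 := exp (- Lu) / (2 * k)). set (c2 := exp (- Lv) / 2).
  set (c3 := exp (- Lw) * ((k - 1) / (2 * k))).
  assert (Hc1 : 0 < c1) by (apply Rdiv_lt_0_compat; [apply exp_pos|lra]).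
  assert (Hc2 : 0 < c2) by (apply Rdiv_lt_0_compat; [apply exp_pos|lra]).
  assert (Hc3 : 0 < c3) by (apply Rmult_lt_0_compat; [apply exp_pos|apply Rdiv_lt_0_compat; lra]).
  assert (Hup : RInt (fun t => Re (Cmult (zeta (/2, t)) (val G t))) (T / 2) T
     <= exp Lg * (c1 * Iz + c2 * RInt (fun t => Re (val AA t)) (T / 2) T
          + c3 * RInt (fun t => Re (val f t)) (T / 2) T)).
  { set (h := fun t => exp Lg * (c1 * rpow (Cmod (zeta (/2, t))) (2 * k)
       + c2 * Re (val AA t) + c3 * Re (val f t))).
    assert (Ih : is_RInt h (T / 2) T (exp Lg * (c1 * Iz + c2 * RInt (fun t => Re (val AA t)) (T / 2) T
          + c3 * RInt (fun t => Re (val f t)) (T / 2) T))).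
    { unfold h. apply (is_RInt_scal (V := R_NormedModule)).
      apply (is_RInt_plus (V := R_NormedModule)); [apply (is_RInt_plus (V := R_NormedModule))|];
        apply (is_RInt_scal (V := R_NormedModule)); apply is_RInt_of_cont;
        [intros t; apply continuous_moment; lra|apply continuous_Re_val|apply continuous_Re_val]. }
    rewrite <- (is_RInt_unique _ _ _ _ Ih). apply RInt_le; [lra| |eexists; exact Ih|].
    - apply ex_RInt_cont. apply continuous_twist.
    - intros t _. unfold h.
      assert (EG : val G t = Cmult (val B t) (Cconj (val A t))).
      { unfold G. rewrite (val_bmul U N N B (bconj A)) by (assumption || apply good_bconj, GA).
        rewrite val_bconj. reflexivity. }
      assert (EA : Re (val AA t) = Cmod (val A t) ^ 2).
      { unfold AA. rewrite (val_bmul U N N A (bconj A)) by (assumption || apply good_bconj, GA).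
        rewrite val_bconj, <- Cmod2_conj. reflexivity. }
      rewrite EA, EG. destruct (Hf t) as [Hft _].
      eapply Rle_trans; [eapply Rle_trans; [apply Rle_abs|apply re_le_Cmod]|].
      rewrite !Cmod_mult, Cmod_conj.
      pose proof (young3 k (Cmod (zeta (/2, t))) (Cmod (val A t)) (Cmod (val B t)) Lg Lv Lw Hk
        (Cmod_ge_0 _) (Cmod_ge_0 _) (Cmod_ge_0 _)) as Y. cbv zeta in Y. fold Lu c1 c2 c3 in Y.
      replace (Cmod (zeta (/2, t)) * (Cmod (val B t) * Cmod (val A t)))
        with (Cmod (zeta (/2, t)) * Cmod (val A t) * Cmod (val B t)) by ring.
      eapply Rle_trans; [exact Y|]. apply Rmult_le_compat_l; [left; apply exp_pos|].
      rewrite (Rmult_comm c1), (Rmult_comm c2). apply Rplus_le_compat_l.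
      rewrite Rmult_comm. apply Rmult_le_compat_l; lra. }
  assert (F : T / 2 * exp Lg <= exp Lg * (c1 * Iz + c2 * (T / 2 * exp Lv) + c3 * (T / 2 * exp Lw))).
  { eapply Rle_trans; [exact IG|]. eapply Rle_trans; [exact Hup|].
    apply Rmult_le_compat_l; [left; apply exp_pos|].
    repeat apply Rplus_le_compat; [lra| |]; apply Rmult_le_compat_l; lra. }
  rewrite Rmult_comm in F. apply Rmult_le_reg_l in F; [|apply exp_pos].
  (* After normalization the terms of A and B take the shares 1/2 and (k-1)/(2k) of T/2, so the
     share 1/(2k) is left for zeta. *)
  assert (X2 : c2 * (T / 2 * exp Lv) = T / 4).
  { unfold c2. rewrite exp_Ropp. field. apply Rgt_not_eq, exp_pos. }
  assert (X3 : c3 * (T / 2 * exp Lw) = T / 2 * ((k - 1) / (2 * k))).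
  { unfold c3. rewrite exp_Ropp. field. split; [lra|apply Rgt_not_eq, exp_pos]. }
  rewrite X2, X3 in F.
  replace (2 * k * Lg - k * Lv - (k - 1) * Lw) with Lu by reflexivity.
  assert (F2 : T / 2 * / (2 * k) <= c1 * Iz).
  { replace (T / 2 * ((k - 1) / (2 * k))) with (T / 4 - T / 2 * / (2 * k)) in F by (field; lra). lra. }
  apply (Rmult_le_compat_l (2 * k * exp Lu)) in F2.
  - replace (2 * k * exp Lu * (T / 2 * / (2 * k))) with (T / 2 * exp Lu) in F2 by (field; lra).
    assert (Ez : forall I : R, 2 * k * exp Lu * (c1 * I) = I).
    { intros I. unfold c1. rewrite exp_Ropp. field. split; [apply Rgt_not_eq, exp_pos|lra]. }
    rewrite Ez in F2. exact F2.
  - apply Rmult_le_pos; [lra|left; apply exp_pos].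
Qed.
End ZetaCont.

(** * Choice of parameters *)

Lemma dexp2_mono (i j : nat) : (i <= j)%nat -> (dexp2 i <= dexp2 j)%nat.
Proof. intros H. apply pow2_mono, pow2_mono, H. Qed.

Lemma ln_dexp2 (i : nat) : ln (INR (dexp2 i)) = 2 ^ i * ln 2.
Proof.
  unfold dexp2. rewrite pow_INR. simpl (INR 2). replace (1 + 1) with 2 by ring.
  rewrite ln_pow by lra. rewrite pow_INR. simpl (INR 2). replace (1 + 1) with 2 by ring. reflexivity.
Qed.

Lemma dexp2_bracket (T : R) : 2 <= T -> exists L, INR (dexp2 L) <= T < INR (dexp2 (S L)).
Proof.
  intros HT.
  assert (exists K, T < INR (dexp2 K)) as [K HK].
  { destruct (nfloor_ex T ltac:(lra)) as [K [_ HK]]. exists (S K).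
    eapply Rlt_le_trans; [exact HK|].
    eapply Rle_trans; [|apply dexp2_ge; lia]. rewrite <- S_INR.
    eapply Rle_trans; [apply pow2_ge_INR|]. apply pow_incr. lra. }
  induction K as [|K IH]; [unfold dexp2 in HK; simpl in HK; lra|].
  destruct (Rlt_le_dec T (INR (dexp2 K))) as [H|H]; [auto|]. exists K. split; assumption.
Qed.

(** As [dexp2 0 = 2], only the prime 2 precedes the ranges, each of which contributes at most 2. *)
Lemma rsum_pint_dexp2 (i : nat) : rsum rinv (pint 1 (dexp2 i)) <= 1/2 + 2 * INR i.
Proof.
  induction i as [|i IH].
  - unfold dexp2, pint. simpl. destruct (prime.prime 2); simpl; unfold rinv; simpl; lra.
  - rewrite (pint_app 1 (dexp2 i) (dexp2 (S i))).
    + rewrite rsum_app, S_INR. fold (ilist i). pose proof (rsum_ilist i). lra.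
    + split; [|apply dexp2_mono; lia]. unfold dexp2. pose proof (Nat.pow_nonzero 2 (2 ^ i)). lia.
Qed.

(* [hseries n] is the tail [sum_{j > n} j^2 / 2^j]. *)
Definition hseries (n : nat) : R := (INR n ^ 2 + 4 * INR n + 6) * (/2) ^ n.

Lemma hseries_S (n : nat) : hseries (S n) + INR (S n) ^ 2 * (/2) ^ S n = hseries n.
Proof. unfold hseries. rewrite S_INR. simpl. field. Qed.

(** The threshold 17 is the least integer above 16, as n exceeds 16k^2; 8/320 = 1/40 becomes the
    exponent of T in the length of the polynomials. *)
Lemma hseries_small (n : nat) : (17 <= n)%nat -> 0 <= hseries n <= / 320.
Proof.
  intros H. split.
  - unfold hseries. pose proof (pos_INR n). apply Rmult_le_pos; [nra|apply pow_le; lra].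
  - induction H as [|n _ IH].
    + unfold hseries. simpl. lra.
    + pose proof (hseries_S n). assert (0 <= INR (S n) ^ 2 * (/2) ^ S n); [|lra].
      apply Rmult_le_pos; [apply pow2_ge_0|apply pow_le; lra].
Qed.

(** * Combination of the ranges *)

Section Assembly.
Variables (k : R) (L i0 : nat).
Hypothesis Hk : 1 < k.
Hypothesis Hi0 : k <= INR i0.

(** The product of the bounds for the single ranges; it bounds both the length and the weight. *)
Definition length_bound (j : nat) : R :=
  (fix go j := match j with
   | O => 1
   | S j' => go j' * ((INR (dexp2 (i0 + j'))) ^ 2) ^ (4 * (L - (i0 + j')) ^ 2)
   end) j.

Lemma i0_ge2 : (2 <= i0)%nat.
Proof. destruct i0 as [|[|n]]; simpl in Hi0; [lra|lra|lia]. Qed.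

Lemma dexp2_large (j : nat) : 4 ^ (i0 + j) <= INR (dexp2 (i0 + j)) /\
  16 <= INR (dexp2 (i0 + j)) /\ 2 * k <= INR (dexp2 (i0 + j)).
Proof.
  pose proof i0_ge2. assert (H4 := dexp2_ge (i0 + j) ltac:(lia)).
  split; [exact H4|].
  assert (H16 : 16 <= 4 ^ (i0 + j)).
  { replace 16 with (4 ^ 2) by ring. apply Rle_pow; [lra|lia]. }
  split; [lra|].
  assert (H2 : 2 * INR (i0 + j) <= 4 ^ (i0 + j)).
  { replace 4 with (2 * 2) by ring. rewrite Rpow_mult_distr.
    pose proof (pow2_ge_INR (i0 + j)).
    assert (2 ^ 1 <= 2 ^ (i0 + j)) by (apply Rle_pow; [lra|lia]).
    pose proof (pos_INR (i0 + j)). rewrite pow_1 in *. nra. }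
  rewrite plus_INR in H2. pose proof (pos_INR j). lra.
Qed.

Lemma length_bound_ge1 (j : nat) : 1 <= length_bound j.
Proof.
  induction j as [|j IH]; [simpl; lra|].
  change (length_bound (S j)) with (length_bound j * ((INR (dexp2 (i0 + j))) ^ 2) ^ (4 * (L - (i0 + j)) ^ 2)).
  destruct (dexp2_large j) as [_ [H _]].
  rewrite <- (Rmult_1_l 1). apply Rmult_le_compat; try lra.
  apply pow_R1_Rle. simpl. nra.
Qed.

(** Range i has logarithmic length 8 n^2 2^i ln 2 = 8 ln 2 2^L n^2 2^(-n) with n = L - i; these sum
    to a tail of the series of n^2 / 2^n. *)
Lemma ln_length_bound (j : nat) : (i0 + j <= L)%nat ->
  ln (length_bound j) <= 8 * ln 2 * 2 ^ L * hseries (L - (i0 + j)).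
Proof.
  assert (L2 : 0 < ln 2) by (rewrite <- ln_1; apply ln_increasing; lra).
  assert (P2 : 0 < 2 ^ L) by (apply pow_lt; lra).
  induction j as [|j IH]; intros Hj.
  - simpl. rewrite ln_1. apply Rmult_le_pos; [nra|].
    unfold hseries. pose proof (pos_INR (L - (i0 + 0))). apply Rmult_le_pos; [nra|apply pow_le; lra].
  - change (length_bound (S j)) with (length_bound j * ((INR (dexp2 (i0 + j))) ^ 2) ^ (4 * (L - (i0 + j)) ^ 2)).
    destruct (dexp2_large j) as [_ [HX _]]. pose proof (length_bound_ge1 j) as HN.
    rewrite ln_mult by (try lra; apply pow_lt, pow_lt; lra).
    rewrite ln_pow by (apply pow_lt; lra). rewrite ln_pow by lra.
    rewrite ln_dexp2. specialize (IH ltac:(lia)).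
    set (n := (L - (i0 + S j))%nat).
    replace (L - (i0 + j))%nat with (S n) in * by (unfold n; lia).
    pose proof (hseries_S n) as E. rewrite <- E, Rmult_plus_distr_l.
    apply Rplus_le_compat; [exact IH|]. right.
    rewrite mult_INR, pow_INR. simpl (INR 4). simpl (INR 2).
    assert (EL : 2 ^ L = 2 ^ (i0 + j) * 2 ^ S n).
    { rewrite <- pow_add. f_equal. unfold n. lia. }
    rewrite EL, pow_inv. field. apply pow_nonzero. lra.
Qed.

(** Each subtracted term is the telescoped total of a loss per range. The loss 4 k^5 4^(-i), from
    the squares of 1/p, sums to the term with 16/3; truncation costs at most 4 k 2^(-n); and the
    maximum grows by 1 with each range where B = 1, which loses k^2 (k-1) times a prime sum of at
    most 2. *)
Lemma assemble (n1 j : nat) : 16 * k ^ 2 <= INR n1 -> (i0 + j + n1 <= L)%nat ->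
  let c := 2 * k ^ 2 / (k - 1) in
  exists lv lw lg, 0 <= lv /\ 0 <= lw /\ 0 <= lg /\
    resonator k (dexp2 i0) (dexp2 (i0 + j)) (length_bound j) (length_bound j) lv lw lg /\
    k ^ 2 * rsum rinv (pint (dexp2 i0) (dexp2 (i0 + j)))
      - 16/3 * k ^ 5 * ((/4) ^ i0 - (/4) ^ (i0 + j))
      - 4 * k * ((/2) ^ (L - (i0 + j)) - (/2) ^ (L - i0))
      - 2 * k ^ 2 * (k - 1) * Rmax 0 (c - INR (L - (i0 + j)))
    <= 2 * k * lg - k * lv - (k - 1) * lw.
Proof.
  intros Hn1 Hj c. induction j as [|j IH].
  - exists 0, 0, 0. split; [lra|]. split; [lra|]. split; [lra|]. split.
    + rewrite Nat.add_0_r. apply resonator_nil, Hk.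
    + rewrite Nat.add_0_r. unfold pint. rewrite Nat.sub_diag. simpl (rsum _ _).
      pose proof (Rmax_l 0 (c - INR (L - i0))).
      assert (0 <= 2 * k ^ 2 * (k - 1)) by (pose proof (pow2_ge_0 k); nra). nra.
  - destruct (IH ltac:(lia)) as [lv [lw [lg [Hlv [Hlw [Hlg [HP HE]]]]]]]. clear IH.
    set (i := (i0 + j)%nat) in *. set (n := (L - i)%nat) in *.
    assert (Hnn : 16 * k ^ 2 <= INR n).
    { eapply Rle_trans; [exact Hn1|]. apply le_INR. unfold n, i. lia. }
    destruct (dexp2_large j) as [X4 [X16 Xk]]. fold i in X4, X16, Xk.
    pose proof (S0_bounds i) as HS. set (Si := rsum rinv (ilist i)) in *.
    set (Xi := INR (dexp2 i)) in *.
    assert (Hh : 0 < (/2) ^ n) by (apply pow_lt; lra).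
    assert (HXi : 2 / Xi <= 2 * (/4) ^ i).
    { unfold Rdiv. apply Rmult_le_compat_l; [lra|]. rewrite pow_inv.
      apply Rinv_le_contravar; [apply pow_lt; lra|exact X4]. }
    assert (HXi0 : 0 < 2 / Xi) by (apply Rdiv_lt_0_compat; lra).
    assert (Er : rsum rinv (pint (dexp2 i0) (dexp2 (i0 + S j))) = rsum rinv (pint (dexp2 i0) (dexp2 i)) + Si).
    { rewrite (pint_app (dexp2 i0) (dexp2 i)).
      - rewrite rsum_app. f_equal. unfold Si, ilist. rewrite Nat.add_succ_r. reflexivity.
      - split; apply dexp2_mono; unfold i; lia. }
    assert (E4 : (/4) ^ (i0 + S j) = (/4) ^ i * /4).
    { rewrite Nat.add_succ_r. simpl. unfold i. ring. }
    assert (E2 : (/2) ^ (L - (i0 + S j)) = 2 * (/2) ^ n).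
    { unfold n, i. replace (L - (i0 + j))%nat with (S (L - (i0 + S j))) by lia. simpl. field. }
    assert (En : INR (L - (i0 + S j)) = INR n - 1).
    { unfold n, i. replace (L - (i0 + j))%nat with (S (L - (i0 + S j))) by lia. rewrite S_INR. ring. }
    assert (HXm : (dexp2 i0 <= dexp2 i <= dexp2 (S i))%nat) by (split; apply dexp2_mono; unfold i; lia).
    assert (Kc : 0 < 2 * k ^ 2 * (k - 1)).
    { apply Rmult_lt_0_compat; [|lra]. apply Rmult_lt_0_compat; [lra|apply pow_lt; lra]. }
    assert (K5 : 0 < k ^ 5) by (apply pow_lt; lra).
    replace (i0 + S j)%nat with (S i) in * by (unfold i; lia).
    (* If n >= c, the main terms combine to k^2 Si (2k - k - (k - 1)) = k^2 Si; otherwise to (2k^2 -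
       k^3) Si = k^2 Si - k^2 (k - 1) Si. *)
    destruct (Rle_lt_dec c (INR n)) as [Hc|Hc].
    + pose proof (interval_full i X16 k n Hk Hnn Hc Xk) as HI. fold Si Xi in HI.
      set (g := Rmax 0 (k ^ 2 * Si - k ^ 4 * (2 / Xi) - (/2) ^ n)) in *.
      exists (lv + k ^ 2 * Si), (lw + (k ^ 2 * Si + 2 * (/2) ^ n)), (lg + g).
      assert (Hg0 : 0 <= g) by apply Rmax_l.
      assert (Hg1 : k ^ 2 * Si - k ^ 4 * (2 / Xi) - (/2) ^ n <= g) by apply Rmax_r.
      assert (0 <= k ^ 2 * Si) by (apply Rmult_le_pos; [apply pow2_ge_0|lra]).
      split; [lra|]. split; [lra|]. split; [lra|].
      split; [exact (resonator_app k _ _ _ _ _ _ _ _ _ _ _ _ _ HXm HP HI)|].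
      rewrite Er, E4, E2, En.
      assert (R1 : Rmax 0 (c - INR n) <= Rmax 0 (c - (INR n - 1))) by (apply Rle_max_compat_l; lra).
      assert (R2 : 2 * k ^ 2 * (k - 1) * Rmax 0 (c - INR n) <= 2 * k ^ 2 * (k - 1) * Rmax 0 (c - (INR n - 1)))
        by (apply Rmult_le_compat_l; lra).
      assert (G2 : 2 * k * (k ^ 2 * Si - k ^ 4 * (2 / Xi) - (/2) ^ n) <= 2 * k * g)
        by (apply Rmult_le_compat_l; lra).
      assert (G3 : 2 * k * k ^ 4 * (2 / Xi) <= 2 * k * k ^ 4 * (2 * (/4) ^ i)).
      { apply Rmult_le_compat_l; [|exact HXi]. apply Rmult_le_pos; [lra|apply pow_le; lra]. }
      replace (2 * k * k ^ 4 * (2 * (/4) ^ i)) with (4 * k ^ 5 * (/4) ^ i) in G3 by ring.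
      set (q := (/4) ^ i) in *. set (h := (/2) ^ n) in *. set (R := Rmax 0 (c - (INR n - 1))) in *.
      set (R' := Rmax 0 (c - INR n)) in *. set (S1 := rsum rinv (pint (dexp2 i0) (dexp2 i))) in *.
      set (qi := (/4) ^ i0) in *. set (h0 := (/2) ^ (L - i0)) in *. set (u := 2 / Xi) in *.
      assert (k * h > 0) by nra.
      lra.
    + pose proof (interval_middle i X16 k n Hk Hnn Xk) as HI. fold Si Xi in HI.
      set (g := Rmax 0 (k * Si - k ^ 2 * (2 / Xi) - (/2) ^ n)) in *.
      exists (lv + k ^ 2 * Si), (lw + 0), (lg + g).
      assert (Hg0 : 0 <= g) by apply Rmax_l.
      assert (Hg1 : k * Si - k ^ 2 * (2 / Xi) - (/2) ^ n <= g) by apply Rmax_r.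
      assert (0 <= k ^ 2 * Si) by (apply Rmult_le_pos; [apply pow2_ge_0|lra]).
      split; [lra|]. split; [lra|]. split; [lra|].
      split; [exact (resonator_app k _ _ _ _ _ _ _ _ _ _ _ _ _ HXm HP HI)|].
      rewrite Er, E4, E2, En.
      assert (R1 : Rmax 0 (c - (INR n - 1)) = Rmax 0 (c - INR n) + 1).
      { rewrite !Rmax_right by lra. ring. }
      rewrite R1.
      assert (G2 : 2 * k * (k * Si - k ^ 2 * (2 / Xi) - (/2) ^ n) <= 2 * k * g)
        by (apply Rmult_le_compat_l; lra).
      assert (G3 : 2 * k * k ^ 2 * (2 / Xi) <= 2 * k * k ^ 4 * (2 * (/4) ^ i)).
      { apply Rmult_le_compat; [|lra| |exact HXi].
        - apply Rmult_le_pos; [lra|apply pow2_ge_0].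
        - apply Rmult_le_compat_l; [lra|]. apply Rle_pow; [lra|lia]. }
      replace (2 * k * k ^ 4 * (2 * (/4) ^ i)) with (4 * k ^ 5 * (/4) ^ i) in G3 by ring.
      assert (G4 : k ^ 2 * (k - 1) * Si <= k ^ 2 * (k - 1) * 2).
      { apply Rmult_le_compat_l; [|lra]. apply Rmult_le_pos; [apply pow2_ge_0|lra]. }
      set (q := (/4) ^ i) in *. set (h := (/2) ^ n) in *.
      set (R' := Rmax 0 (c - INR n)) in *. set (S1 := rsum rinv (pint (dexp2 i0) (dexp2 i))) in *.
      set (qi := (/4) ^ i0) in *. set (h0 := (/2) ^ (L - i0)) in *. set (u := 2 / Xi) in *.
      assert (k * h > 0) by nra.
      lra.
Qed.
End Assembly.

(** * Numerical estimates and conclusion *)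

Lemma ln2_le : ln 2 <= 7/10.
Proof.
  rewrite <- (ln_exp (7/10)). apply ln_le; [lra|].
  eapply Rle_trans; [|apply (exp_ge_taylor (7/10) 3); lra]. simpl. lra.
Qed.

Lemma four_pow_ge (i : nat) : (1 <= i)%nat -> 4 * INR i <= 4 ^ i.
Proof.
  induction 1 as [|i Hi IH]; [simpl; lra|]. rewrite S_INR. simpl.
  assert (1 <= INR i) by (apply (le_INR 1); assumption). lra.
Qed.

(** With T = exp tau and M about T^(3/2), the endpoint error M^(1/2) / T and the midpoint error T^2
    M^(-3/2) are both of order T^(-1/4), which explains the length. *)
Lemma zeta_approx (zeta : C -> C) (tau t : R) (M : nat) :
  is_riemann_zeta zeta -> 1 <= tau -> exp tau / 2 <= t <= exp tau ->
  exp (3/2 * tau) <= INR M <= 2 * exp (3/2 * tau) ->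
  Cmod (Cminus (zeta (/2, t)) (csum (fun i => cpw (INR (S i)) (/2, t)) M))
    <= 8 * exp (- tau / 4).
Proof.
  intros Hz Htau Ht HM.
  assert (HT : 2 <= exp tau) by (pose proof (exp_ineq1_le tau); lra).
  assert (HM1 : 1 <= exp (3/2 * tau)) by (pose proof (exp_ineq1_le (3/2 * tau)); lra).
  assert (HMn : (1 <= M)%nat) by (apply INR_le; simpl; lra).
  pose proof (zeta_partial_sum zeta t M Hz ltac:(lra) HMn) as H. cbv zeta in H.
  eapply Rle_trans; [exact H|]. clear H.
  replace (8 * exp (- tau / 4)) with (4 * exp (- tau / 4) + 4 * exp (- tau / 4)) by ring.
  apply Rplus_le_compat.
  - assert (E : Rpower (INR M + /2) (/2) <= 2 * exp (3/4 * tau)).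
    { rewrite Rpower_sqrt by lra. rewrite <- (sqrt_pow2 (2 * exp (3/4 * tau))).
      - apply sqrt_le_1_alt.
        replace ((2 * exp (3/4 * tau)) ^ 2) with (4 * exp (3/2 * tau)); [lra|].
        replace (3/2 * tau) with (3/4 * tau + 3/4 * tau) by field. rewrite exp_plus. ring.
      - pose proof (exp_pos (3/4 * tau)). lra. }
    apply Rle_trans with (2 * exp (3/4 * tau) / (exp tau / 2)).
    + unfold Rdiv. apply Rmult_le_compat.
      * left; apply exp_pos.
      * left. apply Rinv_0_lt_compat. lra.
      * exact E.
      * apply Rinv_le_contravar; lra.
    + right. replace (- tau / 4) with (3/4 * tau + - tau) by field.
      rewrite exp_plus, exp_Ropp. field. lra.
  - assert (S1 : Cmod (/2, t) <= 2 * exp tau).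
    { replace ((/2, t) : C) with (Cplus (RtoC (/2)) (Cmult Ci (RtoC t)))
        by (unfold Cplus, Cmult, Ci, RtoC; simpl; f_equal; ring).
      eapply Rle_trans; [apply Cmod_triangle|].
      rewrite Cmod_mult, Cmod_Ci, !Cmod_R, !Rabs_right by lra. lra. }
    assert (S2 : Cmod (Cplus (/2, t) (RtoC 1)) <= 2 * exp tau).
    { replace (Cplus (/2, t) (RtoC 1)) with (Cplus (RtoC (3/2)) (Cmult Ci (RtoC t)))
        by (unfold Cplus, Cmult, Ci, RtoC; simpl; f_equal; field).
      eapply Rle_trans; [apply Cmod_triangle|].
      rewrite Cmod_mult, Cmod_Ci, !Cmod_R, !Rabs_right by lra. lra. }
    assert (S3 : Rpower (INR M) (- (3/2)) <= exp (- (9/4) * tau)).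
    { eapply Rle_trans; [apply (Rpower_antitone (exp (3/2 * tau))); lra|].
      unfold Rpower. rewrite ln_exp. right. f_equal. field. }
    apply Rle_trans with (2 * exp tau * (2 * exp tau) * exp (- (9/4) * tau)).
    + apply Rmult_le_compat.
      * apply Rmult_le_pos; apply Cmod_ge_0.
      * left; apply exp_pos.
      * apply Rmult_le_compat; try apply Cmod_ge_0; assumption.
      * exact S3.
    + right. replace (- tau / 4) with (tau + (tau + - (9/4) * tau)) by field.
      rewrite !exp_plus. ring.
Qed.

Lemma two_pow_le_exp (n : nat) : 2 ^ n <= exp (INR n).
Proof.
  rewrite <- (Rmult_1_r (INR n)), exp_INR_mult. apply pow_incr.
  pose proof (exp_ineq1_le 1). lra.
Qed.

Theorem theorem1 (zeta : C -> C) (Hzeta : is_riemann_zeta zeta)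
    (k : R) (Hk : 1 < k) :
  exists T0 : R, forall T : R, T0 <= T ->
    zeta_moment zeta k T >= exp (- 30 * k ^ 4) * T * rpow (ln T) (k ^ 2).
Proof.
  assert (Hk2 : 1 < k ^ 2) by (simpl; nra).
  (* The last ranges, with n <= [n1], are discarded; 16k^2 < n1 <= 16k^2 + 1. *)
  destruct (nfloor_ex (16 * k ^ 2) ltac:(lra)) as [m0 [Hm1 Hm2]].
  set (n1 := S m0). assert (En1 : INR n1 = INR m0 + 1) by apply S_INR.
  assert (Hn17 : (17 <= n1)%nat).
  { assert (16 < n1)%nat; [|lia]. apply INR_lt. simpl (INR 16). lra. }
  (* The first range has index [i0], with k < i0 <= k + 1; this makes 4^i0 at least 4k, so that the
     loss k^5 4^(-i0) is O(k^4). *)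
  destruct (nfloor_ex k ltac:(lra)) as [q0 [Hq1 Hq2]].
  set (i0 := S q0). assert (Ei0 : INR i0 = INR q0 + 1) by apply S_INR.
  (* The bound exp 100 absorbs the numerical constants; the other makes [L] exceed [n1 + i0], so
     that some ranges remain. *)
  exists (Rmax (exp 100) (INR (dexp2 (n1 + i0 + 1)))). intros T HT0.
  assert (HT1 : exp 100 <= T) by (eapply Rle_trans; [apply Rmax_l|exact HT0]).
  assert (HT2 : INR (dexp2 (n1 + i0 + 1)) <= T) by (eapply Rle_trans; [apply Rmax_r|exact HT0]).
  clear HT0.
  assert (HT3 : 101 <= T) by (pose proof (exp_ineq1_le 100); lra).
  set (tau := ln T). assert (ET : exp tau = T) by (apply exp_ln; lra).
  assert (Htau : 100 <= tau) by (rewrite <- (ln_exp 100); apply ln_le; [apply exp_pos|assumption]).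
  destruct (dexp2_bracket T ltac:(lra)) as [L [HL1 HL2]].
  assert (HL : (n1 + i0 + 1 <= L)%nat).
  { apply Nat.nlt_ge. intros Hlt.
    assert (INR (dexp2 (S L)) <= INR (dexp2 (n1 + i0 + 1))) by (apply le_INR, dexp2_mono; lia). lra. }
  set (j := (L - n1 - i0)%nat).
  assert (Ej : (i0 + j = L - n1)%nat) by (unfold j; lia).
  destruct (assemble k L i0 Hk ltac:(lra) n1 j ltac:(lra) ltac:(lia))
    as [lv [lw [lg [Hlv [Hlw [Hlg [HP HE]]]]]]].
  set (NJ := length_bound L i0 j) in *.
  assert (HN1 : 1 <= NJ) by (apply (length_bound_ge1 k); lra).
  assert (L2 : 0 < ln 2) by (rewrite <- ln_1; apply ln_increasing; lra).
  assert (HNJ : NJ <= exp (tau / 40)).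
  { rewrite <- (exp_ln NJ) by lra. apply exp_le_exp.
    pose proof (ln_length_bound k L i0 Hk ltac:(lra) j ltac:(lia)) as H. fold NJ in H.
    rewrite Ej in H. replace (L - (L - n1))%nat with n1 in H by lia.
    pose proof (hseries_small n1 Hn17) as Hh.
    assert (HX : 2 ^ L * ln 2 <= tau).
    { rewrite <- ln_dexp2. apply ln_le; [|assumption].
      apply lt_0_INR. unfold dexp2. pose proof (Nat.pow_nonzero 2 (2 ^ L)). lia. }
    assert (0 < 2 ^ L) by (apply pow_lt; lra).
    eapply Rle_trans; [exact H|].
    replace (8 * ln 2 * 2 ^ L * hseries n1) with (8 * hseries n1 * (2 ^ L * ln 2)) by ring.
    apply Rle_trans with (/40 * (2 ^ L * ln 2)); [apply Rmult_le_compat_r; nra|lra]. }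
  assert (HN2 : NJ ^ 2 <= exp (tau / 20)).
  { replace (tau / 20) with (tau / 40 + tau / 40) by field. rewrite exp_plus.
    simpl. rewrite Rmult_1_r. apply Rmult_le_compat; lra. }
  assert (HN21 : 1 <= NJ ^ 2) by (apply pow_R1_Rle, HN1).
  assert (Big : 128 <= exp 10).
  { pose proof (two_pow_le_exp 10) as H. simpl in H. simpl.
    replace (1 + 1 + 1 + 1 + 1 + 1 + 1 + 1 + 1 + 1) with 10 in H by ring. lra. }
  set (Y := exp (3/2 * tau)).
  assert (HY : 1 <= Y) by (unfold Y; pose proof (exp_ineq1_le (3/2 * tau)); lra).
  destruct (nfloor_ex Y ltac:(lra)) as [M0 [HM1 HM2]].
  set (M := S M0). assert (EM : INR M = INR M0 + 1) by apply S_INR.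
  assert (HM : Y <= INR M <= 2 * Y) by lra.
  assert (Hsq : sqrt (INR M) <= 2 * exp (3/4 * tau)).
  { rewrite <- (sqrt_pow2 (2 * exp (3/4 * tau))) by (pose proof (exp_pos (3/4 * tau)); lra).
    apply sqrt_le_1_alt.
    replace ((2 * exp (3/4 * tau)) ^ 2) with (4 * Y); [lra|].
    unfold Y. replace (3/2 * tau) with (3/4 * tau + 3/4 * tau) by field. rewrite exp_plus. ring. }
  assert (Main : T / 2 * exp (2 * k * (lg - ln 2) - k * (lv + ln 2) - (k - 1) * (lw + ln 2))
     <= zeta_moment zeta k T).
  { apply (moment_from_resonator zeta Hzeta k (dexp2 i0) (dexp2 (i0 + j)) NJ NJ lv lw lg T (8 * exp (- tau / 4)) M);
      try assumption; try lra.
    - eapply Rle_trans; [exact HN2|]. apply Rle_trans with Y; [apply exp_le_exp; lra|lra].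
    - intros t Ht. apply zeta_approx; try assumption; rewrite ?ET; lra.
    (* The product is 128 T^(17/20), and 128 <= T^(3/20). *)
    - apply Rle_trans with (64 * exp (tau / 20) * exp (tau / 20) * (2 * exp (3/4 * tau))).
      + pose proof (sqrt_pos (INR M)).
        apply Rmult_le_compat; [|assumption| |assumption].
        * apply Rmult_le_pos; lra.
        * apply Rmult_le_compat; lra.
      + replace (64 * exp (tau / 20) * exp (tau / 20) * (2 * exp (3 / 4 * tau)))
          with (128 * exp (17/20 * tau)).
        2: { replace (17/20 * tau) with (tau / 20 + (tau / 20 + 3/4 * tau)) by field.
             rewrite !exp_plus. ring. }
        rewrite <- ET. replace tau with (3/20 * tau + 17/20 * tau) at 2 by field.
        rewrite exp_plus. apply Rmult_le_compat_r; [left; apply exp_pos|].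
        eapply Rle_trans; [exact Big|]. apply exp_le_exp. lra.
    - apply Rle_trans with (8 * exp (- tau / 4) * exp (tau / 20)).
      + apply Rmult_le_compat_l; [|assumption]. pose proof (exp_pos (- tau / 4)). lra.
      + rewrite Rmult_assoc, <- exp_plus.
        replace (- tau / 4 + tau / 20) with (- (tau / 5)) by field.
        rewrite exp_Ropp.
        assert (32 <= exp (tau / 5)).
        { apply Rle_trans with (exp 10); [lra|]. apply exp_le_exp. lra. }
        apply Rle_trans with (8 * / 32); [|lra].
        apply Rmult_le_compat_l; [lra|]. apply Rinv_le_contravar; lra. }
  apply Rle_ge. eapply Rle_trans; [|exact Main].
  assert (Hlt : 0 < tau) by lra.
  unfold rpow. fold tau. destruct (Rlt_dec 0 tau) as [_|]; [|lra].
  unfold Rpower. set (ll := ln tau).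
  (* Stopping [n1] ranges early divides the logarithm of the largest prime by at most 2^(n1 + 1),
     where the extra factor 2 comes from T < [dexp2 (S L)]; the double logarithm loses (n1 + 1) ln
     2. *)
  assert (Mert : ll - (INR n1 + 1) * ln 2 - 1 <= rsum rinv (pint 1 (dexp2 (L - n1)))).
  { assert (HX2 : (2 <= dexp2 (L - n1))%nat).
    { change 2%nat with (2 ^ 1)%nat at 1. unfold dexp2. apply pow2_mono.
      pose proof (Nat.pow_nonzero 2 (L - n1)). lia. }
    pose proof (mertens_lower _ HX2) as H. rewrite ln_dexp2 in H.
    assert (HT4 : tau <= 2 ^ (L - n1) * ln 2 * 2 ^ S n1).
    { replace (2 ^ (L - n1) * ln 2 * 2 ^ S n1) with (2 ^ (S L) * ln 2).
      - rewrite <- ln_dexp2. apply ln_le; lra.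
      - replace (S L) with ((L - n1) + S n1)%nat by lia. rewrite pow_add. ring. }
    assert (P : 0 < 2 ^ (L - n1) * ln 2) by (apply Rmult_lt_0_compat; [apply pow_lt|]; lra).
    apply ln_le in HT4; [|lra]. rewrite ln_mult in HT4; [|exact P|apply pow_lt; lra].
    rewrite (ln_pow 2) in HT4 by lra. rewrite S_INR in HT4. fold ll in HT4. lra. }
  assert (Stot : ll - (INR n1 + 1) * ln 2 - 3/2 - 2 * INR i0 <= rsum rinv (pint (dexp2 i0) (dexp2 (i0 + j)))).
  { rewrite Ej. pose proof (rsum_pint_dexp2 i0) as H0.
    rewrite (pint_app 1 (dexp2 i0) (dexp2 (L - n1))), rsum_app in Mert; [lra|].
    split; [unfold dexp2; pose proof (Nat.pow_nonzero 2 (2 ^ i0)); lia|apply dexp2_mono; lia]. }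
  set (St := rsum rinv (pint (dexp2 i0) (dexp2 (i0 + j)))) in *.
  rewrite Ej in HE. replace (L - (L - n1))%nat with n1 in HE by lia.
  assert (Loss1 : 16/3 * k ^ 5 * ((/4) ^ i0 - (/4) ^ (L - n1)) <= 4/3 * k ^ 4).
  { pose proof (four_pow_ge i0 ltac:(unfold i0; lia)) as H4.
    assert (P4 : 0 < 4 ^ i0) by (apply pow_lt; lra).
    assert (0 < (/4) ^ (L - n1)) by (apply pow_lt; lra).
    assert (K4 : 0 < k ^ 4) by (apply pow_lt; lra).
    assert (Hk4 : k * (/4) ^ i0 <= /4).
    { rewrite pow_inv. apply (Rmult_le_reg_r (4 ^ i0)); [assumption|].
      rewrite Rmult_assoc, Rinv_l by lra. lra. }
    apply Rle_trans with (16/3 * k ^ 4 * (k * (/4) ^ i0)).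
    - replace (16/3 * k ^ 4 * (k * (/4) ^ i0)) with (16/3 * k ^ 5 * (/4) ^ i0) by ring.
      apply Rmult_le_compat_l; [|lra]. pose proof (pow_lt k 5 ltac:(lra)). lra.
    - apply Rle_trans with (16/3 * k ^ 4 * /4); [apply Rmult_le_compat_l; lra|lra]. }
  assert (Loss2 : 4 * k * ((/2) ^ n1 - (/2) ^ (L - i0)) <= k).
  { assert (0 < (/2) ^ (L - i0)) by (apply pow_lt; lra).
    assert ((/2) ^ n1 <= /4).
    { replace n1 with (2 + (n1 - 2))%nat by lia. rewrite pow_add.
      assert (0 < (/2) ^ (n1 - 2) <= 1).
      { split; [apply pow_lt; lra|]. rewrite <- (pow1 (n1 - 2)). apply pow_incr. lra. }
      simpl ((/2) ^ 2). lra. }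
    nra. }
  (* The factor k - 1 in the loss per range cancels the k - 1 in the number of ranges, so the bound
     is uniform near k = 1. *)
  assert (Loss3 : 2 * k ^ 2 * (k - 1) * Rmax 0 (2 * k ^ 2 / (k - 1) - INR n1) <= 4 * k ^ 4).
  { assert (0 <= 2 * k ^ 2 * (k - 1)) by (apply Rmult_le_pos; lra).
    apply Rle_trans with (2 * k ^ 2 * (k - 1) * (2 * k ^ 2 / (k - 1))).
    - apply Rmult_le_compat_l; [assumption|]. apply Rmax_lub.
      + apply Rdiv_le_0_compat; lra.
      + lra.
    - right. field. lra. }
  (* With all powers of k bounded by k^4, the losses add up to 56/5 + 49/10 + 2 from the omitted
     primes, 4/3 + 1 + 4 from the ranges and 14/5 from the factors 2, less than 28 in total. *)
  assert (Hfin : - 30 * k ^ 4 + k ^ 2 * ll <= 2 * k * (lg - ln 2) - k * (lv + ln 2) - (k - 1) * (lw + ln 2) - ln 2).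
  { pose proof ln2_le as Hl2.
    assert (Hb : (INR n1 + 1) * ln 2 <= (16 * k ^ 2 + 2) * (7/10)) by (apply Rmult_le_compat; lra).
    assert (H1 : k ^ 2 * (ll - (16 * k ^ 2 + 2) * (7/10) - 3/2 - 2 * (k + 1)) <= k ^ 2 * St)
      by (apply Rmult_le_compat_l; lra).
    assert (Hkk : k ^ 2 <= k ^ 4) by (apply Rle_pow; [lra|lia]).
    assert (Hk3 : k ^ 3 <= k ^ 4) by (apply Rle_pow; [lra|lia]).
    assert (Hk1 : k <= k ^ 4) by (rewrite <- (pow_1 k) at 1; apply Rle_pow; [lra|lia]).
    assert (H5 : 4 * k * ln 2 <= 4 * k * (7/10)) by (apply Rmult_le_compat_l; lra).
    replace (k ^ 2 * (ll - (16 * k ^ 2 + 2) * (7 / 10) - 3 / 2 - 2 * (k + 1)))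
      with (k ^ 2 * ll - 56/5 * k ^ 4 - 49/10 * k ^ 2 - 2 * k ^ 3) in H1 by field.
    lra. }
  apply exp_le_exp in Hfin.
  unfold Rminus at 1 in Hfin. rewrite !exp_plus, exp_Ropp, exp_ln in Hfin by lra.
  apply (Rmult_le_compat_r T) in Hfin; [|lra].
  fold ll.
  match type of Hfin with _ <= ?e * / 2 * T => replace (e * /2 * T) with (T / 2 * e) in Hfin by field end.
  match goal with |- ?a <= _ => match type of Hfin with ?b <= _ =>
    replace a with b by ring end end.
  exact Hfin.
Qed.
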